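(* Let $P$ be the marginal Metropolis--Hastings kernel with target $\pi$ and proposal $q$, and for each $N\in\mathbb N$ let $\tilde P_N$ be the pseudo-marginal kernel, with invariant distribution $\tilde\pi_N$, built from weight distributions $\{Q^N_x\}_{x\in\mathsf X}$. Assume there exist a function $V:\mathsf X\times\mathsf W\to[1,\infty)$, a set $C\in\mathcal B(\mathsf X)\times\mathcal B(\mathsf W)$ with $\sup_{(x,w)\in C}V(x,w)<\infty$, and constants $\alpha\in(0,1]$, $b_V\in[0,\infty)$, $\varepsilon_V\in(0,\infty)$ and $N_0<\infty$ such that for all $N\ge N_0$ $$\tilde P_NV(x,w)\le V(x,w)-\varepsilon_VV^\alpha(x,w)+b_V\mathbb I\{(x,w)\in C\}\qquad\text{for all }x\in\mathsf X,\ w\in\mathsf W,$$ and that for any $v\in[1,\infty)$ there exist probability measures $\{\nu^N\}_{N\ge N_0}$ and a constant $\varepsilon_v\in(0,1]$ such that for all $N\ge N_0$ $$\tilde P_N(x,w;\cdot)\ge\varepsilon_v\nu^N(\cdot)\qquad\text{for all }(x,w)\in\mathsf X\times\mathsf W\text{ such that }V(x,w)\le v.$$ Let $g:\mathsf X\to\mathbb R$ and suppose that for some $\lambda\in[0,1)$ and $\kappa\in[0,1)$, with $\alpha_{\kappa,\lambda}:=\kappa\alpha(1-\lambda)$, $$\sup_{(x,w)\in\mathsf X\times\mathsf W}\frac{|g(x)|}{V^{\alpha_{\kappa,\lambda}}(x,w)}<\infty\quad\text{and}\quad\sup_{N\ge N_0}\tilde\pi_N\bigl((|g|+1)V^{1-\lambda\alpha}\bigr)<\infty.$$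 Then both of the following hold: the integrated autocorrelation time $\tau(g,P)$ is well defined and finite; and there exists a constant $N_0'<\infty$ such that $$\lim_{n\to\infty}\sup_{N\ge N_0'}\Bigl|\sum_{k=n}^\infty\mathbb E[\bar g(\tilde X_0^N)\bar g(\tilde X_k^N)]\Bigr|=0,\qquad\bar g=g-\pi(g),$$ where $(\tilde X_k^N,\tilde W_k^N)_{k\ge0}$ is the Markov chain with initial distribution $\tilde\pi_N$ and kernel $\tilde P_N$.
   Context: Let $(\mathsf X,\mathcal B(\mathsf X))$ be a measurable space, $\pi$ a probability measure on it and $q(x,\mathrm dy)$ a Markov kernel on $\mathsf X$. The function $r(x,y)=\frac{\pi(\mathrm dy)q(y,\mathrm dx)}{\pi(\mathrm dx)q(x,\mathrm dy)}$ is the Radon--Nikodym derivative in the sense of Tierney: there is a symmetric measurable set $R\subset\mathsf X^2$ on which the measures $\pi(\mathrm dx)q(x,\mathrm dy)$ and $\pi(\mathrm dy)q(y,\mathrm dx)$ are mutually absolutely continuous, and on whose complement they are mutually singular; on $R$, $r$ is the density of the second with respect to the first, with values in $(0,\infty)$ and $r(x,y)r(y,x)=1$; off $R$, $r:=0$. The marginal kernel is $P(x,\mathrm dy)=\min\{1,r(x,y)\}q(x,\mathrm dy)+\delta_x(\mathrm dy)\rho(x)$ with $\rho(x)=1-\int\min\{1,r(x,y)\}q(x,\mathrm dy)$. Let $\mathsf W$ be a Borel subset of $\mathbb R_+=[0,\infty)$. For each $N\in\mathbb N$, $x\mapsto Q_x^N$ is a probability kernel from $\mathsf X$ to $\mathsf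 W$ with $\int w\,Q_x^N(\mathrm dw)=1$ for all $x$. Put $\pi_x^N(\mathrm dw)=w\,Q_x^N(\mathrm dw)$ and $\tilde\pi_N(\mathrm dx,\mathrm dw)=\pi(\mathrm dx)\pi_x^N(\mathrm dw)$. The pseudo-marginal kernel is $\tilde P_N(x,w;\mathrm dy,\mathrm du)=\min\{1,r(x,y)\frac uw\}q(x,\mathrm dy)Q_y^N(\mathrm du)+\delta_{x,w}(\mathrm dy,\mathrm du)\tilde\rho_N(x,w)$ with $\tilde\rho_N(x,w)=1-\iint\min\{1,r(x,y)\frac uw\}q(x,\mathrm dy)Q_y^N(\mathrm du)$. (If $0\in\mathsf W$, read $\min\{1,r(x,y)u/w\}$ as $1$ for $w=0$; the set $\{w=0\}$ is $\tilde\pi_N$-null.) $\mathcal B(\mathsf X)\times\mathcal B(\mathsf W)$ is the product $\sigma$-algebra, $\mathbb I$ denotes an indicator, $\tilde P_NV(x,w)=\int\tilde P_N(x,w;\mathrm dy,\mathrm du)V(y,u)$, and $g$ is identified with $(x,w)\mapsto g(x)$ where needed. The integrated autocorrelation time is $\tau(g,P):=1+2\sum_{k=1}^\infty\frac{\mathbb E[g(X_0)g(X_k)]-\pi(g)^2}{\operatorname{var}_\pi(g)}$, where $(X_k)_{k\ge0}$ is the stationary chain with kernel $P$ and $X_0\sim\pi$, and $\operatorname{var}_\pi(g)=\pi((g-\pi(g))^2)$. *)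

(* Defs.v *)
From HB Require Import structures.
From mathcomp Require Import all_boot all_order all_algebra.
From mathcomp Require Import all_classical all_reals all_analysis.

Set Implicit Arguments.
Unset Strict Implicit.
Unset Printing Implicit Defensive.

Import Order.TTheory GRing.Theory Num.Theory.
Import numFieldNormedType.Exports.

Local Open Scope classical_set_scope.
Local Open Scope ring_scope.
Local Open Scope ereal_scope.

(* The kernels and laws below are explicit set functions; integrals against
   them are the library's integrals, which accept any set function. *)

Section tierney.
Context d (X : measurableType d) (R : realType).
Variables (pi : probability X R) (q : R.-pker X ~> X).

(* pi(dx) q(x, dy) *)
Definition proposal_law (A : set (X * X)) : \bar R :=
  \int[pi]_x q x (xsection A x).

(* pi(dy) q(y, dx), still as a law of the pair (x, y) *)
Definition proposal_law_rev (A : set (X * X)) : \bar R :=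
  \int[pi]_y q y (ysection A y).

(* The set S is the set on which the two laws are equivalent. *)
Record tierney_ratio (S : set (X * X)) (r : X -> X -> R) : Prop := {
  tierney_measurable_set : measurable S ;
  tierney_symmetric : forall x y, S (x, y) -> S (y, x) ;
  tierney_equivalent : forall A, measurable A -> A `<=` S ->
    (proposal_law A = 0 <-> proposal_law_rev A = 0) ;
  tierney_singular : exists B, [/\ measurable B, B `<=` ~` S,
    proposal_law B = 0 & proposal_law_rev (~` S `\` B) = 0] ;
  tierney_measurable : measurable_fun setT (fun z : X * X => r z.1 z.2) ;
  tierney_density : forall A, measurable A -> A `<=` S ->
    proposal_law_rev A = \int[proposal_law]_(z in A) (r z.1 z.2)%:E ;
  tierney_gt0 : forall x y, S (x, y) -> (0 < r x y)%R ;
  tierney_recip : forall x y, S (x, y) -> (r x y * r y x = 1)%R ;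
  tierney_off : forall x y, ~ S (x, y) -> r x y = 0%R
}.

End tierney.

Section marginal.
Context d (X : measurableType d) (R : realType).
Variables (q : R.-pker X ~> X) (r : X -> X -> R).

Definition mh_kernel (x : X) (A : set X) : \bar R :=
  \int[q x]_(y in A) (Num.min 1 (r x y))%:E
  + \d_x A * (1 - \int[q x]_y (Num.min 1 (r x y))%:E).

End marginal.

(* The weight space is a Borel set W of reals, and X x W is represented inside
   X * R: weight integrals range over W only. *)
Section pseudo_marginal.
Context d (X : measurableType d) (R : realType).
Variables (W : set R) (Q : R.-pker X ~> R).

Definition pm_target (pi : probability X R) (A : set (X * R)) : \bar R :=
  \int[pi]_x \int[Q x]_(w in W `&` xsection A x) w%:E.

Variables (q : R.-pker X ~> X) (r : X -> X -> R).

(* On nonnegative weights the second branch is the convention at w = 0. *)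
Definition pm_accept (x : X) (w : R) (y : X) (u : R) : R :=
  if (0 < w)%R then Num.min 1%R (r x y * (u / w))%R else 1%R.

Definition pm_kernel (z : X * R) (A : set (X * R)) : \bar R :=
  \int[q z.1]_y \int[Q y]_(u in W `&` xsection A y) (pm_accept z.1 z.2 y u)%:E
  + \d_z A *
    (1 - \int[q z.1]_y \int[Q y]_(u in W) (pm_accept z.1 z.2 y u)%:E).

End pseudo_marginal.

Section markov_chain.
Context dO (Om : measurableType dO) d (E : measurableType d) (R : realType).

(* Z has initial law mu and transition kernel K; the Markov property is stated
   on the events {Z_0 in A_0, ..., Z_n in A_n}, which generate the past. *)
Definition markov_chain (mu : set E -> \bar R) (K : E -> set E -> \bar R)
    (Pr : probability Om R) (Z : nat -> {RV Pr >-> E}) : Prop :=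
  (forall A, measurable A -> Pr (Z 0%N @^-1` A) = mu A) /\
  (forall (n : nat) (A : nat -> set E) (B : set E),
     (forall i, measurable (A i)) -> measurable B ->
     let H := \bigcap_(i in `I_n.+1) (Z i @^-1` A i) in
     Pr (H `&` Z n.+1 @^-1` B) = \int[Pr]_(o in H) K (Z n o) B).

(* E[f(Z_0) f(Z_k)] *)
Definition joint_moment (Pr : probability Om R) (Z : nat -> {RV Pr >-> E})
    (f : E -> R) (k : nat) : \bar R :=
  'E_Pr[fun o => (f (Z 0%N o) * f (Z k o))%R].

Definition joint_moment_defined (Pr : probability Om R)
    (Z : nat -> {RV Pr >-> E}) (f : E -> R) (k : nat) : Prop :=
  Pr.-integrable setT (fun o => (f (Z 0%N o) * f (Z k o))%:E).

(* The integrated autocorrelation time computed along the stationary chain Z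
   is well defined and equal to the real number tau.  If the variance is zero,
   the quotients are 0 since x / 0 = 0. *)
Definition has_iact (mu : probability E R) (Pr : probability Om R)
    (Z : nat -> {RV Pr >-> E}) (g : E -> R) (tau : R) : Prop :=
  (forall k, joint_moment_defined Z g k) /\
  (fun n => 1 + 2 * \sum_(1 <= k < n.+1)
     ((fine (joint_moment Z g k) - fine 'E_mu[g] ^+ 2) / fine 'V_mu[g]))%R
    @ \oo --> tau.

End markov_chain.

(* Main.v *)
Require Import Defs.
From HB Require Import structures.
From mathcomp Require Import all_boot all_order all_algebra.
From mathcomp Require Import all_classical all_reals all_analysis.
From mathcomp Require Import finmap measurable_realfun.
From mathcomp Require Import ring lra.

(** Write [P] for the Metropolis-Hastings operator and [T_N] for the
    pseudo-marginal one. Both are reversible, [P] for [pi] and [T_N] for a law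
    whose first marginal is [pi], so a function of [x] can be followed under
    either of them. The proof has two independent parts.

    The first part controls the tails of the autocovariance series under [T_N]
    with constants that depend on the drift and the minorization only, hence
    not on [N]. If [T U + c w <= U + b] holds and a minorization holds where
    [w] is not large, then the bound [f z - f z' <= (2 / c) (U z + U z' + 2 b
    / eps)] on the oscillation of [f], where [eps] is the constant of the
    minorization, survives the map [f |-> h + T f] whenever [|h| <= w]
    (osc_step): away from the small set the drift of [U] pays for [h], on it
    the minorization does. Taking for [U] two different powers of [V] bounds
    at once the partial sums of [T^k g], by a power smaller than [eta = 1 -
    lambda alpha], and [n T^n f] for bounded [f], by the power [eta].
    Truncating the partial sum at a high level combines the two: the
    oscillation of [\sum_(n <= k < n + m) T^k g] between [z] and [z'] is at
    most [delta (V^eta z + V^eta z' + K)], from a rank on that depends on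
    [delta] and the constants only (uniform_tail). Multiplied by [g] and
    integrated, this is the uniform decay of the tails (acov_tail_le,
    uniform_acov_tail).

    The second part transfers summability from one [T_N] to [P]. Averaging the
    acceptance probability over the two weights can only decrease it, because
    the minimum is concave; so the Dirichlet form of [T_N] on functions of [x]
    is below that of [P] (pm_dirichlet_le). The partial sums of an
    autocovariance series are given by a variational formula involving the
    Dirichlet form, and those of even length are therefore bounded under [P]
    (acov_psum_comparison). For a reversible operator the even autocovariances
    are nonnegative and the sum of an even one and of the next odd one is too,
    so it remains to see that the even ones tend to zero. For bounded
    functions this follows from minorizations of [P] on sets of mass
    arbitrarily close to one (acov_even_vanishes), which are inherited from
    those of [T_N] by looking at the same [x] with two different weights
    (mh_small).

    All this algebra is done for bounded functions, for which no integrability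
    question arises. A general [g] is the limit of its centred truncations;
    the bounds do not depend on the level of truncation, and the
    autocovariances along a stationary chain are the limits of those of the
    truncations by dominated convergence (chain_moment_cvg).

    The kernels of the statement are set functions. They are realized as
    measures by giving first the functional that integrates against them,
    which is an iterated integral, and by checking that it is a Daniell
    functional. *)

Set Implicit Arguments.
Unset Strict Implicit.
Unset Printing Implicit Defensive.

Import Order.TTheory GRing.Theory Num.Theory.
Import numFieldNormedType.Exports.

Local Open Scope classical_set_scope.
Local Open Scope ring_scope.

(** * Means, Markov operators and oscillation *)

Section means.
Context (R : realType) (E : Type).
Implicit Types (F : set (E -> R)) (I : (E -> R) -> R) (f g : E -> R).

(** The operators below act on different classes of functions (bounded ones,
    or ones dominated by a weight); the closure properties shared by these
    classes are all that the algebra uses. *)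
Record fun_space F : Prop := {
  fun_cst : forall c, F (fun=> c) ;
  fun_add : forall f g, F f -> F g -> F (fun x => f x + g x) ;
  fun_scale : forall c f, F f -> F (fun x => c * f x) }.

Record mean F I : Prop := {
  mean_add : forall f g, F f -> F g -> I (fun x => f x + g x) = I f + I g ;
  mean_scale : forall c f, F f -> I (fun x => c * f x) = c * I f ;
  mean_le : forall f g, F f -> F g -> (forall x, f x <= g x) -> I f <= I g ;
  mean_one : I (fun=> 1) = 1 }.

Variables (F : set (E -> R)) (I : (E -> R) -> R).
Hypotheses (sF : fun_space F) (mI : mean F I).

Lemma fun_opp f : F f -> F (fun x => - f x).
Proof.
move=> Ff; rewrite (_ : (fun x => _) = (fun x => -1 * f x)).
  exact: fun_scale.
by apply/funext => x; rewrite mulN1r.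
Qed.

Lemma fun_sub f g : F f -> F g -> F (fun x => f x - g x).
Proof. by move=> Ff Fg; apply: (fun_add sF Ff); exact: fun_opp. Qed.

Lemma fun_sum (h : nat -> E -> R) m n : (forall k, F (h k)) ->
  F (fun x => \sum_(m <= k < n) h k x).
Proof.
move=> Fh; elim: n => [|n IH].
  rewrite (_ : (fun x => _) = fun=> 0); first exact: fun_cst.
  by apply/funext => x; rewrite big_geq.
have [mn|mn] := leqP m n.
  rewrite (_ : (fun x => _) = fun x => \sum_(m <= k < n) h k x + h n x).
    exact: fun_add.
  by apply/funext => x; rewrite big_nat_recr.
rewrite (_ : (fun x => _) = fun=> 0); first exact: fun_cst.
by apply/funext => x; rewrite big_geq.
Qed.

Lemma mean_cst c : I (fun=> c) = c.
Proof.
rewrite (_ : (fun=> c) = (fun x : E => c * (fun=> 1) x)).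
  by rewrite (mean_scale mI) ?(mean_one mI) ?mulr1//; exact: fun_cst.
by apply/funext => x; rewrite mulr1.
Qed.

Lemma mean_opp f : F f -> I (fun x => - f x) = - I f.
Proof.
move=> Ff; rewrite (_ : (fun x => _) = (fun x => -1 * f x)).
  by rewrite (mean_scale mI)// mulN1r.
by apply/funext => x; rewrite mulN1r.
Qed.

Lemma mean_sub f g : F f -> F g -> I (fun x => f x - g x) = I f - I g.
Proof.
move=> Ff Fg; rewrite (mean_add mI) ?mean_opp//; exact: fun_opp.
Qed.

Lemma mean_ge0 f : F f -> (forall x, 0 <= f x) -> 0 <= I f.
Proof.
by move=> Ff f0; rewrite -(mean_cst 0); apply: (mean_le mI) => //; exact: fun_cst.
Qed.

Lemma mean_sum (h : nat -> E -> R) m n : (forall k, F (h k)) ->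
  I (fun x => \sum_(m <= k < n) h k x) = \sum_(m <= k < n) I (h k).
Proof.
move=> Fh; elim: n => [|n IH].
  rewrite big_geq// -[RHS](mean_cst 0); congr I.
  by apply/funext => x; rewrite big_geq.
have [mn|mn] := leqP m n.
  rewrite big_nat_recr//= -IH -(mean_add mI)//; last exact: fun_sum.
  by congr I; apply/funext => x; rewrite big_nat_recr.
rewrite big_geq// -[RHS](mean_cst 0); congr I.
by apply/funext => x; rewrite big_geq.
Qed.

Lemma mean_norm_le f g : F f -> F g -> (forall x, `|f x| <= g x) -> `|I f| <= I g.
Proof.
move=> Ff Fg fg; rewrite ler_norml; apply/andP; split.
  rewrite -mean_opp//; apply: (mean_le mI) => //; first exact: fun_opp.
  by move=> x; have := fg x; rewrite ler_norml => /andP[].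
apply: (mean_le mI) => // x.
by have := fg x; rewrite ler_norml => /andP[].
Qed.

End means.

Record markov_operator (R : realType) (E : Type) (F : set (E -> R))
    (T : (E -> R) -> E -> R) : Prop := {
  markov_fun : forall f, F f -> F (T f) ;
  markov_mean : forall z, mean F (fun f => T f z) }.

Section iterates.
Context (R : realType) (E : Type) (F : set (E -> R)) (T : (E -> R) -> E -> R).
Hypotheses (sF : fun_space F) (mT : markov_operator F T).

Lemma iter_fun n f : F f -> F (iter n T f).
Proof. by move=> Ff; elim: n => //= n IH; exact: (markov_fun mT). Qed.

Lemma iter_add n f g : F f -> F g ->
  iter n T (fun x => f x + g x) = (fun x => iter n T f x + iter n T g x).
Proof.
move=> Ff Fg; elim: n => //= n ->; apply/funext => x.
by apply: (mean_add (markov_mean mT x)); exact: iter_fun.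
Qed.

Lemma iter_scale n c f : F f ->
  iter n T (fun x => c * f x) = (fun x => c * iter n T f x).
Proof.
move=> Ff; elim: n => //= n ->; apply/funext => x.
by apply: (mean_scale (markov_mean mT x)); exact: iter_fun.
Qed.

Lemma iter_cst n c : iter n T (fun=> c) = (fun=> c).
Proof.
elim: n => //= n ->; apply/funext => x.
exact: (mean_cst sF (markov_mean mT x)).
Qed.

Lemma iter_sub n f g : F f -> F g ->
  iter n T (fun x => f x - g x) = (fun x => iter n T f x - iter n T g x).
Proof.
move=> Ff Fg; elim: n => //= n ->; apply/funext => x.
by apply: (mean_sub sF (markov_mean mT x)); exact: iter_fun.
Qed.

Lemma iter_sum i (h : nat -> E -> R) a b : (forall k, F (h k)) ->
  iter i T (fun x => \sum_(a <= k < b) h k x) =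
  (fun x => \sum_(a <= k < b) iter i T (h k) x).
Proof.
move=> Fh; elim: i => //= i ->; apply/funext => x.
by apply: (mean_sum sF (markov_mean mT x)) => k; exact: iter_fun.
Qed.

Lemma iter_norm_le n f c : F f -> (forall x, `|f x| <= c) ->
  forall x, `|iter n T f x| <= c.
Proof.
move=> Ff fc; elim: n => //= n IH x.
rewrite -[leRHS](mean_cst sF (markov_mean mT x) c).
apply: (mean_norm_le sF (markov_mean mT x)) => //; first exact: iter_fun.
exact: fun_cst.
Qed.

End iterates.

Section oscillation.
Context (R : realType) (E : Type) (F : set (E -> R)) (T : (E -> R) -> E -> R).
Hypotheses (sF : fun_space F) (mT : markov_operator F T).
Variables (U w : E -> R) (D : set E) (b c eps : R) (nu : (E -> R) -> R).
Hypotheses (FU : F U) (U0 : forall z, 0 <= U z)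
  (w0 : forall z, 0 <= w z) (b0 : 0 <= b) (c0 : 0 < c) (eps0 : 0 < eps)
  (drift : forall z, T U z + c * w z <= U z + b)
  (outside : forall z, ~ D z -> 4 * b <= c * w z)
  (mnu : mean F nu)
  (minor : forall z f, D z -> F f -> (forall y, 0 <= f y) -> eps * nu f <= T f z).

Definition osc_bounded (f : E -> R) :=
  forall z z', f z - f z' <= 2 / c * (U z + U z' + 2 * b / eps).

Let double_half : 2 * b / eps / 2 = b / eps.
Proof. by rewrite mulrAC (mulrC 2) mulfK// pnatr_eq0. Qed.

(** With [A = 2 / c] and [k = 2 b / eps], the supremum [s] of [f - A U]
    satisfies [f - A U <= s <= f + A U + A k] everywhere, so [f] is within [A
    U + A k / 2] of [s - A k / 2]. *)
Lemma osc_center f : osc_bounded f -> E ->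
  exists m : R, forall z, `|f z - m| <= 2 / c * (U z + b / eps).
Proof.
move=> of_ z0; set A := 2 / c in of_ *; set k := 2 * b / eps in of_.
have ub z' : ubound (range (fun y => f y - A * U y)) (f z' + A * U z' + A * k).
  by move=> _ [y _ <-]; have := of_ y z'; rewrite -/A -/k !mulrDr; lra.
have hs : has_sup (range (fun y => f y - A * U y)).
  split; last by exists (f z0 + A * U z0 + A * k); exact: ub.
  by exists (f z0 - A * U z0); exists z0.
exists (sup (range (fun y => f y - A * U y)) - A * k / 2) => z.
have h1 : f z - A * U z <= sup (range (fun y => f y - A * U y)).
  by apply: ub_le_sup; [case: hs|exists z].
have h2 : sup (range (fun y => f y - A * U y)) <= f z + A * U z + A * k.
  by apply: ge_sup; [case: hs|exact: ub].
have kE : A * (b / eps) = A * k / 2 by rewrite -mulrA double_half.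
by rewrite mulrDr kE ler_norml; apply/andP; split; lra.
Qed.

(** With [f] centred, [|f - m| <= phi] for [phi = A (U + k / 2)].  If one of
    the two points lies outside [D], there [c w >= 4 b] and the drift of [U]
    alone absorbs [h] and the two terms [b].  If both lie in [D], the
    minorization applied to [phi - f + m] and to [phi + f - m] improves the
    trivial bound by [2 eps nu phi >= eps A k], and the value [k = 2 b / eps]
    is the one for which this gain compensates the terms [b]. *)
Lemma osc_step h f : F h -> (forall z, `|h z| <= w z) -> F f ->
  osc_bounded f -> osc_bounded (fun z => h z + T f z).
Proof.
move=> Fh hw Ff of_ z z'.
have [m fm] := osc_center of_ z.
pose A := 2 / c; pose k := 2 * b / eps.
have A0 : 0 < A by rewrite divr_gt0.
have k0 : 0 <= k by rewrite divr_ge0 ?mulr_ge0// ltW.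
have epsk : eps * k = 2 * b by rewrite /k mulrC divfK// gt_eqF.
have Ac : A * c = 2 by rewrite /A divfK// gt_eqF.
pose fh y := f y - m; pose phi y := A * (U y + k / 2).
have fphi y : `|fh y| <= phi y.
  by rewrite /phi double_half; exact: fm.
have Ffh : F fh by apply: (fun_sub sF) => //; exact: fun_cst.
have FUk : F (fun y => U y + k / 2) by apply: (fun_add sF) => //; exact: fun_cst.
have Fphi : F phi by exact: fun_scale.
have TphiE x : T phi x = A * (T U x + k / 2).
  rewrite /phi (mean_scale (markov_mean mT x))//; congr (_ * _).
  rewrite (mean_add (markov_mean mT x))//; last exact: fun_cst.
  by rewrite (mean_cst sF (markov_mean mT x)).
have TfE x : T fh x = T f x - m.
  rewrite /fh (mean_sub sF (markov_mean mT x))//; last exact: fun_cst.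
  by rewrite (mean_cst sF (markov_mean mT x)).
have hz : h z - h z' <= w z + w z'.
  have := hw z; have := hw z'; rewrite !ler_norml => /andP[? ?] /andP[? ?]; lra.
have Tfz x : `|T fh x| <= T phi x.
  exact: (mean_norm_le sF (markov_mean mT x)).
have goalE : A * (U z + U z' + k) - (h z + T f z - (h z' + T f z'))
  = A * (U z + U z' + k) - (h z - h z') - (T fh z - T fh z').
  by rewrite !TfE; ring.
rewrite -/A -/k -subr_ge0 goalE.
have dz := ler_wpM2l (ltW A0) (drift z); have dz' := ler_wpM2l (ltW A0) (drift z').
have Acw x : A * (c * w x) = 2 * w x by rewrite mulrA Ac.
rewrite !mulrDr !Acw in dz dz'.
have [[Dz Dz']|nD] := pselect (D z /\ D z').
  have F1 : F (fun y => phi y - fh y) by exact: (fun_sub sF).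
  have F2 : F (fun y => phi y + fh y) by exact: fun_add.
  have e1 := minor Dz F1 _; have e2 := minor Dz' F2 _.
  have /e1 {}e1 : forall y, 0 <= phi y - fh y.
    by move=> y; have := fphi y; rewrite ler_norml => /andP[? ?]; lra.
  have /e2 {}e2 : forall y, 0 <= phi y + fh y.
    by move=> y; have := fphi y; rewrite ler_norml => /andP[? ?]; lra.
  rewrite (mean_sub sF mnu)// (mean_sub sF (markov_mean mT z))// in e1.
  rewrite (mean_add mnu)// (mean_add (markov_mean mT z'))// in e2.
  have nuphi : A * (k / 2) <= nu phi.
    rewrite -(mean_cst sF mnu (A * (k / 2))); apply: (mean_le mnu) => //.
      exact: fun_cst.
    by move=> y; apply: ler_wpM2l; [exact: ltW|rewrite lerDr].
  have := ler_wpM2l (ltW eps0) nuphi; rewrite mulrCA (mulrA eps) epsk.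
  have := w0 z; have := w0 z'; rewrite !TphiE in e1 e2.
  have : 0 <= A * b by rewrite mulr_ge0// ltW.
  rewrite !mulrDr in dz dz' e1 e2 *; lra.
have : 4 * (A * b) <= 2 * (w z + w z').
  have : ~ D z \/ ~ D z' by apply/not_andP.
  by case=> /outside/(ler_wpM2l (ltW A0)); rewrite Acw; have := w0 z; have := w0 z'; lra.
have := Tfz z; have := Tfz z'; rewrite !TphiE !ler_norml => /andP[? ?] /andP[? ?].
rewrite !mulrDr in dz dz' *; lra.
Qed.

End oscillation.

(** * Tails of Markov iterates under drift and minorization *)

(** A concave function lies below its tangents; here this is Young's
    inequality for the conjugate exponents [1 / theta] and [1 / (1 - theta)]. *)
Lemma powR_tangent (R : realType) (theta s y : R) : 0 < theta -> theta <= 1 ->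
  0 < s -> 0 < y ->
  y `^ theta <= s `^ theta + theta * s `^ (theta - 1) * (y - s).
Proof.
move=> t0 t1 s0 y0; have [->|tn1] := eqVneq theta 1.
  rewrite subrr powRr0 (powRr1 (ltW s0)) (powRr1 (ltW y0)); lra.
have t1' : 0 < 1 - theta by rewrite subr_gt0 lt_neqAle tn1.
have := @conjugate_powR R (y `^ theta) (s `^ (1 - theta)) theta^-1 (1 - theta)^-1
  (powR_ge0 _ _) (powR_ge0 _ _).
rewrite !invr_gt0 !invrK -!powRrM !mulfV ?gt_eqF//.
rewrite (powRr1 (ltW s0)) (powRr1 (ltW y0)).
move=> /(_ t0 t1'); rewrite addrC subrK => /(_ erefl) h.
have st0 : 0 <= s `^ (theta - 1) by exact: powR_ge0.
have := ler_wpM2r st0 h; rewrite /= -[leLHS]mulrA -powRD; last by rewrite (gt_eqF s0) implybT.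
rewrite [1 - theta + _](_ : _ = 0); last by ring.
rewrite powRr0 mulr1 => /le_trans; apply.
have -> : s `^ theta = s * s `^ (theta - 1) by rewrite mulr_powRB1// ltW.
by rewrite le_eqVlt; apply/orP; left; apply/eqP; ring.
Qed.

(** Here [ev v] is the constant of the minorization on the level set [V <= v];
    as a function of [v] it is a parameter, like [alpha], [e] and [b], so that
    conclusions can be uniform over all models with the same parameters. *)
Record drift_model (R : realType) (E : Type) (F : set (E -> R))
    (T : (E -> R) -> E -> R) (V : E -> R) (alpha e b : R) (ev : R -> R) : Prop := {
  dm_space : fun_space F ;
  dm_clamp : forall f B, F f -> F (fun z => Num.max (- B) (Num.min B (f z))) ;
  dm_markov : markov_operator F T ;
  dm_ge1 : forall z, 1 <= V z ;
  dm_powR : forall s, 0 <= s <= 1 -> F (fun z => V z `^ s) ;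
  dm_drift : forall z, T V z <= V z - e * V z `^ alpha + b ;
  dm_minor : forall v, 1 <= v -> exists2 nu, mean F nu &
    forall z f, V z <= v -> F f -> (forall y, 0 <= f y) -> ev v * nu f <= T f z }.

Section drift_powers.
Context (R : realType).
Variables (alpha e b : R) (ev : R -> R).
Hypotheses (alpha0 : 0 < alpha) (alpha1 : alpha <= 1) (e0 : 0 < e) (b0 : 0 <= b)
  (ev0 : forall v, 1 <= v -> 0 < ev v).

(** Jensen's inequality for the power [theta], in the form of the tangent
    inequality at [V z]; the additive constant stays below [b] because the
    slope is at most one. *)
Lemma drift_power E F T (V : E -> R) (theta : R) z :
  drift_model F T V alpha e b ev -> 0 < theta <= 1 ->
  T (fun z => V z `^ theta) z + theta * e * V z `^ (theta + alpha - 1)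
    <= V z `^ theta + b.
Proof.
move=> M /andP[t0 t1].
have Vz1 : 1 <= V z by exact: dm_ge1 M z.
have Vz0 : 0 < V z by exact: lt_le_trans Vz1.
have FV : F V.
  rewrite (_ : V = (fun z => V z `^ 1)); first by apply: (dm_powR M); lra.
  apply/funext => x; rewrite powRr1//.
  by apply: le_trans (dm_ge1 M x).
have sF := dm_space M; have mTz := markov_mean (dm_markov M) z.
set p := theta * V z `^ (theta - 1).
have p0 : 0 <= p by rewrite mulr_ge0 ?powR_ge0// ltW.
have Vp1 : V z `^ (theta - 1) <= 1.
  by rewrite -[leRHS](powRr0 (V z)); apply: ler_powR; rewrite ?subr_le0.
have p1 : p <= 1 by rewrite mulr_ile1 ?powR_ge0 ?(ltW t0).
have FVt : F (fun z => V z `^ theta) by apply: (dm_powR M); rewrite t1 ltW.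
have Fd : F (fun y => V y - V z) by apply: (fun_sub sF) => //; exact: fun_cst.
have h : T (fun z => V z `^ theta) z <= V z `^ theta + p * (T V z - V z).
  rewrite -[X in _ * (_ - X)](mean_cst sF mTz) -(mean_sub sF mTz)//; last exact: fun_cst.
  rewrite -(mean_scale mTz)//.
  rewrite -[X in X + _](mean_cst sF mTz) -(mean_add mTz)//; last 2 first.
  - exact: fun_cst.
  - exact: fun_scale.
  apply: (mean_le mTz) => //.
    apply: (fun_add sF); [exact: fun_cst|exact: fun_scale].
  move=> y; apply: powR_tangent => //.
  by apply: lt_le_trans (dm_ge1 M y).
have pe : p * V z `^ alpha = theta * V z `^ (theta + alpha - 1).
  rewrite /p -mulrA -powRD ?(gt_eqF Vz0) ?implybT//; congr (_ * _ `^ _); ring.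
have dz := ler_wpM2l p0 (dm_drift M z).
have : p * b <= b by rewrite ler_piMl.
have -> : theta * e * V z `^ (theta + alpha - 1) = e * (p * V z `^ alpha).
  by rewrite pe; ring.
move: dz h; rewrite !mulrDr !mulrN; lra.
Qed.

Definition osc_class E (V : E -> R) (theta A K : R) (f : E -> R) :=
  forall z z', f z - f z' <= A * (V z `^ theta + V z' `^ theta + K).

(** The powers [U = V^theta] and [w = V^(theta + alpha - 1)] satisfy the drift
    inequality required by [osc_step], and the small set is a level set of [V]
    high enough for [w] to dominate the constant. *)
Lemma osc_class_step (theta : R) : 0 < theta <= 1 -> 0 < theta + alpha - 1 ->
  exists A K : R, [/\ 0 < A, 0 <= K &
    forall E F T (V : E -> R), drift_model F T V alpha e b ev ->
    (forall h f, F h -> (forall z, `|h z| <= V z `^ (theta + alpha - 1)) ->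
      F f -> osc_class V theta A K f ->
      osc_class V theta A K (fun z => h z + T f z)) /\
    (forall f, osc_class V theta A K f -> E ->
      exists m : R, forall z, `|f z - m| <= A * (V z `^ theta + K))].
Proof.
move=> t01 beta0; have /andP[t0 t1] := t01; set beta := theta + alpha - 1 in beta0 *.
pose c := theta * e.
have c0 : 0 < c by rewrite mulr_gt0.
(* the level above which c V^beta >= 4 b *)
pose v := Num.max 1 ((4 * b / c) `^ beta^-1).
have v1 : 1 <= v by rewrite le_max lexx.
exists (2 / c), (2 * b / ev v).
have K0 : 0 <= 2 * b / ev v.
  by rewrite divr_ge0 ?mulr_ge0// ltW// ev0.
split=> // [|E F T V M]; first by rewrite divr_gt0.
have [nu mnu minor] := dm_minor M v1.
have V0 z : 0 <= V z by apply: le_trans (dm_ge1 M z).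
have outside z : ~ V z <= v -> 4 * b <= c * V z `^ beta.
  move=> /negP; rewrite -ltNge /v gt_max => /andP[_ /ltW].
  move=> /(@ge0_ler_powR _ beta (ltW beta0)).
  rewrite !nnegrE powR_ge0 => /(_ isT (V0 z)).
  rewrite -powRrM mulVf ?gt_eqF// powRr1; last by rewrite divr_ge0 ?mulr_ge0// ltW.
  by rewrite ler_pdivrMr// (mulrC c).
have bt1 : 0 <= beta <= 1.
  by rewrite ltW//= /beta lerBlDr lerD.
have FU : F (fun z => V z `^ theta) by apply: (dm_powR M); lra.
split=> [h f Fh hV Ff of_|f of_ z].
  change (osc_bounded (fun z => V z `^ theta) b c (ev v) (fun z => h z + T f z)).
  apply: (@osc_step _ _ F T (dm_space M) (dm_markov M) _ (fun z => V z `^ beta)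
    (fun z => V z <= v) b c (ev v) nu) => //.
  - by move=> z; exact: powR_ge0.
  - by move=> z; exact: powR_ge0.
  - exact: ev0.
  - by move=> z; exact: drift_power M t01.
have [m hm] := @osc_center _ _ (fun z => V z `^ theta) b c (ev v) f of_ z.
exists m => y; apply: le_trans (hm y) _.
rewrite ler_pM2l ?divr_gt0// lerD2l -mulrA ler_peMl ?ler1n//.
by rewrite divr_ge0// ltW// ev0.
Qed.

(** As [(n + 1) T^(n+1) f = T^(n+1) f + T (n T^n f)] and [|T^(n+1) f| <= 1],
    the step property with [h = T^(n+1) f] gives an induction on [n]: the
    oscillation of [T^n f] decays like [1 / n]. *)
Lemma osc_class_iterM E F T (V : E -> R) (beta theta A K : R) f n :
  drift_model F T V alpha e b ev -> 0 <= beta -> 0 <= A -> 0 <= K ->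
  (forall h f, F h -> (forall z, `|h z| <= V z `^ beta) ->
      F f -> osc_class V theta A K f ->
      osc_class V theta A K (fun z => h z + T f z)) ->
  F f -> (forall z, `|f z| <= 1) ->
  osc_class V theta A K (fun z => n%:R * iter n T f z).
Proof.
move=> M beta0 A0 K0 step Ff f1; have sF := dm_space M; have mT := dm_markov M.
elim: n => [z z'|n IH].
  rewrite !mul0r subrr mulr_ge0// addr_ge0// addr_ge0 ?powR_ge0//.
have := step (iter n.+1 T f) (fun z => n%:R * iter n T f z) _ _ _ IH.
have -> : (fun z => iter n.+1 T f z + T (fun z0 => n%:R * iter n T f z0) z) =
    (fun z => n.+1%:R * iter n.+1 T f z).
  apply/funext => z; rewrite (mean_scale (markov_mean mT z)); last exact: iter_fun.
  by rewrite iterS -nat1r mulrDl mul1r.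
apply.
- exact: (iter_fun mT).
- move=> z; apply: le_trans (_ : 1 <= _).
    exact: (iter_norm_le sF mT).
  by rewrite -[leLHS](powRr0 (V z)); apply: ler_powR => //; exact: dm_ge1 M z.
- by apply: (fun_scale sF); exact: (iter_fun mT).
Qed.

Lemma osc_class_iter E F T (V : E -> R) (beta theta A K : R) f n :
  drift_model F T V alpha e b ev ->
  (forall h f, F h -> (forall z, `|h z| <= V z `^ beta) ->
      F f -> osc_class V theta A K f ->
      osc_class V theta A K (fun z => h z + T f z)) ->
  F f -> osc_class V theta A K f -> osc_class V theta A K (iter n T f).
Proof.
move=> M step Ff of_; have sF := dm_space M; have mT := dm_markov M.
elim: n => //= n IH.
have := step (fun=> 0) (iter n T f) (fun_cst sF 0) _ _ IH.
rewrite (_ : (fun z => 0 + _) = T (iter n T f)); last first.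
  by apply/funext => z; rewrite add0r.
apply; first by move=> z; rewrite normr0 powR_ge0.
exact: (iter_fun mT).
Qed.

(** The sum is [T^n s] for a partial sum [s] of the [T^k g].  Since [|g|] is a
    power of [V] strictly below the critical one, the oscillation of [s] is
    controlled by [V^th0] with [th0 < eta].  Once centred, [s] is the sum of a
    function bounded by [B], whose oscillation under [T^n] decays like [B /
    n], and of a remainder supported where [V] is large, which is at most [eps
    / 2 V^eta]; its oscillation keeps a bound of this order under [T^n]. *)
Theorem uniform_tail (lambda kappa : R) :
  0 <= lambda < 1 -> 0 < kappa < 1 ->
  exists2 K : R, 0 <= K & forall eps : R, 0 < eps -> exists n0 : nat,
    forall E F T (V : E -> R), drift_model F T V alpha e b ev ->
    forall g, F g -> (forall z, `|g z| <= V z `^ (kappa * alpha * (1 - lambda))) ->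
    forall n m, (n0 <= n)%N -> forall z z',
      \sum_(n <= k < n + m) iter k T g z - \sum_(n <= k < n + m) iter k T g z'
      <= eps * (V z `^ (1 - lambda * alpha) + V z' `^ (1 - lambda * alpha) + K).
Proof.
move=> /andP[l0 l1] /andP[k0 k1].
pose eta1 : R := alpha * (1 - lambda); pose eta : R := 1 - lambda * alpha.
have eta10 : 0 < eta1 by rewrite mulr_gt0// subr_gt0.
(* th0 + alpha - 1 is the exponent of the bound on g, and th0 < eta as kappa < 1 *)
pose th0 : R := 1 - alpha + kappa * eta1.
have keta1 : 0 < kappa * eta1 by rewrite mulr_gt0.
have eta1E : eta + alpha - 1 = eta1 by rewrite /eta /eta1; ring.
have th0E : th0 + alpha - 1 = kappa * alpha * (1 - lambda).
  by rewrite /th0 /eta1; ring.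
have th0eta : th0 < eta.
  rewrite -subr_gt0 (_ : _ - _ = (1 - kappa) * eta1); last first.
    by rewrite /th0 /eta /eta1; ring.
  by rewrite mulr_gt0// subr_gt0.
have eta_le1 : eta <= 1 by rewrite lerBlDr lerDl mulr_ge0// ltW.
have th0_gt0 : 0 < th0 by rewrite ltr_wpDl// subr_ge0.
have th01 : 0 < th0 <= 1 by rewrite th0_gt0/= ltW// (lt_le_trans th0eta).
have etaI : 0 < eta <= 1 by rewrite eta_le1 (lt_trans th0_gt0).
have th0b : 0 < th0 + alpha - 1 by rewrite th0E -mulrA.
have etab : 0 < eta + alpha - 1 by rewrite eta1E.
have [A0 [K0 [A00 K00 S0]]] := osc_class_step th01 th0b.
have [A1 [K1 [A10 K10 S1]]] := osc_class_step etaI etab.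
exists K1 => // eps eps0.
pose Af := A0 * (1 + K0).
have Af0 : 0 < Af by rewrite mulr_gt0// ltr_wpDr.
pose rho := eta - th0; have rho0 : 0 < rho by rewrite subr_gt0.
(* for V >= L one has Af V^th0 <= eps / 2 V^eta *)
pose L := Num.max 1 ((2 * Af / eps) `^ rho^-1).
have L1 : 1 <= L by rewrite le_max lexx.
have L0 : 0 < L by exact: lt_le_trans L1.
pose B := Af * L `^ th0.
have B0 : 0 < B by rewrite mulr_gt0// powR_gt0.
have tail V0 : 1 <= V0 -> B <= Af * V0 `^ th0 ->
    Af * V0 `^ th0 <= eps / 2 * V0 `^ eta.
  move=> V01; rewrite /B ler_pM2l// => LV.
  have V00 : 0 < V0 by exact: lt_le_trans V01.
  have {}LV : L <= V0.
    have := @ge0_ler_powR _ th0^-1 _ (L `^ th0) (V0 `^ th0).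
    rewrite invr_ge0 (ltW th0_gt0) => /(_ isT); rewrite !nnegrE !powR_ge0.
    by move=> /(_ isT isT LV); rewrite -!powRrM mulfV ?gt_eqF// !powRr1// ltW.
  have h : 2 * Af / eps <= V0 `^ rho.
    have : (2 * Af / eps) `^ rho^-1 <= V0.
      by apply: le_trans LV; rewrite /L le_max lexx orbT.
    move/(@ge0_ler_powR _ rho (ltW rho0)).
    rewrite !nnegrE powR_ge0 (ltW V00) => /(_ isT isT).
    rewrite -powRrM mulVf ?gt_eqF// powRr1; first exact.
    by apply: divr_ge0; [apply: mulr_ge0 => //|]; exact: ltW.
  have -> : eta = th0 + rho by rewrite /rho; ring.
  rewrite powRD ?(gt_eqF V00) ?implybT// mulrCA [leRHS]mulrA.
  have h' : Af <= eps / 2 * V0 `^ rho.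
    by move: h; rewrite ler_pdivrMr//; lra.
  by rewrite mulrC -mulrA; apply: ler_wpM2l => //; exact: powR_ge0.
(* for n >= n0 the oscillation A1 B / n of the bounded part is below eps / 2 *)
pose n0 := (Num.truncn (2 * B * A1 / eps)).+1.
have hn0 : 2 * B * A1 / eps < n0%:R by exact: truncnS_gt.
exists n0 => E F T V M g Fg gV n m n0n z z'.
have sF := dm_space M; have mT := dm_markov M.
have [step0 center0] := S0 E F T V M; have [step1 _] := S1 E F T V M.
have V1 y : 1 <= V y by exact: dm_ge1 M y.
pose s := fun z => \sum_(0 <= k < m) iter k T g z.
have Fs : F s by apply: (fun_sum sF) => k; exact: (iter_fun mT).
have os : osc_class V th0 A0 K0 s.
  rewrite /s; elim: m {s Fs} => [y y'|m IH].
    rewrite !big_geq// subrr; apply: mulr_ge0; first exact: ltW.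
    by rewrite !addr_ge0// powR_ge0.
  have := step0 g (fun z => \sum_(0 <= k < m) iter k T g z) Fg _ _ IH.
  have -> : (fun y => g y + T (fun z => \sum_(0 <= k < m) iter k T g z) y) =
      (fun y => \sum_(0 <= k < m.+1) iter k T g y).
    apply/funext => y; rewrite (mean_sum sF (markov_mean mT y)); last first.
      by move=> k; exact: (iter_fun mT).
    by rewrite big_nat_recl.
  apply; first by rewrite th0E.
  by apply: (fun_sum sF) => k; exact: (iter_fun mT).
have sumE y : \sum_(n <= k < n + m) iter k T g y = iter n T s y.
  rewrite /s (iter_sum sF mT); last by move=> k; exact: (iter_fun mT).
  rewrite -{1}(add0n n) big_addn addKn; apply: eq_bigr => k _.
  by rewrite addnC iterD.
rewrite !sumE.
have [c hc] := center0 s os z.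
pose f y := s y - c.
have Ff : F f by apply: (fun_sub sF) => //; exact: (fun_cst sF).
have fAf y : `|f y| <= Af * V y `^ th0.
  apply: le_trans (hc y) _; rewrite /Af -mulrA ler_pM2l// mulrDl mul1r lerD2l.
  rewrite -[leLHS]mulr1 ler_wpM2l// -(powRr0 (V y)).
  by apply: ler_powR => //; exact: ltW.
pose f1 y := Num.max (- B) (Num.min B (f y)).
have Ff1 : F f1 by exact: dm_clamp M _ _ Ff.
have f1B y : `|f1 y| <= B.
  rewrite /f1 ler_norml le_max lexx/= ge_max ge_min lexx /= andbT.
  by rewrite (le_trans _ (ltW B0))// oppr_le0 ltW.
pose f2 y := f y - f1 y.
have Ff2 : F f2 by exact: (fun_sub sF).
have f2V y : `|f2 y| <= eps / 2 * V y `^ eta.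
  have [h|h] := lerP (`|f y|) B.
    rewrite /f2 /f1; move: h; rewrite ler_norml => /andP[h1 h2].
    rewrite min_r// max_r// subrr normr0 mulr_ge0 ?powR_ge0//; by apply/ltW/divr_gt0.
  have hB : B <= Af * V y `^ th0 by rewrite (le_trans (ltW h)).
  apply: le_trans _ (tail _ (V1 y) hB).
  apply: le_trans _ (fAf y); rewrite /f2 /f1.
  move: h; rewrite lter_normr => /orP[h|h].
    rewrite (min_l (ltW h)) max_r; last by rewrite (le_trans _ (ltW B0))// oppr_le0 ltW.
    rewrite !ger0_norm; lra.
  have h' : f y < - B by rewrite ltrNr.
  rewrite min_r; last by lra.
  rewrite (max_l (ltW h')) !ler0_norm; lra.
have iE y : iter n T s y = iter n T f1 y + iter n T f2 y + c.
  have -> : s = (fun y => (f1 y + f2 y) + c).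
    by apply/funext => u; rewrite /f2 /f; ring.
  by rewrite (iter_add mT _ (fun_add sF Ff1 Ff2) (fun_cst sF c))
    (iter_add mT _ Ff1 Ff2) (iter_cst sF mT).
have nn0 : 0 < n%:R :> R by rewrite ltr0n (leq_trans _ n0n).
have o1 : iter n T f1 z - iter n T f1 z' <=
    eps / 2 * (V z `^ eta + V z' `^ eta + K1).
  have := @osc_class_iterM E F T V _ eta A1 K1 (fun y => B^-1 * f1 y) n M (ltW etab)
    (ltW A10) K10 step1.
  have FB : F (fun y => B^-1 * f1 y) by exact: (fun_scale sF).
  move=> /(_ FB); have h1 y : `|B^-1 * f1 y| <= 1.
    by rewrite normrM gtr0_norm ?invr_gt0// mulrC ler_pdivrMr// mul1r.
  move=> /(_ h1 z z'); rewrite (iter_scale mT)//.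
  set X := V z `^ eta + V z' `^ eta + K1.
  have X0 : 0 <= X by rewrite addr_ge0// addr_ge0// powR_ge0.
  rewrite -!mulrBr mulrA -ler_pdivlMl ?mulr_gt0 ?invr_gt0// => /le_trans; apply.
  rewrite mulrA; apply: ler_wpM2r => //.
  rewrite invfM invrK -mulrA ler_pdivrMl//.
  have : 2 * B * A1 / eps <= n%:R by apply: ltW; apply: lt_le_trans hn0 _; rewrite ler_nat.
  by rewrite ler_pdivrMr//; lra.
have o2 : iter n T f2 z - iter n T f2 z' <=
    eps / 2 * (V z `^ eta + V z' `^ eta + K1).
  pose t := A1 / (eps / 2); have t0 : 0 < t by rewrite !divr_gt0.
  have FB : F (fun y => t * f2 y) by exact: (fun_scale sF).
  have h2 : osc_class V eta A1 K1 (fun y => t * f2 y).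
    move=> y y'; rewrite -mulrBr.
    apply: le_trans (_ : t * (eps / 2 * V y `^ eta + eps / 2 * V y' `^ eta) <= _).
      rewrite ler_pM2l//; have := f2V y; have := f2V y'.
      by rewrite !ler_norml => /andP[? ?] /andP[? ?]; lra.
    rewrite -mulrDr mulrA /t divfK ?gt_eqF ?divr_gt0//.
    by rewrite ler_pM2l// lerDl.
  have := osc_class_iter n M step1 FB h2 z z'.
  rewrite (iter_scale mT)// -mulrBr -ler_pdivlMl// => /le_trans; apply.
  by rewrite mulrA /t invfM invrK [_ * A1]mulrAC mulVf ?gt_eqF// mul1r.
rewrite !iE -/eta; set X := V z `^ eta + V z' `^ eta + K1 in o1 o2 *.
rewrite (_ : eps * X = eps / 2 * X + eps / 2 * X); last by field.
lra.
Qed.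

End drift_powers.

(** * Reversible operators and their autocovariances *)

(** A Markov operator that is self-adjoint for the mean [I]; closure under
    products makes every expression below integrable. *)
Record reversible_model (R : realType) (E : Type) (F : set (E -> R))
    (T : (E -> R) -> E -> R) (I : (E -> R) -> R) : Prop := {
  rm_space : fun_space F ;
  rm_mul : forall f g, F f -> F g -> F (fun x => f x * g x) ;
  rm_markov : markov_operator F T ;
  rm_mean : mean F I ;
  rm_sym : forall f g, F f -> F g ->
    I (fun x => f x * T g x) = I (fun x => T f x * g x) }.

Definition acov (R : realType) (E : Type) (T : (E -> R) -> E -> R)
  (I : (E -> R) -> R) (f : E -> R) (k : nat) : R := I (fun x => f x * iter k T f x).

Section reversible.
Context (R : realType) (E : Type) (F : set (E -> R)) (T : (E -> R) -> E -> R)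
  (I : (E -> R) -> R).
Hypothesis M : reversible_model F T I.
Let sF := rm_space M.
Let mT := rm_markov M.
Let mI := rm_mean M.
Let FM := rm_mul M.
Let FD := fun_add sF.
Let FB := fun_sub sF.
Let FT := markov_fun mT.
Let Fi := iter_fun mT.

Lemma rm_inv f : F f -> I (T f) = I f.
Proof.
move=> Ff; have F1 : F (fun=> 1) by exact: fun_cst sF 1.
have := rm_sym M F1 Ff.
rewrite (_ : T (fun=> 1) = fun=> 1); last first.
  by apply/funext => x; exact: (mean_cst sF (markov_mean mT x)).
have e u : (fun x : E => 1 * u x) = u :> (E -> R).
  by apply/funext => x; rewrite mul1r.
by rewrite !e.
Qed.

Lemma rm_inv_iter k f : F f -> I (iter k T f) = I f.
Proof. by move=> Ff; elim: k => //= k IH; rewrite rm_inv//; exact: Fi. Qed.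

Lemma rm_sym_iter i f g : F f -> F g ->
  I (fun x => iter i T f x * g x) = I (fun x => f x * iter i T g x).
Proof.
elim: i g => //= i IH g Ff Fg.
by rewrite -(rm_sym M) ?IH//; [congr I; apply/funext => x; rewrite -iterS iterSr|
  exact: FT | exact: Fi].
Qed.

Lemma mean_sqr_ge f : F f -> I f ^+ 2 <= I (fun x => f x * f x).
Proof.
move=> Ff; have Ff2 : F (fun x => f x * f x) by exact: FM.
have F1 := fun_scale sF (2 * I f) Ff; have F2 := FB Ff2 F1.
have F3 := fun_cst sF (I f ^+ 2).
have h : 0 <= I (fun x => f x * f x - (2 * I f) * f x + I f ^+ 2).
  apply: (mean_ge0 sF mI (FD F2 F3)) => x.
  by have := sqr_ge0 (f x - I f); rewrite !expr2; lra.
move: h; rewrite (mean_add mI F2 F3) (mean_sub sF mI Ff2 F1).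
rewrite (mean_scale mI _ Ff) (mean_cst sF mI) !expr2; lra.
Qed.

(** The two signs [s = -1] and [s = 1] are used: the first gives the Dirichlet
    form of [T], the second the form of [- T], which controls how close to
    [-1] the spectrum comes. *)
Lemma dirichlet_cst (s : R) f : F f -> s ^+ 2 = 1 ->
  forall z, (s * f z) ^+ 2 + 2 * (s * f z) * T f z + T (fun x => f x * f x) z =
   T (fun x => (f x + s * f z) * (f x + s * f z)) z.
Proof.
move=> Ff s1 z; have mz := markov_mean mT z.
rewrite [in RHS](_ : (fun x => _ * _) = (fun x => f x * f x + (2 * (s * f z)) * f x + (s * f z) ^+ 2)).
  have F2 : F (fun x => f x * f x) by exact: FM.
  have F1 := fun_scale sF (2 * (s * f z)) Ff.
  rewrite (mean_add mz (FD F2 F1) (fun_cst sF _)) (mean_add mz F2 F1).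
  by rewrite (mean_scale mz _ Ff) (mean_cst sF mz) /=; ring.
by apply/funext => x; ring.
Qed.

(** Half of the mean square of [f x' + s f x] over one step of the stationary
    chain from [x] to [x'], by invariance of [I]. *)
Lemma dirichletE (s : R) f : F f -> s ^+ 2 = 1 ->
  2 * I (fun x => f x * (f x + s * T f x)) =
  I (fun z => T (fun x => (f x + s * f z) * (f x + s * f z)) z).
Proof.
move=> Ff s1; have F2 : F (fun x => f x * f x) by exact: FM.
have FfT : F (fun x => f x * T f x) by apply: FM => //; exact: FT.
rewrite (_ : (fun z => T _ z) = (fun z => f z * f z + (2 * s) * (f z * T f z) +
    T (fun x => f x * f x) z)); last first.
  apply/funext => z; rewrite -dirichlet_cst// exprMn s1 mul1r; ring.
rewrite (_ : (fun x => f x * (_ + _)) = fun x => f x * f x + s * (f x * T f x)); last first.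
  by apply/funext => x; ring.
have FsT : F (fun x => s * (f x * T f x)) by exact: fun_scale.
have F2sT : F (fun x => 2 * s * (f x * T f x)) by exact: fun_scale.
rewrite (mean_add mI F2 FsT) (mean_scale mI _ FfT).
rewrite (mean_add mI (FD F2 F2sT) (FT F2)) (mean_add mI F2 F2sT).
by rewrite (mean_scale mI _ FfT) rm_inv//; ring.
Qed.

Lemma dirichlet_ge0 (s : R) f : F f -> s ^+ 2 = 1 ->
  0 <= I (fun x => f x * (f x + s * T f x)).
Proof.
move=> Ff s1; have : 0 <= 2 * I (fun x => f x * (f x + s * T f x)).
  rewrite dirichletE//; apply: (mean_ge0 sF mI); last first.
    move=> z; apply: (mean_ge0 sF (markov_mean mT z)) => [|x].
      by apply: FM; apply: FD => //; exact: fun_cst.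
    by rewrite -expr2 sqr_ge0.
  rewrite (_ : (fun z => T _ z) = (fun z => (s * s) * (f z * f z) + (2 * s) * (f z * T f z) +
    T (fun x => f x * f x) z)).
    apply: FD; last by apply: FT; exact: FM.
    by apply: FD; apply: (fun_scale sF); apply: FM => //; exact: FT.
  apply/funext => z; rewrite -dirichlet_cst//; ring.
by rewrite pmulr_rge0.
Qed.

Lemma acov_shift i j f : F f ->
  I (fun x => iter i T f x * iter j T f x) = acov T I f (i + j).
Proof.
move=> Ff; rewrite rm_sym_iter//; last exact: Fi.
by congr I; apply/funext => x; rewrite iterD.
Qed.

(** By self-adjointness this is the mean square of [T^k f]. *)
Lemma acov_even_ge0 k f : F f -> 0 <= acov T I f (k + k).
Proof.
move=> Ff; rewrite -acov_shift//; apply: (mean_ge0 sF mI) => [|x].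
  by apply: FM; exact: Fi.
by rewrite -expr2 sqr_ge0.
Qed.

Lemma acov_pair k f : F f -> acov T I f (k + k) + acov T I f (k + k).+1 =
  I (fun x => iter k T f x * (iter k T f x + 1 * T (iter k T f) x)).
Proof.
move=> Ff; rewrite -acov_shift// -addnS -acov_shift//.
rewrite -(mean_add mI); last 2 first.
- by apply: FM; exact: Fi.
- by apply: FM; [exact: Fi|exact: (Fi k.+1)].
by congr I; apply/funext => x; rewrite mul1r mulrDr.
Qed.

(** This is the form of [- T] at [T^k f]. *)
Lemma acov_pair_ge0 k f : F f -> 0 <= acov T I f (k + k) + acov T I f (k + k).+1.
Proof.
by move=> Ff; rewrite acov_pair//; apply: dirichlet_ge0; [exact: Fi|rewrite expr1n].
Qed.

Lemma acov_psum_even m f :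
  \sum_(0 <= k < m + m) acov T I f k =
  \sum_(0 <= k < m) (acov T I f (k + k) + acov T I f (k + k).+1).
Proof.
elim: m => [|m IH]; first by rewrite !big_geq.
by rewrite addSn addnS !big_nat_recr//= IH addrA.
Qed.

(** Even autocovariances decrease, by Jensen's inequality for the square and
    invariance; the other ones are compared to them by the
    arithmetic-geometric inequality. *)
Lemma acov_le k f : F f -> `|acov T I f k| <= acov T I f 0.
Proof.
move=> Ff.
suff h : forall k, acov T I f (k + k) <= acov T I f 0.
  have Fk := @Fi k f Ff.
  have F2 : F (fun x => f x * f x) by exact: FM.
  have Fk2 : F (fun x => iter k T f x * iter k T f x) by exact: FM.
  have bnd x : `|f x * iter k T f x| <= 2^-1 * (f x * f x + iter k T f x * iter k T f x).
    have := sqr_ge0 (f x - iter k T f x); have := sqr_ge0 (f x + iter k T f x).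
    rewrite ler_norml !expr2 => ? ?; apply/andP; split; lra.
  have := @mean_norm_le _ _ _ _ sF mI (fun x => f x * iter k T f x) _ _ _ bnd.
  rewrite (mean_scale mI) ?(mean_add mI)// ?acov_shift//; last exact: FD.
  move=> /(_ (FM Ff Fk)) /(_ (fun_scale sF _ (FD F2 Fk2))) /le_trans; apply.
  have := h k; rewrite /acov/=; lra.
elim=> // i IH; apply: le_trans IH.
rewrite -!acov_shift//.
apply: le_trans (_ : I (T (fun x => iter i T f x * iter i T f x)) <= _); last first.
  by rewrite rm_inv//; apply: FM; exact: Fi.
apply: (mean_le mI).
- by apply: FM; exact: (@Fi i.+1).
- by apply: FT; apply: FM; exact: Fi.
- move=> z /=; have := dirichlet_cst (@Fi i f Ff) (expr1n _ 2) z.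
  have mz := markov_mean mT z; have Fif := @Fi i f Ff.
  set g := iter i T f in Fif *.
  have Fg2 : F (fun x => g x * g x) by exact: FM.
  have F1 := fun_scale sF (2 * T g z) Fif; have F3 := fun_cst sF (T g z ^+ 2).
  move=> _; have : 0 <= T (fun x => g x * g x - (2 * T g z) * g x + T g z ^+ 2) z.
    apply: (mean_ge0 sF mz (FD (FB Fg2 F1) F3)) => x.
    by have := sqr_ge0 (g x - T g z); rewrite !expr2; lra.
  rewrite (mean_add mz (FB Fg2 F1) F3) (mean_sub sF mz Fg2 F1).
  rewrite (mean_scale mz _ Fif) (mean_cst sF mz) !expr2; lra.
Qed.

Section variational.
Variable h : E -> R.
Hypothesis Fh : F h.
Let psi n x := \sum_(0 <= k < n) iter k T h x.
Let s n := \sum_(0 <= k < n) acov T I h k.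

Let Fpsi n : F (psi n).
Proof. by apply: (fun_sum sF) => k; exact: Fi. Qed.

Lemma psi_sub n x : psi n x - T (psi n) x = h x - iter n T h x.
Proof.
rewrite /psi (mean_sum sF (markov_mean mT x)); last by move=> k; exact: Fi.
elim: n => [|n IH]; first by rewrite !big_geq// !subrr.
by rewrite !big_nat_recr//= opprD addrACA IH addrA subrK.
Qed.

Lemma psi_mul i n : I (fun x => psi n x * iter i T h x) =
  \sum_(i <= k < i + n) acov T I h k.
Proof.
rewrite -{2}(add0n i) big_addn addKn.
under [RHS]eq_bigr => k _ do rewrite -acov_shift//.
rewrite -(mean_sum sF mI); last by move=> k; apply: FM; exact: Fi.
by congr I; apply/funext => x; rewrite mulr_suml.
Qed.

Lemma psi_dirichlet n :
  I (fun x => psi n x * (psi n x - T (psi n) x)) = 2 * s n - s (n + n).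
Proof.
under eq_fun do rewrite psi_sub mulrBr.
rewrite (mean_sub sF mI); last 2 first.
- exact: FM.
- by apply: FM => //; exact: Fi.
rewrite (psi_mul 0) psi_mul add0n /s (@big_cat_nat _ _ _ n 0 (n + n))//=; last exact: leq_addr.
by ring.
Qed.

(** For [psi = \sum_(k < n) T^k h] one has [psi - T psi = h - T^n h], so that
    [psi] solves the Poisson equation up to a vanishing term and almost
    maximizes [2 <f, h> - <f, f - T f>]. *)
Lemma psi_energy n : s (n + n) =
  2 * I (fun x => psi n x * h x) - I (fun x => psi n x * (psi n x - T (psi n) x)).
Proof. by rewrite psi_dirichlet (psi_mul 0) add0n /s; ring. Qed.

(** The difference of the two sides is the Dirichlet form of [f - psi], which
    is nonnegative; this is the variational formula for the asymptotic
    variance, with the error made when the sum is stopped at [n]. *)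
Lemma energy_le n f : F f ->
  2 * I (fun x => f x * h x) - I (fun x => f x * (f x - T f x)) <=
  2 * s n - s (n + n) + 2 * I (fun x => f x * iter n T h x).
Proof.
move=> Ff; have FTf := FT Ff; have Fp := Fpsi n; have FTp := FT Fp.
have Fd : F (fun x => f x - psi n x) by exact: FB.
have := @dirichlet_ge0 (-1) _ Fd.
rewrite sqrrN expr1n => /(_ erefl).
rewrite (_ : (fun x => _ * _) = (fun x => (f x * (f x - T f x) - f x * (h x - iter n T h x)) -
    (psi n x * f x - psi n x * T f x) + psi n x * (psi n x - T (psi n) x))); last first.
  apply/funext => x; rewrite (mean_sub sF (markov_mean mT x))//.
  by rewrite -psi_sub; ring.
have F1 : F (fun x => f x * (f x - T f x)) by apply: FM => //; exact: FB.
have F2 : F (fun x => f x * (h x - iter n T h x)).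
  by apply: FM => //; apply: FB => //; exact: Fi.
have F3 : F (fun x => psi n x * f x) by exact: FM.
have F4 : F (fun x => psi n x * T f x) by exact: FM.
have F5 : F (fun x => psi n x * (psi n x - T (psi n) x)).
  by apply: FM => //; exact: FB.
rewrite (mean_add mI (FB (FB F1 F2) (FB F3 F4)) F5).
rewrite (mean_sub sF mI (FB F1 F2) (FB F3 F4)) (mean_sub sF mI F1 F2).
rewrite (mean_sub sF mI F3 F4) psi_dirichlet.
have -> : I (fun x => psi n x * f x) - I (fun x => psi n x * T f x) =
    I (fun x => f x * (h x - iter n T h x)).
  rewrite (rm_sym M)// -(mean_sub sF mI); last 2 first.
  - exact: FM.
  - exact: FM.
  by congr I; apply/funext => x; rewrite -psi_sub; ring.
rewrite (_ : (fun x => f x * (h x - _)) = (fun x => f x * h x - f x * iter n T h x)); last first.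
  by apply/funext => x; rewrite mulrBr.
rewrite (mean_sub sF mI); last 2 first.
- exact: FM.
- by apply: FM => //; exact: Fi.
lra.
Qed.

End variational.

End reversible.

(** * Comparison of autocovariances and small sets *)

Section comparison.
Context (R : realType) (E1 E2 : Type) (p : E2 -> E1)
  (F1 : set (E1 -> R)) (T1 : (E1 -> R) -> E1 -> R) (I1 : (E1 -> R) -> R)
  (F2 : set (E2 -> R)) (T2 : (E2 -> R) -> E2 -> R) (I2 : (E2 -> R) -> R).
Hypotheses (M1 : reversible_model F1 T1 I1) (M2 : reversible_model F2 T2 I2)
  (Fp : forall f, F1 f -> F2 (f \o p))
  (Ip : forall f, F1 f -> I2 (f \o p) = I1 f)
  (dirichlet_le : forall f, F1 f ->
     I2 (fun x => f (p x) * (f (p x) - T2 (f \o p) x)) <=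
     I1 (fun x => f x * (f x - T1 f x))).

(** The sum for [T1] is the value of the variational functional of [T1] at the
    partial sum [f].  Going over to [T2] replaces the Dirichlet form by a
    smaller one, and [energy_le] for [T2] bounds the result by partial sums
    for [T2] plus an error which tends to zero with the even autocovariances
    of [T2]. *)
Lemma acov_psum_comparison (h : E1 -> R) (B : R) m : F1 h ->
  (forall n, `|\sum_(0 <= k < n) acov T2 I2 (h \o p) k| <= B) ->
  (forall e : R, 0 < e -> exists n : nat, acov T2 I2 (h \o p) (n + n) <= e) ->
  \sum_(0 <= k < m + m) acov T1 I1 h k <= 3 * B.
Proof.
move=> Fh sB a0.
pose f x := \sum_(0 <= k < m) iter k T1 h x.
have sF1 := rm_space M1; have sF2 := rm_space M2.
have Ff : F1 f.
  by apply: (fun_sum sF1) => k; exact: (iter_fun (rm_markov M1)).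
have Ff2 := Fp Ff; have Fh2 := Fp Fh.
rewrite (psi_energy M1 Fh) -/f.
have IfE : I1 (fun x => f x * h x) = I2 (fun x => f (p x) * h (p x)).
  by rewrite -Ip//; exact: (rm_mul M1).
apply: le_trans (_ : 2 * I2 (fun x => f (p x) * h (p x)) -
   I2 (fun x => f (p x) * (f (p x) - T2 (f \o p) x)) <= _).
  by rewrite IfE lerD2l lerN2; exact: dirichlet_le.
have Fff : F2 (fun x => f (p x) * f (p x)) by exact: (rm_mul M2 Ff2 Ff2).
have If0 : 0 <= I2 (fun x => f (p x) * f (p x)).
  by apply: (mean_ge0 sF2 (rm_mean M2) Fff) => x; rewrite -expr2 sqr_ge0.
set q := I2 (fun x => f (p x) * f (p x)) in If0.
apply/ler_addgt0Pr => e e0.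
have q1 : 0 < q + 1 by rewrite ltr_wpDl.
(* the weight that balances 2 u v <= u^2 / t + t v^2 below; q + 1 avoids dividing by 0 *)
pose t := 2 * (q + 1) / e; have t0 : 0 < t by rewrite divr_gt0// mulr_gt0.
have d0 : 0 < e ^+ 2 / (4 * (q + 1)) by rewrite divr_gt0 ?exprn_gt0// mulr_gt0.
have [n an] := a0 _ d0.
have FiH : F2 (iter n T2 (h \o p)) by exact: (iter_fun (rm_markov M2)).
have := @energy_le _ _ _ _ _ M2 _ Fh2 n _ Ff2.
move/le_trans; apply.
have h1 : 2 * I2 (fun x => (f \o p) x * iter n T2 (h \o p) x) <= e.
  have FI2 : F2 (fun x => iter n T2 (h \o p) x * iter n T2 (h \o p) x) by exact: (rm_mul M2).
  have Fc : F2 (fun x => t^-1 * (f (p x) * f (p x)) +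
      t * (iter n T2 (h \o p) x * iter n T2 (h \o p) x)).
    by apply: (fun_add sF2); exact: (fun_scale sF2).
  have Ffi : F2 (fun x => (f \o p) x * iter n T2 (h \o p) x) by exact: (rm_mul M2).
  rewrite -(mean_scale (rm_mean M2) 2 Ffi).
  apply: le_trans (_ : I2 (fun x => t^-1 * (f (p x) * f (p x)) +
      t * (iter n T2 (h \o p) x * iter n T2 (h \o p) x)) <= _).
    apply: (mean_le (rm_mean M2)) => //; first exact: (fun_scale sF2).
    move=> x /=; have := sqr_ge0 (f (p x) - t * iter n T2 (h \o p) x).
    set u := f (p x); set v := iter n T2 _ x => uv.
    rewrite -subr_ge0 (_ : _ - _ = t^-1 * (u - t * v) ^+ 2); last by field; rewrite gt_eqF.
    by rewrite mulr_ge0// invr_ge0 ltW.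
  rewrite (mean_add (rm_mean M2)); last 2 first.
  - exact: (fun_scale sF2).
  - exact: (fun_scale sF2).
  rewrite (mean_scale (rm_mean M2) _ Fff) (mean_scale (rm_mean M2) _ FI2) -/q.
  rewrite (acov_shift M2)//.
  have := ler_wpM2l (ltW t0) an.
  have -> : t * (e ^+ 2 / (4 * (q + 1))) = e / 2.
    by rewrite /t; field; rewrite !gt_eqF.
  have : t^-1 * q <= e / 2.
    have -> : t^-1 = e / 2 * (q + 1)^-1 by rewrite /t; field; rewrite !gt_eqF.
    rewrite -[leLHS]mulrA; apply: ler_piMr; first by apply/ltW/divr_gt0.
    by rewrite ler_pdivrMl// mulr1 lerDl.
  lra.
have h2 := sB n; have h3 := sB (n + n)%N.
move: h1 h2 h3; rewrite !ler_norml => h1 /andP[? ?] /andP[? ?].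
by rewrite [leLHS]addrC; lra.
Qed.

End comparison.

Section small_set.
Context (R : realType) (E : Type) (F : set (E -> R)) (T : (E -> R) -> E -> R)
  (I : (E -> R) -> R).
Hypothesis M : reversible_model F T I.
Let sF := rm_space M.
Let mT := rm_markov M.
Let mI := rm_mean M.
Let FM := rm_mul M.
Let FD := fun_add sF.
Let FB := fun_sub sF.

Variables (d : E -> R) (D : set E) (c : R) (nu : (E -> R) -> R).
Hypotheses (Fd : F d) (d01 : forall z, D z /\ d z = 1 \/ d z = 0)
  (c0 : 0 < c) (mnu : mean F nu)
  (minor : forall z f, D z -> F f -> (forall y, 0 <= f y) -> c * nu f <= T f z).

(** The form of [- T] at [h] controls the mean square of [h x' + h x] over one
    step.  From a point of [D] the next state is drawn from [nu] with
    probability at least [c], so [h + nu h] is small in mean square on [D].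
    As [h] has mean zero and [D] has almost full mass, [nu h] itself is small,
    and then so is [h]. *)
Lemma small_set_bound (h : E -> R) (L : R) : F h -> I h = 0 -> 0 <= L -> (forall z, `|h z| <= L) ->
  I (fun z => 1 - d z) <= 2^-1 ->
  I (fun z => h z * h z) <= 36 / c * I (fun z => h z * (h z + 1 * T h z)) +
     9 * L ^+ 2 * I (fun z => 1 - d z).
Proof.
move=> Fh h0 L0 hL del.
have F1d : F (fun z => 1 - d z) by apply: FB => //; exact: fun_cst sF 1.
have dd z : d z * d z = d z by case: (d01 z) => [[_]|] ->; rewrite ?mul0r ?mul1r.
have d0 z : 0 <= d z by case: (d01 z) => [[_]|] ->.
have d1 z : d z <= 1 by case: (d01 z) => [[_]|] ->.
set delta := I (fun z => 1 - d z) in del *.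
have delta0 : 0 <= delta by apply: (mean_ge0 sF mI F1d) => z; rewrite subr_ge0.
set b := I (fun z => h z * (h z + 1 * T h z)).
set m := nu h.
have Fhm : F (fun z => h z + m) by apply: FD => //; exact: fun_cst.
have Fhm2 : F (fun z => (h z + m) * (h z + m)) by exact: FM.
have Fdhm : F (fun z => d z * (h z + m)) by exact: FM.
have Fdhm2 : F (fun z => d z * ((h z + m) * (h z + m))) by exact: FM.
have Fh2 : F (fun z => h z * h z) by exact: FM.
have FTh : F (T h) by exact: (markov_fun mT).
set q := I (fun z => d z * ((h z + m) * (h z + m))).
have step1 : c * q <= 2 * b.
  rewrite /b (dirichletE M Fh (expr1n _ 2)) -(mean_scale mI _ Fdhm2).
  have e z : T (fun x => (h x + 1 * h z) * (h x + 1 * h z)) z =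
     h z * h z + 2 * (h z * T h z) + T (fun x => h x * h x) z.
    by rewrite -(dirichlet_cst M Fh (expr1n _ 2)); ring.
  apply: (mean_le mI).
  - exact: fun_scale.
  - rewrite (_ : (fun z => T _ z) = (fun z => h z * h z + 2 * (h z * T h z) + T (fun x => h x * h x) z)).
      apply: FD; last exact: (markov_fun mT).
      by apply: FD => //; apply: fun_scale => //; exact: FM.
    by apply/funext => z; rewrite e.
  - move=> z; have Fz : F (fun x => (h x + 1 * h z) * (h x + 1 * h z)).
      by apply: FM; apply: FD => //; exact: fun_cst.
    have g0 x : 0 <= (h x + 1 * h z) * (h x + 1 * h z) by rewrite -expr2 sqr_ge0.
    case: (d01 z) => [[Dz ->]|->]; last first.
      rewrite mul0r mulr0; exact: (mean_ge0 sF (markov_mean mT z)).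
    apply: le_trans (minor Dz Fz g0); rewrite mul1r ler_pM2l//.
    have Fz1 : F (fun x => h x + 1 * h z) by apply: FD => //; exact: fun_cst.
    have G1 := fun_scale sF (2 * (h z + m)) Fz1.
    have G2 := fun_cst sF ((h z + m) ^+ 2).
    have h1 : 0 <= nu (fun x => (h x + 1 * h z) * (h x + 1 * h z) -
       (2 * (h z + m)) * (h x + 1 * h z) + (h z + m) ^+ 2).
      apply: (mean_ge0 sF mnu (FD (FB Fz G1) G2)) => x.
      by have := sqr_ge0 (h x + 1 * h z - (h z + m)); rewrite !expr2; lra.
    move: h1; rewrite (mean_add mnu (FB Fz G1) G2) (mean_sub sF mnu Fz G1).
    rewrite (mean_scale mnu _ Fz1) (mean_cst sF mnu).
    rewrite (mean_add mnu Fh (fun_cst sF (1 * h z))) (mean_cst sF mnu) -/m expr2; lra.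
have q0 : 0 <= q.
  by apply: (mean_ge0 sF mI Fdhm2) => z; rewrite mulr_ge0// -expr2 sqr_ge0.
have qb : q <= 2 * b / c by rewrite ler_pdivlMr// mulrC.
have F1dh : F (fun z => (1 - d z) * h z) by exact: FM.
have u1 : I (fun z => d z * (h z + m)) ^+ 2 <= q.
  apply: le_trans (mean_sqr_ge M Fdhm) _; rewrite le_eqVlt; apply/orP; left; apply/eqP.
  by congr I; apply/funext => z; rewrite -[in RHS]dd; ring.
have u2 : `|I (fun z => (1 - d z) * h z)| <= L * delta.
  rewrite -(mean_scale mI _ F1d); apply: (mean_norm_le sF mI) => //.
    exact: fun_scale.
  move=> z; rewrite normrM mulrC (@ger0_norm _ (1 - d z)) ?subr_ge0//.
  by apply: ler_wpM2r => //; rewrite subr_ge0.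
(* I (d h) = - I ((1 - d) h), because I h = 0 *)
have u3 : m * (1 - delta) = I (fun z => d z * (h z + m)) + I (fun z => (1 - d z) * h z).
  rewrite -(mean_add mI)//.
  rewrite (_ : (fun z => _ + _) = (fun z => h z + (m * d z))); last first.
    by apply/funext => z; ring.
  rewrite (mean_add mI Fh (fun_scale sF _ Fd)) (mean_scale mI _ Fd) h0 add0r; congr (_ * _).
  by rewrite /delta (mean_sub sF mI (fun_cst sF 1) Fd) (mean_cst sF mI); ring.
have u4 : m ^+ 2 <= 8 * q + 8 * (L * delta) ^+ 2.
  have : (m * (1 - delta)) ^+ 2 <= 2 * q + 2 * (L * delta) ^+ 2.
    rewrite u3; set a := I _ in u1 *; set a' := I _ in u2 *.
    have : a' ^+ 2 <= (L * delta) ^+ 2 by rewrite -(real_normK (num_real _)) lerXn2r ?nnegrE// mulr_ge0.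
    by have := sqr_ge0 (a - a'); move: u1; rewrite !expr2; lra.
  rewrite exprMn => h1.
  have h2 : 4^-1 <= (1 - delta) ^+ 2 by rewrite expr2; nra.
  have := ler_wpM2l (sqr_ge0 m) h2; lra.
have dd2 : delta ^+ 2 <= 2^-1 * delta by rewrite expr2 ler_wpM2r.
have L2 : 0 <= L ^+ 2 by exact: sqr_ge0.
have u5 : I (fun z => h z * h z) <= 2 * q + 2 * m ^+ 2 + L ^+ 2 * delta.
  rewrite -(mean_scale mI _ Fdhm2) -(mean_scale mI _ F1d) -[X in _ + X + _](mean_cst sF mI).
  have G1 := fun_scale sF 2 Fdhm2; have G2 := fun_scale sF (L ^+ 2) F1d.
  have G3 := fun_cst sF (2 * m ^+ 2).
  rewrite -(mean_add mI G1 G3) -(mean_add mI (FD G1 G3) G2).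
  apply: (mean_le mI) => //; first exact: (FD (FD G1 G3) G2).
  move=> z; have : h z ^+ 2 <= L ^+ 2 by rewrite -(real_normK (num_real _)) lerXn2r ?nnegrE.
  have := sqr_ge0 (h z + m + m); have := sqr_ge0 m; have := sqr_ge0 (h z).
  by case: (d01 z) => [[_ ->]|->]; rewrite !expr2; lra.
have -> : 36 / c * b = 18 * (2 * b / c) by field; rewrite gt_eqF.
have := ler_wpM2l L2 dd2; move: u4 u5; rewrite exprMn; lra.
Qed.

End small_set.

Section acov_vanishes.
Context (R : realType) (E : Type) (F : set (E -> R)) (T : (E -> R) -> E -> R)
  (I : (E -> R) -> R).
Hypothesis M : reversible_model F T I.
Let sF := rm_space M.
Let mT := rm_markov M.
Let mI := rm_mean M.

Hypothesis small_sets : forall e : R, 0 < e -> exists (d : E -> R) (D : set E) (c : R)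
  (nu : (E -> R) -> R), [/\ F d, (forall z, D z /\ d z = 1 \/ d z = 0), 0 < c,
    mean F nu /\ (forall z f, D z -> F f -> (forall y, 0 <= f y) -> c * nu f <= T f z) &
    I (fun z => 1 - d z) <= e].

(** The sums [a_(2 k) + a_(2 k + 1)] are the terms of a series with bounded
    partial sums, so they tend to zero.  Each is the form of [- T] at [T^k h],
    and [small_set_bound] turns its smallness into that of the mean square of
    [T^k h], that is, of [a_(2 k)]. *)
Lemma acov_even_vanishes (h : E -> R) (L B : R) : F h -> I h = 0 -> 0 <= L -> (forall z, `|h z| <= L) ->
  (forall m, \sum_(0 <= k < m + m) acov T I h k <= B) ->
  forall e : R, 0 < e -> exists n0 : nat, forall n, (n0 <= n)%N -> acov T I h (n + n) <= e.
Proof.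
move=> Fh Ih L0 hL sB e e0.
pose b k := acov T I h (k + k) + acov T I h (k + k).+1.
have b0 k : 0 <= b k by exact: (acov_pair_ge0 M).
have cb : b @ \oo --> 0.
  apply: cvg_series_cvg_0; apply: nondecreasing_is_cvgn.
    apply/nondecreasing_seqP => n.
    by rewrite !seriesEnat /= big_nat_recr//= lerDl.
  exists B => _ [n _ <-]; rewrite seriesEnat /=.
  by rewrite -(acov_psum_even T I n h).
pose e1 := e / (2 * (9 * L ^+ 2 + 1)).
have q0 : 0 <= 9 * L ^+ 2 by rewrite mulr_ge0// sqr_ge0.
have q1 : 0 < 9 * L ^+ 2 + 1 by rewrite ltr_wpDl.
have e10 : 0 < e1 by rewrite divr_gt0// mulr_gt0.
have m0 : 0 < Num.min 2^-1 e1 by rewrite lt_min e10 invr_gt0 ltr0n.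
have [d [D [c [nu [Fd d01 c0 [mnu minor] dle]]]]] := small_sets m0.
move: dle; rewrite le_min => /andP[d2 de].
have bc0 : 0 < e * c / 72 by rewrite divr_gt0// mulr_gt0.
move/cvgrPdist_le : cb => /(_ _ bc0) [n0 _ hn0].
exists n0 => n n0n; rewrite -(acov_shift M)//.
have Fn : F (iter n T h) by exact: iter_fun mT n _ Fh.
have := @small_set_bound _ _ _ _ _ M d D c nu Fd d01 c0 mnu minor (iter n T h) L Fn.
rewrite (rm_inv_iter M)// => /(_ Ih L0 (iter_norm_le sF mT n Fh hL) d2) /le_trans; apply.
rewrite -(acov_pair M)// -/(b n).
have := hn0 n n0n; rewrite sub0r normrN ger0_norm// => hb.
have h1 : 36 / c * b n <= e / 2.
  have c36 : 0 <= 36 / c by rewrite divr_ge0// ltW.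
  apply: le_trans (ler_wpM2l c36 hb) _.
  by rewrite le_eqVlt; apply/orP; left; apply/eqP; field; rewrite gt_eqF.
have h2 : 9 * L ^+ 2 * I (fun z => 1 - d z) <= e / 2.
  apply: le_trans (ler_wpM2l q0 de) _.
  have -> : e / 2 = (9 * L ^+ 2 + 1) * e1 by rewrite /e1; field; rewrite gt_eqF.
  by apply: ler_wpM2r; [exact: ltW|rewrite lerDl].
by move: h1 h2; lra.
Qed.

End acov_vanishes.

(** * Measures from Daniell functionals *)

Local Open Scope ereal_scope.

Section set_function_integral.
Context d (T : measurableType d) (R : realType).

Import HBNNSimple.

(** Integrals are defined for arbitrary set functions through simple
    functions, hence depend only on the values on measurable sets.  No
    additivity is available for the set functions of the statement, so that
    they must be replaced by measures before anything else. *)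
Lemma eq_set_function_integral (m1 m2 : set T -> \bar R) D (f : T -> \bar R) :
  (forall A, measurable A -> m1 A = m2 A) ->
  \int[m1]_(x in D) f x = \int[m2]_(x in D) f x.
Proof.
move=> m12; have h (h : {nnsfun T >-> R}) : sintegral m1 h = sintegral m2 h.
  by apply: eq_fsbigr => x _; rewrite m12//; exact: measurable_funPTI.
by congr (ereal_sup _ - ereal_sup _); apply: eq_imagel => g _; exact: h.
Qed.

End set_function_integral.

Section daniell.
Context d (T : measurableType d) (R : realType).
Implicit Types (f g : T -> \bar R) (I : (T -> \bar R) -> \bar R).

Definition nnmf f := measurable_fun setT f /\ forall x, 0 <= f x.

Lemma nnmf_indic (A : set T) : measurable A -> nnmf (EFin \o \1_A).
Proof.
by move=> mA; split=> [|x]; [exact/measurable_EFinP | rewrite lee_fin].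
Qed.

Lemma nnmf_cst (c : \bar R) : 0 <= c -> nnmf (cst c).
Proof. by []. Qed.

Lemma nnmfD f g : nnmf f -> nnmf g -> nnmf (fun x => f x + g x).
Proof.
move=> [mf f0] [mg g0]; split=> [|x]; last exact: adde_ge0.
exact: emeasurable_funD.
Qed.

Lemma nnmfM f g : nnmf f -> nnmf g -> nnmf (fun x => f x * g x).
Proof.
move=> [mf f0] [mg g0]; split=> [|x]; last exact: mule_ge0.
exact: emeasurable_funM.
Qed.

Lemma nnmf_EFin (f : T -> R) : measurable_fun setT f -> (forall x, (0 <= f x)%R) ->
  nnmf (fun x => (f x)%:E).
Proof. by move=> mf f0; split=> [|x]; [exact/measurable_EFinP|rewrite lee_fin]. Qed.

(** The properties of [f |-> \int f] on nonnegative measurable functions.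
    Iterated integrals and sums inherit them, which makes it easier to build a
    functional and then its measure than to build the measure of a set
    directly. *)
Record daniell I : Prop := {
  daniell_ge0 : forall f, (forall x, 0 <= f x) -> 0 <= I f ;
  daniell_le : forall f g, nnmf f -> nnmf g -> (forall x, f x <= g x) -> I f <= I g ;
  daniellD : forall f g, nnmf f -> nnmf g -> I (fun x => f x + g x) = I f + I g ;
  daniellZ : forall (k : R) f, (0 <= k)%R -> nnmf f ->
    I (fun x => k%:E * f x) = k%:E * I f ;
  daniell_cvg : forall f_ : (T -> \bar R)^nat, (forall n, nnmf (f_ n)) ->
    (forall x, nondecreasing_seq (f_ ^~ x)) ->
    I (f_ n) @[n --> \oo] --> I (fun x => limn (f_ ^~ x)) }.

(** The proof that [I] is a Daniell functional is a parameter only to allow a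
    measure structure to be attached to the set function. *)
Definition daniell_measure I & daniell I := fun A : set T => I (EFin \o \1_A).

Section daniell_measure.
Variable I : (T -> \bar R) -> \bar R.
Hypothesis dI : daniell I.

Let mu0 : daniell_measure dI set0 = 0.
Proof.
rewrite /daniell_measure (_ : _ \o _ = fun x => 0%:E * (cst 0 x)).
  by rewrite (daniellZ dI (lexx 0%R) (nnmf_cst (lexx 0))) mul0e.
by apply/funext => x /=; rewrite indic0 mul0e.
Qed.

Let mu_ge0 A : 0 <= daniell_measure dI A.
Proof. by apply: (daniell_ge0 dI) => x; rewrite lee_fin. Qed.

Lemma daniell_zero : I (cst 0) = 0.
Proof.
rewrite (_ : cst 0 = fun x => 0%:E * (cst 0 x)).
  by rewrite (daniellZ dI (lexx 0%R) (nnmf_cst (lexx 0))) mul0e.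
by apply/funext => x /=; rewrite mul0e.
Qed.

Lemma daniell_sum (J : Type) (s : seq J) (f : J -> T -> \bar R) :
  (forall i, nnmf (f i)) ->
  I (fun x => \sum_(i <- s) f i x) = \sum_(i <- s) I (f i).
Proof.
move=> nf; elim: s => [|i s IH].
  rewrite big_nil -[RHS]daniell_zero; congr I.
  by apply/funext => x; rewrite big_nil.
rewrite big_cons -IH -(daniellD dI)//.
  by congr I; apply/funext => x; rewrite big_cons.
split=> [|x]; last by apply: sume_ge0 => j _; case: (nf j).
by apply: emeasurable_sum => j; case: (nf j).
Qed.

Let mu_sigma : semi_sigma_additive (daniell_measure dI).
Proof.
move=> F mF tF mUF.
pose f_ n x := \sum_(0 <= i < n) (\1_(F i) x)%:E : \bar R.
have nf i : nnmf (EFin \o \1_(F i)) by exact: nnmf_indic.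
have nf_ n : nnmf (f_ n).
  split=> [|x]; last by apply: sume_ge0 => j _; rewrite lee_fin.
  by apply: emeasurable_sum => j; case: (nf j).
have nd x : nondecreasing_seq (f_ ^~ x).
  by apply: ereal_nondecreasing_series => j _ _; rewrite lee_fin.
have := daniell_cvg dI nf_ nd.
rewrite (_ : (fun x => limn _) = EFin \o \1_(\bigcup_n F n)); last first.
  by apply/funext => x /=; rewrite indic_bigcup.
rewrite (_ : (fun n => I (f_ n)) = fun n => \sum_(0 <= i < n) daniell_measure dI (F i))//.
by apply/funext => n; rewrite /f_ (daniell_sum _ nf).
Qed.

HB.instance Definition _ := isMeasure.Build d T R (daniell_measure dI)
  mu0 mu_ge0 mu_sigma.

Import HBNNSimple.

(** Both sides agree on simple functions by linearity and pass to increasing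
    limits. *)
Lemma integral_daniell f : nnmf f -> \int[daniell_measure dI]_x f x = I f.
Proof.
move=> [mf f0]; pose f_ := nnsfun_approx measurableT mf.
have nf_ n : nnmf (EFin \o f_ n).
  by split=> [|x]; [exact/measurable_EFinP | rewrite lee_fin].
have nd x : nondecreasing_seq (fun n => (f_ n x)%:E).
  by move=> m n mn; rewrite lee_fin; exact/lefP/nd_nnsfun_approx.
have fE : f = fun x => limn (fun n => (f_ n x)%:E).
  by apply/funext => x; apply/esym/cvg_lim => //; exact: cvg_nnsfun_approx.
have h1 : \int[daniell_measure dI]_x (f_ n x)%:E @[n --> \oo] -->
    \int[daniell_measure dI]_x limn (fun n => (f_ n x)%:E).
  apply: cvg_monotone_convergence => //.
  - by move=> n; case: (nf_ n).
  - by move=> n x _; rewrite lee_fin.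
have h2 := daniell_cvg dI nf_ nd; rewrite -fE in h1 h2.
have e n : \int[daniell_measure dI]_x (f_ n x)%:E = I (EFin \o f_ n).
  rewrite integralT_nnsfun sintegralE fsbig_finite//=.
  have mA (r : R) : measurable (f_ n @^-1` [set r]) by exact: measurable_funPTI.
  have ge0r (r : R) : r \in fset_set (range (f_ n)) -> (0 <= r)%R.
    by rewrite in_fset_set// => /set_mem[x _ <-].
  have -> : EFin \o f_ n = (fun x => \sum_(r <- fset_set (range (f_ n)))
      (`|r|%:E * (\1_(f_ n @^-1` [set r]) x)%:E)).
    apply/funext => x; rewrite /= fimfunE fsbig_finite//= -sumEFin.
    by apply: eq_big_seq => r /ge0r r0; rewrite ger0_norm// EFinM.
  rewrite daniell_sum; last by move=> r; apply: nnmfM; [exact: nnmf_cst|exact: nnmf_indic].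
  apply: eq_big_seq => r /ge0r r0.
  by rewrite (daniellZ dI)//; [rewrite ger0_norm|exact: nnmf_indic].
move: h1; under eq_fun do rewrite e; move=> h1.
exact: (@cvg_unique _ (@ereal_hausdorff R) _ _ _ _ h1 h2). 
Qed.

End daniell_measure.

End daniell.

Local Close Scope ereal_scope.

(** * Composition of Daniell functionals and kernels *)

Local Open Scope ereal_scope.

Section daniell_constructions.
Context d (T : measurableType d) d' (S : measurableType d') (R : realType).

Lemma daniell_eval (x : T) : daniell (fun f : T -> \bar R => f x).
Proof.
split=> // f_ nf nd; exact: ereal_nondecreasing_is_cvgn (nd x).
Qed.

Lemma daniell_plus (I J : (T -> \bar R) -> \bar R) : daniell I -> daniell J ->
  daniell (fun f => I f + J f).
Proof.
move=> dI dJ; split.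
- by move=> f f0; rewrite adde_ge0 ?(daniell_ge0 dI) ?(daniell_ge0 dJ).
- by move=> f g nf ng fg; rewrite leeD ?(daniell_le dI) ?(daniell_le dJ).
- by move=> f g nf ng; rewrite (daniellD dI)// (daniellD dJ)// addeACA.
- move=> k f k0 nf; rewrite (daniellZ dI)// (daniellZ dJ)//.
  rewrite ge0_muleDr//; last by apply: (daniell_ge0 dJ); case: nf.
  by apply: (daniell_ge0 dI); case: nf.
- move=> f_ nf nd.
  apply: cvgeD; [|exact: (daniell_cvg dI)|exact: (daniell_cvg dJ)].
  have l0 x : 0 <= limn (f_ ^~ x).
    apply: lime_ge; first exact: ereal_nondecreasing_is_cvgn.
    by apply: nearW => n; case: (nf n).
  by rewrite ge0_adde_def// inE ?(daniell_ge0 dI) ?(daniell_ge0 dJ).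
Qed.

Lemma daniell_weight (I : (T -> \bar R) -> \bar R) (w : T -> R) (psi : T -> S) :
  daniell I -> measurable_fun setT w -> (forall x, (0 <= w x)%R) ->
  measurable_fun setT psi ->
  daniell (fun f : S -> \bar R => I (fun x => (w x)%:E * f (psi x))).
Proof.
move=> dI mw w0 mpsi.
have nw f : nnmf f -> nnmf (fun x => (w x)%:E * f (psi x)).
  move=> [mf f0]; apply: nnmfM; first exact: nnmf_EFin.
  by split=> [|x]; [exact: measurableT_comp|].
split.
- by move=> f f0; apply: (daniell_ge0 dI) => x; rewrite mule_ge0// lee_fin.
- move=> f g nf ng fg; apply: (daniell_le dI); [exact: nw|exact: nw|].
  by move=> x; apply: lee_wpmul2l; rewrite ?lee_fin.
- move=> f g nf ng; rewrite -(daniellD dI); [|exact: nw|exact: nw].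
  congr I; apply/funext => x; rewrite ge0_muleDr//; [exact: nf.2|exact: ng.2].
- move=> k f k0 nf; rewrite -(daniellZ dI)//; last exact: nw.
  by congr I; apply/funext => x; rewrite muleCA.
- move=> f_ nf nd.
  rewrite (_ : (fun x => _ * limn _) = (fun x => limn (fun n => (w x)%:E * f_ n (psi x)))).
    apply: (daniell_cvg dI) => [n|x m n mn]; first exact: nw.
    by apply: lee_wpmul2l; [rewrite lee_fin|exact: nd].
  apply/funext => x; apply/esym/cvg_lim => //; apply: cvgeZl => //.
  by apply: ereal_nondecreasing_is_cvgn; exact: nd.
Qed.

Lemma daniell_bind (m : {measure set S -> \bar R}) (J : S -> (T -> \bar R) -> \bar R) :
  (forall a, daniell (J a)) ->
  (forall f, nnmf f -> measurable_fun setT (fun a => J a f)) ->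
  daniell (fun f => \int[m]_a J a f).
Proof.
move=> dJ mJ; split.
- by move=> f f0; apply: integral_ge0 => a _; exact: (daniell_ge0 (dJ a)).
- move=> f g nf ng fg; apply: ge0_le_integral => //.
  + by move=> a _; apply: (daniell_ge0 (dJ a)); exact: nf.2.
  + exact: mJ.
  + exact: mJ.
  + by move=> a _; exact: (daniell_le (dJ a)).
- move=> f g nf ng; rewrite -ge0_integralD//.
  + by apply: eq_integral => a _; rewrite (daniellD (dJ a)).
  + by move=> a _; apply: (daniell_ge0 (dJ a)); exact: nf.2.
  + exact: mJ.
  + by move=> a _; apply: (daniell_ge0 (dJ a)); exact: ng.2.
  + exact: mJ.
- move=> k f k0 nf; rewrite -ge0_integralZl_EFin//.
  + by apply: eq_integral => a _; rewrite (daniellZ (dJ a)).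
  + by move=> a _; apply: (daniell_ge0 (dJ a)); exact: nf.2.
  + exact: mJ.
- move=> f_ nf nd.
  have nJ a : nondecreasing_seq (fun n => J a (f_ n)).
    by move=> p n pn; apply: (daniell_le (dJ a)) => // x; exact: nd.
  rewrite (_ : (fun a => J a _) = fun a => limn (fun n => J a (f_ n))).
    apply: cvg_monotone_convergence => //.
    + by move=> n; exact: mJ.
    + by move=> n a _; apply: (daniell_ge0 (dJ a)); exact: (nf n).2.
  by apply/funext => a; apply/esym/cvg_lim => //; exact: (daniell_cvg (dJ a)).
Qed.

End daniell_constructions.

Section integral_daniell.
Context d (T : measurableType d) (R : realType).
Lemma daniell_integral (m : {measure set T -> \bar R}) :
  daniell (fun f => \int[m]_x f x).
Proof.
by apply: (@daniell_bind _ T _ T R m (fun x f => f x)) => [a|f []//]; exact: daniell_eval.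
Qed.
End integral_daniell.

Section precomposed_kernel.
Context d0 d1 d2 (A : measurableType d0) (B : measurableType d1)
  (C : measurableType d2) (R : realType).
Variable k : R.-pker B ~> C.

(** Precomposition serves two purposes: it makes a kernel ignore part of its
    argument, and it redirects the states that are outside of the state space. *)
Definition kernel_precomp (p : A -> B) & measurable_fun setT p :=
  fun a : A => k (p a) : {measure set C -> \bar R}.

Variable p : A -> B.
Hypothesis mp : measurable_fun setT p.

Let measurable_precomp U : measurable U -> measurable_fun setT (kernel_precomp mp ^~ U).
Proof.
by move=> mU; apply: (measurableT_comp (f := fun b => k b U)) => //; exact: measurable_kernel.
Qed.

HB.instance Definition _ := isKernel.Build _ _ A C R (kernel_precomp mp) measurable_precomp.

Let precomp_prob a : kernel_precomp mp a setT = 1.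
Proof. exact: prob_kernel. Qed.

HB.instance Definition _ := Kernel_isProbability.Build _ _ A C R (kernel_precomp mp) precomp_prob.

Lemma measurable_kernel_integral (F : A * C -> \bar R) : nnmf F ->
  measurable_fun setT (fun a => \int[k (p a)]_c F (a, c)).
Proof.
move=> [mF F0].
exact: (measurable_fun_integral_finite_kernel F (kernel_precomp mp)).
Qed.

End precomposed_kernel.

Section as_probability.
Context d (T : measurableType d) (R : realType).

(** A measure of mass one repackaged so that the lemmas on probabilities apply
    to it. *)
Definition as_probability (m : {measure set T -> \bar R}) & m setT = 1 :
  set T -> \bar R := m.

Variable m : {measure set T -> \bar R}.
Hypothesis m1 : m setT = 1.

HB.instance Definition _ := Measure.copy (as_probability m1) m.
HB.instance Definition _ := Measure_isProbability.Build _ _ _ (as_probability m1) m1.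

End as_probability.

Lemma tonelli_prob d d' (X : measurableType d) (Y : measurableType d') (R : realType)
    (m1 : {measure set X -> \bar R}) (m2 : {measure set Y -> \bar R})
    (f : X * Y -> \bar R) :
  m1 setT = 1 -> m2 setT = 1 -> nnmf f ->
  \int[m1]_x \int[m2]_y f (x, y) = \int[m2]_y \int[m1]_x f (x, y).
Proof.
move=> p1 p2 [mf f0].
exact (@fubini_tonelli _ _ X Y R (as_probability p1) (as_probability p2) f mf f0).
Qed.

Local Close Scope ereal_scope.

(** * Kernels acting on dominated functions *)

Section dominated.
Context d (T : measurableType d) (R : realType).
Implicit Types (V f g : T -> R) (m : {measure set T -> \bar R}).

Definition dominated V : set (T -> R) := [set f : T -> R | measurable_fun setT f /\
  exists c : R, forall x, `|f x| <= c * V x].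

Lemma dominated_space V : (forall x, 1 <= V x) -> fun_space (dominated V).
Proof.
move=> V1; have V0 x : 0 <= V x by apply: le_trans (V1 x).
split=> [c|f g [mf [c fc]] [mg [c' gc]]|c f [mf [c' fc]]].
- split; first exact: measurable_cst.
  by exists `|c| => x; rewrite ler_peMr.
- split; first exact: measurable_funD.
  exists (c + c') => x; rewrite mulrDl; apply: le_trans (ler_normD _ _) _.
  exact: lerD.
- split; first exact: measurable_funM.
  exists (`|c| * c') => x; rewrite normrM -mulrA; exact: ler_wpM2l.
Qed.

Lemma dominated_mul f g : dominated (fun=> 1) f -> dominated (fun=> 1) g ->
  dominated (fun=> 1) (fun x => f x * g x).
Proof.
move=> [mf [c fc]] [mg [c' gc]]; split; first exact: measurable_funM.
exists (c * c') => x; rewrite normrM mulr1.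
have := fc x; have := gc x; rewrite !mulr1 => ? ?; exact: ler_pM.
Qed.

Lemma dominated_clamp V f B : (forall x, 1 <= V x) -> dominated V f ->
  dominated V (fun z => Num.max (- B) (Num.min B (f z))).
Proof.
move=> V1 [mf [c fc]]; split.
  by apply: measurable_maxr => //; apply: measurable_minr.
exists `|B| => x; apply: le_trans (_ : `|B| <= _); last by rewrite ler_peMr.
rewrite ler_norml; apply/andP; split.
  by rewrite le_max lerN2 ler_norm.
by rewrite ge_max -normrN ler_norm/= ge_min normrN ler_norm.
Qed.

Lemma dominated_integrable m V f : m.-integrable setT (EFin \o V) ->
  dominated V f -> m.-integrable setT (EFin \o f).
Proof.
move=> iV [mf [c fc]].
apply: (le_integrable measurableT (g := fun x => (c%:E * (V x)%:E)%E)).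
- exact/measurable_EFinP.
- move=> x _ /=; rewrite lee_fin; apply: le_trans (fc x) _; exact: ler_norm.
- exact: integrableZl.
Qed.

Lemma dominated_mean m V : m setT = 1%E -> (forall x, 1 <= V x) ->
  m.-integrable setT (EFin \o V) ->
  mean (dominated V) (fun f => \int[m]_x f x).
Proof.
move=> m1 V1 iV; split.
- by move=> f g Df Dg; rewrite RintegralD//; exact: dominated_integrable iV _.
- by move=> c f Df; rewrite RintegralZl//; exact: dominated_integrable iV _.
- by move=> f g Df Dg fg; apply: le_Rintegral => //; exact: dominated_integrable iV _.
- by rewrite Rintegral_cst// m1 mulr1.
Qed.

Lemma bounded_integrable m f : m setT = 1%E -> dominated (fun=> 1) f ->
  m.-integrable setT (EFin \o f).
Proof.
move=> m1; apply: dominated_integrable.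
apply/integrableP; split; first exact/measurable_EFinP.
under eq_integral do rewrite /= normr1.
by rewrite integral_cst// m1 mule1 ltry.
Qed.

Lemma bounded_mean m : m setT = 1%E ->
  mean (dominated (fun=> 1)) (fun f => \int[m]_x f x).
Proof.
move=> m1; apply: dominated_mean => //; apply: bounded_integrable => //.
by split=> //; exists 1 => x; rewrite normr1 mulr1.
Qed.

Section kernel.
Variable K : R.-pker T ~> T.

Let kprob z : K z setT = 1%E. Proof. exact: prob_kernel. Qed.

Definition kop f : T -> R := fun z => \int[K z]_y f y.

Lemma measurable_kop f : measurable_fun setT f -> measurable_fun setT (kop f).
Proof.
move=> mf; rewrite /kop /Rintegral.
apply: (@measurableT_comp _ _ _ _ _ _ fine) => //.
under eq_fun do rewrite integralE.
have mk U : measurable U -> measurable_fun setT (K ^~ U) by exact: measurable_kernel.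
apply: emeasurable_funB; apply: measurable_fun_integral_kernel => //.
- by apply: measurable_funepos; exact/measurable_EFinP.
- by apply: measurable_funeneg; exact/measurable_EFinP.
Qed.

(** A dominated function is integrable for each [K z] because [V] is, and its
    image is dominated again by the bound on [kop K V]. *)
Lemma kop_markov V : (forall x, 1 <= V x) ->
  (forall z, (K z).-integrable setT (EFin \o V)) ->
  (exists c, forall z, kop V z <= c * V z) ->
  markov_operator (dominated V) kop.
Proof.
move=> V1 iV [c Kc]; have mn z := dominated_mean (kprob z) V1 (iV z).
have sp := dominated_space V1.
have V0 x : 0 <= V x by apply: le_trans (V1 x).
split=> // f [mf [c' fc]]; split; first exact: measurable_kop.
exists (`|c'| * c) => z.
have DV : dominated V V.
  have := measurable_int _ (iV z) => /measurable_EFinP mV.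
  by split=> //; exists 1 => x; rewrite mul1r ger0_norm.
apply: le_trans (_ : kop (fun x => `|c'| * V x) z <= _); last first.
  rewrite /kop (mean_scale (mn z))// -mulrA; apply: ler_wpM2l => //; exact: Kc.
apply: (mean_norm_le sp (mn z)).
- by split=> //; exists c'.
- exact: fun_scale.
- move=> x; apply: le_trans (fc x) _; apply: ler_wpM2r => //; exact: ler_norm.
Qed.

Lemma bounded_kop_markov : markov_operator (dominated (fun=> 1)) kop.
Proof.
have b1 : dominated (fun=> 1) (fun=> 1 : R).
  by split=> //; exists 1 => x; rewrite normr1 mulr1.
apply: kop_markov => //.
  by move=> z; apply: bounded_integrable b1; exact: kprob.
by exists 1 => z; have := mean_one (bounded_mean (kprob z)); rewrite /kop mulr1 => ->.
Qed.

End kernel.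

End dominated.

(** * Bounded functions, reversibility and moments of chains *)

(** A Daniell functional is the integral against its measure, hence is
    determined by indicators. *)
Lemma eq_daniell d (T : measurableType d) (R : realType)
    (I J : (T -> \bar R) -> \bar R) : daniell I -> daniell J ->
  (forall A, measurable A -> I (EFin \o \1_A) = J (EFin \o \1_A)) ->
  forall f, nnmf f -> I f = J f.
Proof.
move=> dI dJ IJ f nf; rewrite -(integral_daniell dI)// -(integral_daniell dJ)//.
exact: eq_set_function_integral.
Qed.

Notation bounded := (dominated (fun=> 1)).

Section bounded_functions.
Context d (T : measurableType d) (R : realType).

Lemma bounded_cst (c : R) : bounded ((fun=> c) : T -> R).
Proof. by split=> //; exists `|c| => x; rewrite mulr1. Qed.

Lemma bounded_space : fun_space (@dominated d T R (fun=> 1)).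
Proof. exact: dominated_space. Qed.

Lemma bounded_shift (f : T -> R) : bounded f ->
  exists c, 0 <= c /\ forall x, 0 <= f x + c.
Proof.
move=> [mf [c fc]]; exists `|c|; split=> // x; rewrite -lerBlDr sub0r lerNl.
have := fc x; rewrite mulr1 ler_norml => /andP[h _].
by rewrite (le_trans _ (ler_norm c))// lerNl.
Qed.

Lemma bounded_nnmf (f : T -> R) : bounded f -> (forall x, 0 <= f x) ->
  nnmf (fun x => (f x)%:E).
Proof. by move=> [mf _] f0; exact: nnmf_EFin. Qed.

(** A bounded function is a difference of a nonnegative one and a constant, so
    that identities between bilinear expressions need only be checked where
    integrals are monotone. *)
Lemma bounded_biadditive_ext (b1 b2 : (T -> R) -> (T -> R) -> R) :
  (forall f f' g, bounded f -> bounded f' -> bounded g ->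
     b1 (fun x => f x + f' x) g = b1 f g + b1 f' g) ->
  (forall f g g', bounded f -> bounded g -> bounded g' ->
     b1 f (fun x => g x + g' x) = b1 f g + b1 f g') ->
  (forall f f' g, bounded f -> bounded f' -> bounded g ->
     b2 (fun x => f x + f' x) g = b2 f g + b2 f' g) ->
  (forall f g g', bounded f -> bounded g -> bounded g' ->
     b2 f (fun x => g x + g' x) = b2 f g + b2 f g') ->
  (forall f g, bounded f -> bounded g -> (forall x, 0 <= f x) ->
     (forall x, 0 <= g x) -> b1 f g = b2 f g) ->
  forall f g, bounded f -> bounded g -> b1 f g = b2 f g.
Proof.
move=> l1 r1 l2 r2 b12 f g bf bg.
have half f' : bounded f' -> (forall x, 0 <= f' x) -> b1 f' g = b2 f' g.
  move=> bf' f'0; have [c [c0 gc]] := bounded_shift bg.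
  have bc := bounded_cst c; have bgc := fun_add bounded_space bg bc.
  have := b12 _ _ bf' bgc f'0 gc; rewrite r1// r2// (b12 f' (fun=> c))//.
  exact: addIr.
have [c [c0 fc]] := bounded_shift bf.
have bc := bounded_cst c; have bfc := fun_add bounded_space bf bc.
have := half _ bfc fc; rewrite l1// l2// (half (fun=> c))//.
exact: addIr.
Qed.

Lemma EFin_Rintegral_bounded (m : {measure set T -> \bar R}) (f : T -> R) :
  m setT = 1%E -> bounded f ->
  ((\int[m]_x f x)%:E = \int[m]_x (f x)%:E)%E.
Proof.
by move=> m1 bf; rewrite fineK//; apply: integrable_fin_num => //; exact: bounded_integrable.
Qed.

End bounded_functions.

Section reversible_kernel.
Context d (T : measurableType d) (R : realType) (K : R.-pker T ~> T)
  (m : {measure set T -> \bar R}) (m1 : m setT = 1%E).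

Let kprob z : K z setT = 1%E. Proof. exact: prob_kernel. Qed.
Let sB := @bounded_space _ T R.
Let mK := bounded_kop_markov K.
Let mm := bounded_mean m1.

Lemma kop_ge0 f : (forall x, 0 <= f x) -> forall z, 0 <= kop K f z.
Proof. by move=> f0 z; apply: Rintegral_ge0. Qed.

Lemma EFin_kop f z : bounded f -> ((kop K f z)%:E = \int[K z]_y (f y)%:E)%E.
Proof. by move=> bf; rewrite EFin_Rintegral_bounded. Qed.

Lemma reversible_of_nonneg :
  (forall f g : T -> R, bounded f -> bounded g -> (forall x, 0 <= f x) ->
     (forall x, 0 <= g x) ->
     (\int[m]_z ((f z)%:E * \int[K z]_y (g y)%:E) =
      \int[m]_z ((g z)%:E * \int[K z]_y (f y)%:E))%E) ->
  reversible_model bounded (kop K) (fun f => \int[m]_x f x).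
Proof.
move=> sym; split=> //; first by move=> f g; exact: dominated_mul.
have bM f g : bounded f -> bounded g -> bounded (fun x : T => f x * g x : R).
  exact: dominated_mul.
have bK f : bounded f -> bounded (kop K f) by exact: (markov_fun mK).
apply: bounded_biadditive_ext => /=.
- move=> f f' g bf bf' bg; rewrite -(mean_add mm); last 2 first.
  + by apply: bM => //; exact: bK.
  + by apply: bM => //; exact: bK.
  by apply: eq_Rintegral => x _; rewrite mulrDl.
- move=> f g g' bf bg bg'; rewrite -(mean_add mm); last 2 first.
  + by apply: bM => //; exact: bK.
  + by apply: bM => //; exact: bK.
  apply: eq_Rintegral => x _; rewrite -mulrDr; congr (_ * _).
  exact: (mean_add (markov_mean mK x)).
- move=> f f' g bf bf' bg; rewrite -(mean_add mm); last 2 first.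
  + by apply: bM => //; exact: bK.
  + by apply: bM => //; exact: bK.
  apply: eq_Rintegral => x _; rewrite -mulrDl; congr (_ * _).
  exact: (mean_add (markov_mean mK x)).
- move=> f g g' bf bg bg'; rewrite -(mean_add mm); last 2 first.
  + by apply: bM => //; exact: bK.
  + by apply: bM => //; exact: bK.
  by apply: eq_Rintegral => x _; rewrite mulrDr.
- move=> f g bf bg f0 g0; congr fine.
  under eq_integral => x _ do rewrite EFinM EFin_kop//.
  by rewrite sym//; apply: eq_integral => x _; rewrite -EFin_kop// -EFinM mulrC.
Qed.

End reversible_kernel.

Section chain.
Context dO (Om : measurableType dO) d (T : measurableType d) (R : realType).
Variables (m : {measure set T -> \bar R}) (K : R.-pker T ~> T)
  (Pr : probability Om R) (Z : nat -> {RV Pr >-> T}).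
Hypothesis m1 : m setT = 1%E.
Hypothesis chain : markov_chain m (fun z A => K z A) Z.

Let kprob z : K z setT = 1%E. Proof. exact: prob_kernel. Qed.
Let mZ n : measurable_fun setT (Z n). Proof. exact: measurable_funPT. Qed.
Let Pr1 : Pr setT = 1%E. Proof. exact: probability_setT. Qed.

Lemma chain_init f : nnmf f -> (\int[Pr]_o f (Z 0%N o) = \int[m]_x f x)%E.
Proof.
move=> nf; apply: (@eq_daniell _ _ _ (fun f => \int[Pr]_o f (Z 0%N o))%E
  (fun f => \int[m]_x f x)%E) => //.
- have := daniell_weight (w := fun=> 1) (psi := Z 0%N) (daniell_integral Pr)
    (measurable_cst _) (fun=> ler01) (mZ 0).
  congr daniell; apply/funext => h; apply: eq_integral => o _.
  by rewrite mul1e.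
- exact: daniell_integral.
- move=> A mA; transitivity (\int[Pr]_o (\1_(Z 0%N @^-1` A) o)%:E)%E.
    by apply: eq_integral => o _; rewrite /= !indicE.
  rewrite !integral_indic//; last by rewrite -[X in measurable X]setTI; exact: mZ.
  by rewrite !setIT; exact: chain.1.
Qed.

(** The Markov property is used on the events that restrict the initial state
    only. *)
Lemma chain_step_indic n (A B : set T) : measurable A -> measurable B ->
  (\int[Pr]_o ((\1_A (Z 0%N o))%:E * (\1_B (Z n.+1 o))%:E) =
   \int[Pr]_o ((\1_A (Z 0%N o))%:E * K (Z n o) B))%E.
Proof.
move=> mA mB.
have mZA k C : measurable C -> measurable (Z k @^-1` C).
  by move=> mC; rewrite -[X in measurable X]setTI; exact: mZ.
pose As i := if i == 0%N then A else setT.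
have mAs i : measurable (As i) by rewrite /As; case: ifP.
have := chain.2 n As B mAs mB.
have -> : \bigcap_(i in `I_n.+1) (Z i @^-1` As i) = Z 0%N @^-1` A.
  apply/seteqP; split=> [w h|w h i _]; first exact: (h 0%N).
  by rewrite /As /=; case: eqP => // ->.
move=> /= h; transitivity (Pr (Z 0%N @^-1` A `&` Z n.+1 @^-1` B)).
  rewrite -[X in _ = Pr X]setIT -integral_indic//.
    by apply: eq_integral => o _; rewrite indicI /= EFinM.
  by apply: measurableI; exact: mZA.
rewrite h integral_mkcond; apply: eq_integral => o _.
rewrite patchE indicE /=.
have -> : (o \in Z 0%N @^-1` A) = (Z 0%N o \in A) by apply/idP/idP => /set_mem ?; exact/mem_set.
by case: ifPn => _; rewrite ?mul1e ?mul0e.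
Qed.

Lemma chain_step n (f g : T -> R) : bounded f -> bounded g ->
  (forall x, 0 <= f x) -> (forall x, 0 <= g x) ->
  (\int[Pr]_o ((f (Z 0%N o))%:E * (g (Z n.+1 o))%:E) =
   \int[Pr]_o ((f (Z 0%N o))%:E * (kop K g (Z n o))%:E))%E.
Proof.
move=> bf bg f0 g0.
have mK h : nnmf h -> measurable_fun setT (fun z => \int[K z]_y h y)%E.
  by move=> [mh h0]; apply: measurable_fun_integral_kernel => // U mU; exact: measurable_kernel.
have stepA A : measurable A ->
    (\int[Pr]_o ((\1_A (Z 0%N o))%:E * (g (Z n.+1 o))%:E) =
     \int[Pr]_o ((\1_A (Z 0%N o))%:E * \int[K (Z n o)]_y (g y)%:E))%E.
  move=> mA.
  have mw : measurable_fun setT (fun o => \1_A (Z 0%N o) : R).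
    by apply: (measurableT_comp (f := \1_A : T -> R)) => //; exact: mZ.
  apply: (@eq_daniell _ _ _ (fun g => \int[Pr]_o ((\1_A (Z 0%N o))%:E * g (Z n.+1 o)))%E
     (fun g => \int[Pr]_o ((\1_A (Z 0%N o))%:E * \int[K (Z n o)]_y g y))%E); last first.
  - exact: bounded_nnmf.
  - move=> B mB; rewrite chain_step_indic//; apply: eq_integral => o _.
    by rewrite integral_indic// setIT.
  - apply: daniell_bind => [w|h nh].
      have := daniell_weight (w := fun=> \1_A (Z 0%N w)) (psi := idfun)
        (daniell_integral (K (Z n w))) (measurable_cst _) (fun=> ler0n _ _) (@measurable_id _ _ _).
      congr daniell; apply/funext => h; rewrite indicE; case: (_ \in _).
        by rewrite mul1e; apply: eq_integral => z _; rewrite mul1e.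
      by rewrite mul0e integral0_eq// => z _; rewrite mul0e.
    apply: emeasurable_funM; first exact/measurable_EFinP.
    by apply: (measurableT_comp (f := fun z => \int[K z]_y h y)%E); [exact: mK|exact: mZ].
  - exact: (daniell_weight (daniell_integral Pr)).
have E1 := @eq_daniell _ _ _ (fun f => \int[Pr]_o ((g (Z n.+1 o))%:E * f (Z 0%N o)))%E
     (fun f => \int[Pr]_o ((kop K g (Z n o))%:E * f (Z 0%N o)))%E.
have mg := bg.1.
under eq_integral do rewrite muleC; under [RHS]eq_integral do rewrite muleC.
apply: (E1 _ _ _ (EFin \o f)); last exact: bounded_nnmf.
- apply: (daniell_weight (daniell_integral Pr)) => //.
  by apply: (measurableT_comp (f := g)) => //; exact: mZ.
- apply: (daniell_weight (daniell_integral Pr)) => //.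
    by apply: (measurableT_comp (f := kop K g)) => //; exact: measurable_kop.
  by move=> o; exact: kop_ge0.
- move=> A mA; under eq_integral do rewrite muleC.
  rewrite stepA//; apply: eq_integral => o _ /=.
  by rewrite EFin_kop// muleC.
Qed.

Lemma bounded_comp n (f : T -> R) : bounded f -> bounded (fun o => f (Z n o)).
Proof.
move=> [mf [c fc]]; split; last by exists c => o; exact: fc.
by apply: (measurableT_comp (f := f)) => //; exact: mZ.
Qed.

(** By induction on [n], the last step of the chain is replaced by the
    operator applied to [g]. *)
Lemma chain_moment n (f g : T -> R) : bounded f -> bounded g ->
  \int[Pr]_o (f (Z 0%N o) * g (Z n o)) = \int[m]_x (f x * iter n (kop K) g x).
Proof.
move=> + bg; elim: n f g bg => [|n IH] f g bg bf.
  have bfg : bounded (fun x => f x * g x) by exact: dominated_mul.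
  have [c [c0 h0]] := bounded_shift bfg; have bc := @bounded_cst _ T R c.
  have bfgc := fun_add (@bounded_space _ T R) bfg bc.
  have mP := bounded_mean Pr1; have mm := bounded_mean m1.
  have := congr1 fine (chain_init (bounded_nnmf bfgc h0)).
  have := mean_add mP (bounded_comp 0 bfg) (@bounded_cst _ Om R c).
  rewrite (mean_cst (@bounded_space _ _ _) mP) => eP.
  have := mean_add mm bfg bc; rewrite (mean_cst (@bounded_space _ _ _) mm) => em e.
  apply: (@addIr _ c); rewrite -em -eP; exact: e.
rewrite iterSr -IH//; last exact: (markov_fun (bounded_kop_markov K)).
have bc (h : T -> R) k : bounded h -> bounded (fun o => h (Z k o)) by exact: bounded_comp.
have bK (h : T -> R) : bounded h -> bounded (kop K h) by exact: (markov_fun (bounded_kop_markov K)).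
have mP := bounded_mean Pr1.
apply: (bounded_biadditive_ext (b1 := fun f g => \int[Pr]_o (f (Z 0%N o) * g (Z n.+1 o)))
  (b2 := fun f g => \int[Pr]_o (f (Z 0%N o) * kop K g (Z n o)))) => //.
- move=> f1 f2 h b1 b2 bh; rewrite -(mean_add mP); last 2 first.
  + by apply: dominated_mul; exact: bc.
  + by apply: dominated_mul; exact: bc.
  by apply: eq_Rintegral => x _; rewrite mulrDl.
- move=> h f1 f2 bh b1 b2; rewrite -(mean_add mP); last 2 first.
  + by apply: dominated_mul; exact: bc.
  + by apply: dominated_mul; exact: bc.
  by apply: eq_Rintegral => x _; rewrite mulrDr.
- move=> f1 f2 h b1 b2 bh; rewrite -(mean_add mP); last 2 first.
  + by apply: dominated_mul; apply: bc => //; exact: bK.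
  + by apply: dominated_mul; apply: bc => //; exact: bK.
  by apply: eq_Rintegral => x _; rewrite mulrDl.
- move=> h f1 f2 bh b1 b2; rewrite -(mean_add mP); last 2 first.
  + by apply: dominated_mul; apply: bc => //; exact: bK.
  + by apply: dominated_mul; apply: bc => //; exact: bK.
  apply: eq_Rintegral => x _; rewrite -mulrDr; congr (_ * _).
  exact: (mean_add (markov_mean (bounded_kop_markov K) _)).
- move=> f1 f2 b1 b2 p1 p2; congr fine.
  under eq_integral do rewrite EFinM; under [RHS]eq_integral do rewrite EFinM.
  exact: chain_step.
Qed.

End chain.

(** * Exchange of the two states under the proposal law *)

Local Open Scope ereal_scope.

Section tierney_swap.
Context d (X : measurableType d) (R : realType).
Variables (pi : probability X R) (q : R.-pker X ~> X).
Variables (S : set (X * X)) (r : X -> X -> R).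
Hypothesis hr : tierney_ratio pi q S r.

Definition proposal_integral (f : X * X -> \bar R) := \int[pi]_x \int[q x]_y f (x, y).

Lemma daniell_proposal : daniell proposal_integral.
Proof.
apply: daniell_bind => [x|f nf]; last first.
  exact: (measurable_kernel_integral q (@measurable_id _ _ _) nf).
have mx : measurable_fun setT (fun y : X => (x, y)) by exact: pair1_measurable.
have := daniell_weight (w := fun=> 1%R) (daniell_integral (q x)) (measurable_cst _) (fun=> ler01) mx.
congr daniell; apply/funext => h; apply: eq_integral => y _.
by rewrite mul1e.
Qed.

Let eta := daniell_measure daniell_proposal.

Lemma tierney_ratio_ge0 x y : (0 <= r x y)%R.
Proof.
have [Sxy|nS] := pselect (S (x, y)); first exact/ltW/(tierney_gt0 hr).
by rewrite (tierney_off hr).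
Qed.

Lemma xsection_indic (A : set (X * X)) x y : \1_A (x, y) = \1_(xsection A x) y :> R.
Proof. by rewrite !indicE mem_xsection. Qed.

(** The set function [proposal_law] is a measure only up to its values on
    non-measurable sets. *)
Let proposal_lawE A : measurable A -> proposal_law pi q A = eta A.
Proof.
move=> mA; apply: eq_integral => x _.
under eq_integral => y _ do rewrite /= xsection_indic.
by rewrite integral_indic ?setIT//; exact: measurable_xsection.
Qed.

Let swapXX (p : X * X) := (p.2, p.1).
Let mswap : measurable_fun setT swapXX.
Proof. by apply: measurable_fun_pair; [exact: measurable_snd|exact: measurable_fst]. Qed.

(** On [S] the reversed proposal law has density [r] with respect to the
    proposal law.  Off [S] both integrands vanish, so the singular parts do
    not matter. *)
Lemma tierney_swap (A B : X * X -> \bar R) : nnmf A -> nnmf B ->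
  (forall x y, ~ S (x, y) -> A (x, y) = 0) -> (forall x y, ~ S (x, y) -> B (x, y) = 0) ->
  (forall x y, S (x, y) -> A (x, y) = (r x y)%:E * B (y, x)) ->
  \int[pi]_x \int[q x]_y A (x, y) = \int[pi]_x \int[q x]_y B (x, y).
Proof.
move=> nA nB A0 B0 AB.
have mS := tierney_measurable_set hr.
(* the density of the reversed law, cut off outside S *)
pose w1 (p : X * X) : R := (\1_S p * r p.1 p.2)%R.
have mw1 : measurable_fun setT w1.
  by apply: measurable_funM => //; exact: (tierney_measurable hr).
have w10 p : (0 <= w1 p)%R by rewrite mulr_ge0// tierney_ratio_ge0.
have d1 : daniell (fun f => proposal_integral (fun p => (w1 p)%:E * f (idfun p))).
  exact: (daniell_weight daniell_proposal mw1 w10 (@measurable_id _ _ _)).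
have m1S : measurable_fun setT (\1_S : X * X -> R) by [].
have d2 : daniell (fun f => proposal_integral (fun p => (\1_S p)%:E * f (swapXX p))).
  by apply: (daniell_weight daniell_proposal).
have Ssym x y : (\1_S (x, y) : R) = \1_S (y, x).
  rewrite !indicE; congr (_ %:R); congr nat_of_bool.
  by apply/idP/idP => /set_mem h; apply/mem_set; exact: tierney_symmetric hr _ _ h.
have E A' : measurable A' -> proposal_integral (fun p => (w1 p)%:E * (EFin \o \1_A') (idfun p)) =
    proposal_integral (fun p => (\1_S p)%:E * (EFin \o \1_A') (swapXX p)).
  move=> mA'.
  have mSA : measurable (S `&` A') by exact: measurableI.
  have := tierney_density hr mSA (@subIsetl _ _ _).
  rewrite (@eq_set_function_integral _ _ _ _ eta _ _ proposal_lawE).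
  have nw : nnmf (fun p => (w1 p * \1_A' p)%:E).
    apply: nnmf_EFin => [|p]; last by rewrite mulr_ge0.
    exact: measurable_funM.
  have -> : \int[eta]_(z in S `&` A') (r z.1 z.2)%:E = \int[eta]_z (w1 z * \1_A' z)%:E.
    rewrite integral_mkcond; apply: eq_integral => z _.
    rewrite patchE in_setI /w1 !indicE.
    by case: (z \in S); case: (z \in A'); rewrite /= ?mul1r ?mulr1 ?mul0r ?mulr0.
  rewrite (integral_daniell _ nw) => h.
  transitivity (proposal_law_rev pi q (S `&` A')).
    by rewrite h; congr proposal_integral; apply/funext => p; rewrite EFinM.
  apply: eq_integral => x _.
  rewrite -(setIT (ysection _ _)) -integral_indic//; last exact: measurable_ysection.
  apply: eq_integral => y _.
  rewrite -EFinM; congr EFin; rewrite Ssym.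
  have -> : \1_(ysection (S `&` A') x) y = \1_(S `&` A') (y, x) :> R.
    by rewrite !indicE mem_ysection.
  by rewrite indicI.
pose B' p := B (swapXX p).
have nB' : nnmf B'.
  by case: nB => mB B00; split=> [|p]; [exact: measurableT_comp|exact: B00].
have := eq_daniell d1 d2 E nB'; rewrite /proposal_integral => E1.
transitivity (\int[pi]_x \int[q x]_y ((w1 (x, y))%:E * B' (x, y))).
  apply: eq_integral => x _; apply: eq_integral => y _.
  rewrite /w1 indicE /=; have [Sxy|nS] := pselect (S (x, y)).
    by rewrite (mem_set Sxy) /= mul1r; exact: AB.
  by rewrite (memNset nS) /= mul0r mul0e (A0 _ _ nS).
rewrite E1; apply: eq_integral => x _; apply: eq_integral => y _.
rewrite indicE /=; have [Sxy|nS] := pselect (S (x, y)).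
  by rewrite (mem_set Sxy) /= mul1e.
by rewrite (B0 _ _ nS) (memNset nS); exact: mul0e.
Qed.

End tierney_swap.

Local Close Scope ereal_scope.

(** * The Metropolis-Hastings kernel *)

Local Open Scope ereal_scope.

Section metropolis.
Context d (T : measurableType d) (R : realType).
Variable acc : T -> (T -> \bar R) -> \bar R.
Hypotheses (dacc : forall z, daniell (acc z))
  (macc : forall f, nnmf f -> measurable_fun setT (fun z => acc z f))
  (acc_le1 : forall z, acc z (cst 1%:E) <= 1).

(** The mass that [acc z] lacks is put at [z], which makes a probability of
    it. *)
Definition reject z : R := (1 - fine (acc z (cst 1%:E)))%R.

Lemma acc_fin z : acc z (cst 1%:E) \is a fin_num.
Proof.
rewrite ge0_fin_numE; first exact: le_lt_trans (acc_le1 z) (ltry _).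
by apply: (daniell_ge0 (dacc z)).
Qed.

Lemma reject_ge0 z : (0 <= reject z)%R.
Proof. by rewrite subr_ge0 -lee_fin fineK ?acc_fin. Qed.

Lemma EFin_reject z : (reject z)%:E = 1 - acc z (cst 1%:E).
Proof. by rewrite EFinB fineK ?acc_fin. Qed.

Lemma measurable_reject : measurable_fun setT reject.
Proof.
apply: measurable_funB => //; apply: (measurableT_comp (f := @fine R)) => //.
by apply: macc; exact: nnmf_cst.
Qed.

Lemma daniell_metropolis z : daniell (fun f => acc z f + (reject z)%:E * f z).
Proof.
apply: daniell_plus => //.
exact: (daniell_weight (daniell_eval R z) (measurable_cst _) (fun=> reject_ge0 z)
  (@measurable_id _ _ _)).
Qed.

Definition metropolis & (forall f, nnmf f -> measurable_fun setT (fun z => acc z f)) :=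
  fun z : T => daniell_measure (daniell_metropolis z) : {measure set T -> \bar R}.

Let measurable_metropolis U : measurable U -> measurable_fun setT (metropolis macc ^~ U).
Proof.
move=> mU; have nU := nnmf_indic R mU; apply: emeasurable_funD; first exact: macc.
apply: emeasurable_funM; first by apply/measurable_EFinP; exact: measurable_reject.
by case: nU.
Qed.

HB.instance Definition _ := isKernel.Build _ _ T T R (metropolis macc) measurable_metropolis.

Let metropolis_prob z : metropolis macc z setT = 1.
Proof.
have E : EFin \o \1_[set: T] = cst 1%:E :> (T -> \bar R).
  by apply/funext => x /=; rewrite indicT.
change (acc z (EFin \o \1_setT) + (reject z)%:E * (EFin \o \1_setT) z = 1).
by rewrite E mule1 EFin_reject addeC subeK// acc_fin.
Qed.

HB.instance Definition _ := Kernel_isProbability.Build _ _ T T R (metropolis macc) metropolis_prob.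

Lemma integral_metropolis z f : nnmf f ->
  \int[metropolis macc z]_y f y = acc z f + (reject z)%:E * f z.
Proof. exact: integral_daniell. Qed.

Lemma metropolisE z A : metropolis macc z A = acc z (EFin \o \1_A) + \d_z A * (1 - acc z (cst 1%:E)).
Proof.
change (acc z (EFin \o \1_A) + (reject z)%:E * (EFin \o \1_A) z =
  acc z (EFin \o \1_A) + \d_z A * (1 - acc z (cst 1%:E))).
by rewrite EFin_reject muleC diracE.
Qed.

End metropolis.

Lemma nnmf_pair1 d1 d2 (A : measurableType d1) (B : measurableType d2) (R : realType)
  (F : A * B -> \bar R) a : nnmf F -> nnmf (fun b => F (a, b)).
Proof.
move=> [mF F0]; split=> [|b]; last exact: F0.
exact: measurable_fun_pair2.
Qed.

Section mh_reversible.
Context d (X : measurableType d) (R : realType).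
Variables (pi : probability X R) (q : R.-pker X ~> X).
Variables (S : set (X * X)) (r : X -> X -> R).
Hypothesis hr : tierney_ratio pi q S r.

Let qprob x : q x setT = 1. Proof. exact: prob_kernel. Qed.

Definition mh_acc x (f : X -> \bar R) := \int[q x]_y ((Num.min 1 (r x y))%:E * f y).

Let mr := tierney_measurable hr.

Lemma mh_min_ge0 x y : (0 <= Num.min 1 (r x y))%R.
Proof. by rewrite le_min ler01 (tierney_ratio_ge0 hr). Qed.

Lemma measurable_mh_min : measurable_fun setT (fun p : X * X => (Num.min 1 (r p.1 p.2) : R)%R).
Proof. by apply: measurable_minr => //. Qed.

Lemma daniell_mh_acc x : daniell (mh_acc x).
Proof.
exact: (daniell_weight (daniell_integral (q x)) (measurable_fun_pair2 x measurable_mh_min)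
  (mh_min_ge0 x) (@measurable_id _ _ _)).
Qed.

Lemma measurable_mh_acc f : nnmf f -> measurable_fun setT (fun x => mh_acc x f).
Proof.
move=> [mf f0].
apply: (measurable_kernel_integral q (@measurable_id _ _ _)
  (F := fun p => (Num.min 1 (r p.1 p.2))%:E * f p.2)).
apply: nnmfM; first by apply: nnmf_EFin; [exact: measurable_mh_min|move=> p; exact: mh_min_ge0].
by split=> [|p]; [exact: measurableT_comp|].
Qed.

Lemma mh_acc_le x f : nnmf f -> mh_acc x f <= \int[q x]_y f y.
Proof.
move=> nf; apply: ge0_le_integral => //.
- by move=> y _; rewrite mule_ge0 ?lee_fin ?mh_min_ge0//; exact: nf.2.
- apply: emeasurable_funM; last exact: nf.1.
  by apply/measurable_EFinP; exact: (measurable_fun_pair2 x measurable_mh_min).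
- exact: nf.1.
- move=> y _; rewrite -[leRHS]mul1e lee_wpmul2r ?lee_fin ?ge_min ?lexx//.
  exact: nf.2.
Qed.

Lemma mh_acc_le1 x : mh_acc x (cst 1%:E) <= 1.
Proof.
have n1 : nnmf (cst 1%:E : X -> \bar R) by apply: nnmf_cst; rewrite lee_fin.
apply: (le_trans (mh_acc_le x n1)).
by rewrite integral_cst// qprob mule1.
Qed.

Definition mh : R.-pker X ~> X := metropolis daniell_mh_acc mh_acc_le1 measurable_mh_acc.

Lemma mhE x A : measurable A -> mh x A = mh_kernel q r x A.
Proof.
move=> mA; rewrite /mh metropolisE /mh_kernel; congr (_ + _).
  rewrite [RHS]integral_mkcond; apply: eq_integral => y _.
  rewrite patchE /= indicE; case: (y \in A); rewrite ?mule1 ?mule0//.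
congr (_ * (1 - _)); apply: eq_integral => y _; exact: mule1.
Qed.

Lemma integral_mh x f : nnmf f ->
  \int[mh x]_y f y = mh_acc x f + (reject mh_acc x)%:E * f x.
Proof. exact: integral_metropolis. Qed.

(** The accepted part is symmetric by [tierney_swap], since [r x y min(1, r y
    x) = min(r x y, 1)] on [S]; the rejected part is carried by the diagonal. *)
Lemma mh_reversible : reversible_model bounded (kop mh) (fun f => \int[pi]_x f x)%R.
Proof.
apply: reversible_of_nonneg; first exact: probability_setT.
move=> f g bf bg f0 g0.
have nf := bounded_nnmf bf f0; have ng := bounded_nnmf bg g0.
have mrej := measurable_reject measurable_mh_acc.
pose G (f g : X -> R) (p : X * X) := (Num.min 1 (r p.1 p.2))%:E * ((f p.1)%:E * (g p.2)%:E).
have nG f' g' : bounded f' -> bounded g' -> (forall x, 0 <= f' x)%R -> (forall x, 0 <= g' x)%R -> nnmf (G f' g').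
  move=> [mf' _] [mg' _] f0' g0'; apply: nnmfM.
    by apply: nnmf_EFin; [exact: measurable_mh_min|move=> p; exact: mh_min_ge0].
  by apply: nnmfM; apply: nnmf_EFin => //; exact: measurableT_comp.
have expand (f' g' : X -> R) : bounded f' -> bounded g' -> (forall x, 0 <= f' x)%R -> (forall x, 0 <= g' x)%R ->
    \int[pi]_z ((f' z)%:E * \int[mh z]_y (g' y)%:E) =
    \int[pi]_x \int[q x]_y (G f' g' (x, y)) +
    \int[pi]_x ((reject mh_acc x)%:E * ((f' x)%:E * (g' x)%:E)).
  move=> bf' bg' f0' g0'; have nf' := bounded_nnmf bf' f0'; have ng' := bounded_nnmf bg' g0'.
  have nGx := nG _ _ bf' bg' f0' g0'.
  rewrite -ge0_integralD//; last 4 first.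
  - by move=> x _; apply: integral_ge0 => y _; exact: nGx.2.
  - exact: (measurable_kernel_integral q (@measurable_id _ _ _) nGx).
  - by move=> x _; rewrite !mule_ge0 ?lee_fin ?reject_ge0//; [exact: daniell_mh_acc|exact: mh_acc_le1].
  - apply: emeasurable_funM; first exact/measurable_EFinP.
    by apply: emeasurable_funM; [exact: nf'.1|exact: ng'.1].
  apply: eq_integral => x _; rewrite integral_mh// ge0_muleDr; last 2 first.
  - by apply: (daniell_ge0 (daniell_mh_acc x)) => y; rewrite lee_fin.
  - by rewrite mule_ge0 ?lee_fin ?reject_ge0//; [exact: daniell_mh_acc|exact: mh_acc_le1].
  congr (_ + _); last by rewrite muleCA.
  rewrite -(daniellZ (daniell_mh_acc x)) ?f0'//.
rewrite !expand//; congr (_ + _); last first.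
  by apply: eq_integral => x _; rewrite (muleC (f x)%:E).
apply: (tierney_swap hr); [exact: nG|exact: nG|..].
- by move=> x y nS; rewrite /G /= (tierney_off hr)// min_r ?ler01// mul0e.
- by move=> x y nS; rewrite /G /= (tierney_off hr)// min_r ?ler01// mul0e.
- move=> x y Sxy; rewrite /G /= -!EFinM; congr EFin; rewrite [RHS]mulrA (mulrC (g y)).
  by rewrite minr_pMr ?(tierney_ratio_ge0 hr)// mulr1 (tierney_recip hr)// minC.
Qed.

End mh_reversible.

Local Close Scope ereal_scope.

(** * The pseudo-marginal kernel *)

Section pseudo_marginal.
Context d (X : measurableType d) (R : realType).
Variables (pi : probability X R) (q : R.-pker X ~> X).
Variables (S : set (X * X)) (r : X -> X -> R).
Hypothesis hr : tierney_ratio pi q S r.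
Variables (W : set R) (mW : measurable W) (W0 : forall w, W w -> 0 <= w).
Variable Q : R.-pker X ~> R.
Hypothesis QW : forall x, Q x W = 1%E.
Hypothesis Qmean : forall x, (\int[Q x]_(w in W) w%:E = 1)%E.

Local Notation E := (X * R)%type.

Let qprob x : q x setT = 1%E. Proof. exact: prob_kernel. Qed.
Let Qprob x : Q x setT = 1%E. Proof. exact: prob_kernel. Qed.
Let r0 x y : 0 <= r x y. Proof. exact: tierney_ratio_ge0 hr x y. Qed.
Let mr := tierney_measurable hr.

Definition pm_weight (z : E) : R := \1_W z.2 * z.2.

(** The factor [\1_W] restricts the weights to [W], so that integrals over
    weights can be taken over the whole line. *)
Definition pm_accW (z z' : E) : R := \1_W z'.2 * pm_accept r z.1 z.2 z'.1 z'.2.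

(** The rate at which mass moves between two states, up to [q] and [Q].
    Multiplying the acceptance probability [min(1, r u / w)] by the weight [w]
    of the target gives [min(w, r u)], an expression that makes sense at [w =
    0] too and is symmetric up to [r]. *)
Definition pm_flow (z z' : E) : R :=
  \1_W z.2 * \1_W z'.2 * Num.min z.2 (r z.1 z'.1 * z'.2).

Let indW (w : R) : W w \/ \1_W w = 0 :> R.
Proof.
by rewrite indicE; have [Ww|nW] := pselect (W w); [left|right; rewrite memNset].
Qed.

Let indW1 w : W w -> \1_W w = 1 :> R.
Proof. by move=> Ww; rewrite indicE mem_set. Qed.

Lemma pm_weight_ge0 z : 0 <= pm_weight z.
Proof.
by rewrite /pm_weight; case: (indW z.2) => [/W0|->]; rewrite ?mul0r// => ?; rewrite mulr_ge0.
Qed.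

Lemma pm_accW_ge0 z z' : 0 <= pm_accW z z'.
Proof.
rewrite /pm_accW; case: (indW z'.2) => [/W0 u0|->]; last by rewrite mul0r.
rewrite mulr_ge0// /pm_accept; case: ifPn => // w0.
by rewrite le_min ler01 mulr_ge0// divr_ge0// ltW.
Qed.

Lemma pm_accW_le z z' : pm_accW z z' <= \1_W z'.2.
Proof.
rewrite /pm_accW ler_piMr// /pm_accept; case: ifPn => // _.
by rewrite ge_min lexx.
Qed.

Lemma pm_flow_ge0 z z' : 0 <= pm_flow z z'.
Proof.
rewrite /pm_flow; case: (indW z.2) => [/W0 u0|->]; last by rewrite !mul0r.
case: (indW z'.2) => [/W0 u0'|->]; last by rewrite mulr0 !mul0r.
by rewrite mulr_ge0// le_min u0 mulr_ge0.
Qed.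

Lemma pm_flowE z z' : pm_weight z * pm_accW z z' = pm_flow z z'.
Proof.
rewrite /pm_weight /pm_accW /pm_flow -mulrA.
case: (indW z.2) => [Wz|->]; last by rewrite !mul0r.
case: (indW z'.2) => [Wz'|->]; last by rewrite !mul0r !mulr0.
rewrite !indW1// !mul1r /pm_accept; case: ifPn => [w0|].
  by rewrite minr_pMr ?ltW// mulr1 mulrCA (mulrCA z.2) divff ?gt_eqF// mulr1.
rewrite -leNgt => w0; have -> : z.2 = 0 by apply/eqP; rewrite eq_le w0 W0.
by rewrite mul0r min_l// mulr_ge0// W0.
Qed.

Lemma pm_flow_recip z z' : S (z.1, z'.1) ->
  r z.1 z'.1 * pm_flow z' z = pm_flow z z'.
Proof.
move=> Szz; rewrite /pm_flow mulrCA [in RHS](mulrC (\1_W z.2)); congr (_ * _).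
by rewrite minr_pMr// mulrA (tierney_recip hr)// mul1r minC.
Qed.

Lemma pm_flow_off z z' : ~ S (z.1, z'.1) -> pm_flow z z' = 0.
Proof.
move=> nS; rewrite /pm_flow (tierney_off hr)// mul0r.
case: (indW z.2) => [/W0 w0|->]; last by rewrite !mul0r.
by rewrite min_r// mulr0.
Qed.

Let m11 : measurable_fun setT (fun p : E * E => p.1.1).
Proof. exact: measurableT_comp. Qed.
Let m12 : measurable_fun setT (fun p : E * E => p.1.2).
Proof. exact: measurableT_comp. Qed.
Let m21 : measurable_fun setT (fun p : E * E => p.2.1).
Proof. exact: measurableT_comp. Qed.
Let m22 : measurable_fun setT (fun p : E * E => p.2.2).
Proof. exact: measurableT_comp. Qed.
Let mr2 : measurable_fun setT (fun p : E * E => r p.1.1 p.2.1).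
Proof.
exact: (measurableT_comp mr (measurable_fun_pair m11 m21)).
Qed.
Let mind (f : E * E -> R) : measurable_fun setT f -> measurable_fun setT (fun p => \1_W (f p) : R).
Proof. by move=> mf; apply: measurableT_comp. Qed.

Lemma measurable_pm_accW : measurable_fun setT (fun p : E * E => pm_accW p.1 p.2).
Proof.
apply: measurable_funM; first exact: mind.
rewrite (_ : (fun p => _) = (fun p : E * E => if 0 < p.1.2 then
  Num.min 1 (r p.1.1 p.2.1 * (p.2.2 * (p.1.2 `^ (- 1)))) else 1)); last first.
  apply/funext => p; rewrite /pm_accept; case: ifPn => // w0.
  by rewrite powR_inv1// ltW.
apply: measurable_fun_ifT => //; first exact: measurable_fun_ltr.
apply: measurable_minr => //; apply: measurable_funM => //.
apply: measurable_funM => //.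
apply: (measurableT_comp (f := fun x : R => x `^ (- 1)) _ m12).
exact: measurable_powR.
Qed.

Lemma measurable_pm_weight : measurable_fun setT pm_weight.
Proof. by apply: measurable_funM => //; apply: measurableT_comp. Qed.

Lemma measurable_pm_flow : measurable_fun setT (fun p : E * E => pm_flow p.1 p.2).
Proof.
apply: measurable_funM.
  by apply: measurable_funM; exact: mind.
by apply: measurable_minr => //; apply: measurable_funM.
Qed.

Local Open Scope ereal_scope.

Definition pm_acc (z : E) (f : E -> \bar R) :=
  \int[q z.1]_y \int[Q y]_u ((pm_accW z (y, u))%:E * f (y, u)).

Let nn_accW (h : E * E -> \bar R) : nnmf h ->
  nnmf (fun p : (E * X) * R => (pm_accW p.1.1 (p.1.2, p.2))%:E * h (p.1.1, (p.1.2, p.2))).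
Proof.
move=> nh.
have mp : measurable_fun setT (fun p : (E * X) * R => (p.1.1, (p.1.2, p.2))).
  apply: measurable_fun_pair; first exact: measurableT_comp.
  by apply: measurable_fun_pair => //; exact: measurableT_comp.
apply: nnmfM.
  apply: nnmf_EFin => [|p]; last exact: pm_accW_ge0.
  exact: (measurableT_comp measurable_pm_accW mp).
split=> [|p]; last exact: nh.2.
exact: (measurableT_comp nh.1 mp).
Qed.

Lemma measurable_pm_acc2 (h : E * E -> \bar R) : nnmf h ->
  nnmf (fun z => pm_acc z (fun z' => h (z, z'))).
Proof.
move=> nh; have nF := nn_accW nh; split; last first.
  by move=> z; apply: integral_ge0 => y _; apply: integral_ge0 => u _; exact: (nF.2 ((z, y), u)).
have m2 : measurable_fun setT (snd : E * X -> X) by exact: measurable_snd.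
have m1 : measurable_fun setT (fst : E -> X) by exact: measurable_fst.
have h1 := measurable_kernel_integral Q m2 nF.
apply: (measurable_kernel_integral q m1
  (F := fun p : E * X => \int[Q p.2]_u ((pm_accW p.1 (p.2, u))%:E * h (p.1, (p.2, u))))).
split=> [|p]; first exact: h1.
by apply: integral_ge0 => u _; exact: (nF.2 (p, u)).
Qed.

Lemma measurable_pm_acc f : nnmf f -> measurable_fun setT (fun z => pm_acc z f).
Proof.
move=> nf; have n2 : nnmf (fun p : E * E => f p.2).
  by case: nf => mf f0; split=> [|p]; [exact: measurableT_comp|exact: f0].
exact: (measurable_pm_acc2 n2).1.
Qed.

Lemma daniell_pm_acc z : daniell (pm_acc z).
Proof.
apply: daniell_bind => [y|f nf].
  apply: (daniell_weight (daniell_integral (Q y))).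
  - apply: (measurableT_comp measurable_pm_accW (g := fun u => (z, (y, u)))).
    by apply: measurable_fun_pair => //; exact: pair1_measurable.
  - by move=> u; exact: pm_accW_ge0.
  - exact: pair1_measurable.
have n2 : nnmf (fun p : E * E => f p.2).
  by case: nf => mf f0; split=> [|p]; [exact: measurableT_comp|exact: f0].
have nF := nn_accW n2.
apply: (measurable_kernel_integral Q (@measurable_id _ _ _)
  (F := fun p : X * R => (pm_accW z p)%:E * f p)).
apply: nnmfM => //; apply: nnmf_EFin => [|p]; last exact: pm_accW_ge0.
exact: (measurable_fun_pair2 z measurable_pm_accW).
Qed.

Lemma pm_acc_le1 z : pm_acc z (cst 1%:E) <= 1.
Proof.
have h y : \int[Q y]_u ((pm_accW z (y, u))%:E * 1%:E) <= 1.
  apply: (@le_trans _ _ (\int[Q y]_u 1%:E)); last by rewrite integral_cst// Qprob mule1.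
  apply: ge0_le_integral => //.
  - by move=> u _; rewrite mule1 lee_fin pm_accW_ge0.
  - apply: emeasurable_funM => //; apply/measurable_EFinP.
    apply: (measurableT_comp measurable_pm_accW (g := fun u => (z, (y, u)))).
    by apply: measurable_fun_pair => //; exact: pair1_measurable.
  - by move=> u _; rewrite mule1 lee_fin (le_trans (pm_accW_le _ _))// indicE lern1 leq_b1.
apply: (@le_trans _ _ (\int[q z.1]_y 1%:E)); last by rewrite integral_cst// qprob mule1.
apply: ge0_le_integral => //.
- by move=> y _; apply: integral_ge0 => u _; rewrite mule1 lee_fin pm_accW_ge0.
- have n1 : nnmf (fun p : X * R => (pm_accW z p)%:E * 1%:E).
    apply: nnmfM; last by apply: nnmf_cst; rewrite lee_fin.
    apply: nnmf_EFin => [|p]; last exact: pm_accW_ge0.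
    exact: (measurable_fun_pair2 z measurable_pm_accW).
  exact: (measurable_kernel_integral Q (@measurable_id _ _ _) n1).
Qed.

Definition pm : R.-pker E ~> E := metropolis daniell_pm_acc pm_acc_le1 measurable_pm_acc.

Lemma integral_pm z f : nnmf f ->
  \int[pm z]_y f y = pm_acc z f + (reject pm_acc z)%:E * f z.
Proof. exact: integral_metropolis. Qed.

Lemma pmE z A : measurable A -> pm z A = pm_kernel W Q q r z A.
Proof.
move=> mA.
have e1 : pm_acc z (EFin \o \1_A) = \int[q z.1]_y \int[Q y]_(u in W `&` xsection A y)
    (pm_accept r z.1 z.2 y u)%:E.
  apply: eq_integral => y _; rewrite [RHS]integral_mkcond; apply: eq_integral => u _.
  rewrite patchE /= in_setI mem_xsection !indicE /pm_accW indicE /=.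
  by case: (u \in W); case: ((y, u) \in A); rewrite /= ?mul1r ?mul0r ?mule1 ?mule0 ?mul0e.
have e2 : pm_acc z (cst 1%:E) = \int[q z.1]_y \int[Q y]_(u in W) (pm_accept r z.1 z.2 y u)%:E.
  apply: eq_integral => y _; rewrite [RHS]integral_mkcond; apply: eq_integral => u _.
  by rewrite patchE /pm_accW /= indicE; case: (u \in W); rewrite /= ?mul1r ?mul0r ?mule1 ?mul0e.
rewrite /pm_kernel -e1 -e2.
exact: (metropolisE daniell_pm_acc measurable_pm_acc pm_acc_le1 z A).
Qed.

Definition pmt_int (f : E -> \bar R) :=
  \int[pi]_x \int[Q x]_w ((pm_weight (x, w))%:E * f (x, w)).

Lemma daniell_pmt : daniell pmt_int.
Proof.
apply: daniell_bind => [x|f nf].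
  apply: (daniell_weight (daniell_integral (Q x))).
  - by apply: (measurableT_comp measurable_pm_weight); exact: pair1_measurable.
  - by move=> w; exact: pm_weight_ge0.
  - exact: pair1_measurable.
apply: (measurable_kernel_integral Q (@measurable_id _ _ _)
  (F := fun p => (pm_weight p)%:E * f p)).
by apply: nnmfM => //; apply: nnmf_EFin; [exact: measurable_pm_weight|exact: pm_weight_ge0].
Qed.

Definition pmt : {measure set E -> \bar R} := daniell_measure daniell_pmt.

Lemma integral_pmt f : nnmf f -> \int[pmt]_z f z = pmt_int f.
Proof. exact: integral_daniell. Qed.

Lemma pmtE A : measurable A -> pmt A = pm_target W Q pi A.
Proof.
move=> mA; apply: eq_integral => x _.
rewrite [RHS]integral_mkcond; apply: eq_integral => u _.
rewrite patchE /= in_setI mem_xsection !indicE /pm_weight indicE /=.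
by case: (u \in W); case: ((x, u) \in A); rewrite /= ?mul1r ?mul0r ?mule1 ?mule0 ?mul0e.
Qed.

Lemma pm_weight_int x : \int[Q x]_w (pm_weight (x, w))%:E = 1.
Proof.
rewrite -(Qmean x) [RHS]integral_mkcond; apply: eq_integral => w _.
by rewrite patchE /pm_weight /= indicE; case: (w \in W); rewrite ?mul1r ?mul0r.
Qed.

Lemma pmt_marginal (f : X -> \bar R) : nnmf f -> \int[pmt]_z f z.1 = \int[pi]_x f x.
Proof.
move=> [mf f0]; rewrite integral_pmt; last first.
  by split=> [|z]; [exact: measurableT_comp|exact: f0].
apply: eq_integral => x _ /=.
under eq_integral do rewrite muleC.
rewrite ge0_integralZl//.
- by rewrite pm_weight_int mule1.
- by apply/measurable_EFinP/(measurableT_comp measurable_pm_weight); exact: pair1_measurable.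
- by move=> w _; rewrite lee_fin pm_weight_ge0.
Qed.

Lemma pmt_setT : pmt setT = 1.
Proof.
have n1 : nnmf (cst 1%:E : X -> \bar R) by apply: nnmf_cst; rewrite lee_fin.
have := pmt_marginal n1; rewrite !integral_cst// !mul1e => ->.
exact: probability_setT.
Qed.

Variable wp : R.
Hypothesis Wwp : W wp.

(** Drift and minorization hold on [X x W] only.  A state with a weight
    outside [W] is treated as if its weight were [wp], which extends them to
    the whole product. *)
Definition pmp (z : E) : E := (z.1, (\1_W z.2 * z.2 + (1 - \1_W z.2) * wp)%R).

Lemma pmp_id z : W z.2 -> pmp z = z.
Proof.
by move=> Wz; rewrite /pmp indW1// mul1r subrr mul0r addr0; case: z {Wz}.
Qed.

Lemma pmpW z : W (pmp z).2.
Proof.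
have [Wz|nW] := pselect (W z.2); first by rewrite pmp_id.
by rewrite /pmp /= indicE memNset//= mul0r add0r subr0 mul1r.
Qed.

Lemma measurable_pmp : measurable_fun setT pmp.
Proof.
have mi : measurable_fun setT (fun z : E => (\1_W z.2 : R)%R) by apply: measurableT_comp.
apply: measurable_fun_pair => //; apply: measurable_funD.
  by apply: measurable_funM.
by apply: measurable_funM => //; apply: measurable_funB.
Qed.

(** This kernel coincides with [pm] on [X x W], which carries the target. *)
Definition pmK : R.-pker E ~> E := kernel_precomp pm measurable_pmp.

Lemma pmKE z : W z.2 -> pmK z = pm z.
Proof. by move=> Wz; rewrite -{2}(pmp_id Wz). Qed.

Lemma eq_integral_pmt f g : nnmf f -> nnmf g -> (forall z, W z.2 -> f z = g z) ->
  \int[pmt]_z f z = \int[pmt]_z g z.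
Proof.
move=> nf ng fg; rewrite (integral_pmt nf) (integral_pmt ng).
apply: eq_integral => x _; apply: eq_integral => w _.
case: (indW w) => [Ww|nW]; first by rewrite fg.
by rewrite /pm_weight /= nW mul0r !mul0e.
Qed.

(** The contribution of the accepted moves from [x] to [y]; both weights are
    integrated out, so that [tierney_swap] applies to what is left. *)
Definition pmJ (h : E * E -> \bar R) x y :=
  \int[Q x]_w \int[Q y]_u ((pm_flow (x, w) (y, u))%:E * h ((x, w), (y, u))).

Let nn_flow (h : E * E -> \bar R) : nnmf h ->
  nnmf (fun p => (pm_flow p.1 p.2)%:E * h p).
Proof.
move=> nh; apply: nnmfM => //; apply: nnmf_EFin => [|p]; last exact: pm_flow_ge0.
exact: measurable_pm_flow.
Qed.

Let nnmf_comp d1 d2 (A : measurableType d1) (B : measurableType d2)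
  (h : B -> \bar R) (g : A -> B) : nnmf h -> measurable_fun setT g -> nnmf (fun a => h (g a)).
Proof. by move=> [mh h0] mg; split=> [|a]; [exact: measurableT_comp|exact: h0]. Qed.

Lemma nnmf_pmJ (h : E * E -> \bar R) : nnmf h -> nnmf (fun p => pmJ h p.1 p.2).
Proof.
move=> nh; have nf := nn_flow nh.
pose c1 (a : ((X * X) * R) * R) : E * E := ((a.1.1.1, a.1.2), (a.1.1.2, a.2)).
have mc1 : measurable_fun setT c1.
  apply: measurable_fun_pair; apply: measurable_fun_pair => //.
  - by apply: measurableT_comp => //; apply: measurableT_comp.
  - exact: measurableT_comp.
  - by apply: measurableT_comp => //; apply: measurableT_comp.
have n1 := nnmf_comp nf mc1.
have mp2 : measurable_fun setT (fun a : (X * X) * R => a.1.2) by exact: measurableT_comp.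
have m1 := measurable_kernel_integral Q mp2 n1.
have n2 : nnmf (fun a : (X * X) * R => \int[Q a.1.2]_u ((pm_flow (c1 (a, u)).1 (c1 (a, u)).2)%:E * h (c1 (a, u)))).
  by split=> [//|a]; apply: integral_ge0 => u _; exact: (n1.2 (a, u)).
split; last by move=> p; apply: integral_ge0 => w _; apply: integral_ge0 => u _; exact: (nf.2 (_, _)).
have mf1 : measurable_fun setT (fst : X * X -> X) by exact: measurable_fst.
exact: (measurable_kernel_integral Q mf1 n2).
Qed.

(** The proposal of [y] and the choice of the current weight are independent
    given [x], so that the integrals can be exchanged and the weights
    integrated out together. *)
Lemma integral_pmt_acc h : nnmf h ->
  \int[pmt]_z pm_acc z (fun z' => h (z, z')) = \int[pi]_x \int[q x]_y pmJ h x y.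
Proof.
move=> nh; rewrite integral_pmt; last exact: measurable_pm_acc2.
apply: eq_integral => x _; have nf := nn_flow nh.
pose c1 (a : (R * X) * R) : E * E := ((x, a.1.1), (a.1.2, a.2)).
have mc1 : measurable_fun setT c1.
  apply: measurable_fun_pair; apply: measurable_fun_pair => //.
  - exact: measurableT_comp.
  - exact: measurableT_comp.
have n1 := nnmf_comp nf mc1.
have m1 := measurable_kernel_integral Q (@measurable_snd _ _ R X) n1.
transitivity (\int[Q x]_w \int[q x]_y \int[Q y]_u
    ((pm_flow (x, w) (y, u))%:E * h ((x, w), (y, u)))).
  apply: eq_integral => w _.
  rewrite -(daniellZ (daniell_pm_acc (x, w)) (pm_weight_ge0 (x, w)) (nnmf_pair1 (x, w) nh)).
  apply: eq_integral => y _; apply: eq_integral => u _.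
  by rewrite muleA -EFinM (mulrC (pm_accW _ _)) pm_flowE.
apply: (tonelli_prob
  (f := fun p => \int[Q p.2]_u ((pm_flow (x, p.1) (p.2, u))%:E * h ((x, p.1), (p.2, u))))) => //.
split=> [|p]; first exact: m1.
by apply: integral_ge0 => u _; exact: (nf.2 (_, _)).
Qed.

Lemma eq_pmJ h h' : (forall p, h p = h' p) ->
  \int[pi]_x \int[q x]_y pmJ h x y = \int[pi]_x \int[q x]_y pmJ h' x y.
Proof. by move=> hh'; have -> : h = h' by exact/funext. Qed.

(** Exchanging the two states together with their weights multiplies the flow
    by [r], which is what [tierney_swap] requires. *)
Lemma pmJ_sym h : nnmf h ->
  \int[pi]_x \int[q x]_y pmJ h x y = \int[pi]_x \int[q x]_y pmJ (fun p => h (p.2, p.1)) x y.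
Proof.
move=> nh; have ms : measurable_fun setT (fun p : E * E => (p.2, p.1)).
  by apply: measurable_fun_pair.
have nh' := nnmf_comp nh ms.
have off h' x y : ~ S (x, y) -> pmJ h' x y = 0.
  move=> nS; rewrite /pmJ integral0_eq// => w _; rewrite integral0_eq// => u _.
  by rewrite pm_flow_off// mul0e.
apply: (tierney_swap hr (A := fun p => pmJ h p.1 p.2)
  (B := fun p => pmJ (fun p => h (p.2, p.1)) p.1 p.2)) => //.
- exact: nnmf_pmJ.
- exact: (nnmf_pmJ nh').
- by move=> x y; exact: off.
- by move=> x y; exact: off.
move=> x y Sxy /=; have nf := nn_flow nh'.
pose c1 (a : R * R) : E * E := ((y, a.1), (x, a.2)).
have mc1 : measurable_fun setT c1 by apply: measurable_fun_pair; apply: measurable_fun_pair.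
have n1 := nnmf_comp nf mc1.
have m1 := measurable_kernel_integral (kernel_precomp Q (@measurable_cst _ _ R X setT x)) (@measurable_id _ _ _) n1.
rewrite /pmJ.
transitivity (\int[Q y]_w \int[Q x]_u ((pm_flow (x, u) (y, w))%:E * h ((x, u), (y, w)))).
  have nf' := nn_flow nh.
  pose c2 (a : R * R) : E * E := ((x, a.1), (y, a.2)).
  have mc2 : measurable_fun setT c2 by apply: measurable_fun_pair; apply: measurable_fun_pair.
  have n2 := nnmf_comp nf' mc2.
  exact: (tonelli_prob
    (f := fun p => (pm_flow (x, p.1) (y, p.2))%:E * h ((x, p.1), (y, p.2)))).
have g0 w u : 0 <= (pm_flow (y, w) (x, u))%:E * h ((x, u), (y, w)).
  exact: (nf.2 ((y, w), (x, u))).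
have gi0 w : [set: R] w -> 0 <= \int[Q x]_u ((pm_flow (y, w) (x, u))%:E * h ((x, u), (y, w))).
  by move=> _; apply: integral_ge0.
rewrite -(ge0_integralZl_EFin (Q y) measurableT gi0 m1 (r0 x y)).
apply: eq_integral => w _.
rewrite -(ge0_integralZl_EFin (Q x) measurableT (fun u _ => g0 w u) (nnmf_pair1 w n1).1 (r0 x y)).
apply: eq_integral => u _ /=.
by rewrite muleA -EFinM (@pm_flow_recip (x, u) (y, w)).
Qed.

Let mkint (K : R.-pker E ~> E) (g : E -> \bar R) : nnmf g -> nnmf (fun z => \int[K z]_y g y).
Proof.
move=> [mg g0]; split=> [|z]; last exact: integral_ge0.
by apply: measurable_fun_integral_kernel => // U mU; exact: measurable_kernel.
Qed.

Let rej0 z : (0 <= reject pm_acc z)%R.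
Proof. by apply: reject_ge0; [exact: daniell_pm_acc|exact: pm_acc_le1]. Qed.

Lemma integral_pmt_pmK (h : E * E -> \bar R) : nnmf h ->
  (forall z, nnmf (fun z' => h (z, z'))) ->
  nnmf (fun z => \int[pmK z]_z' h (z, z')) -> nnmf (fun z => h (z, z)) ->
  \int[pmt]_z \int[pmK z]_z' h (z, z') =
  \int[pi]_x \int[q x]_y pmJ h x y + \int[pmt]_z ((reject pm_acc z)%:E * h (z, z)).
Proof.
move=> nh nhz nK nd.
have nrej : nnmf (fun z => (reject pm_acc z)%:E).
  by apply: nnmf_EFin => //; exact: (measurable_reject measurable_pm_acc).
have nacc := measurable_pm_acc2 nh.
have nrd := nnmfM nrej nd.
rewrite -(integral_pmt_acc nh) -ge0_integralD//; last 4 first.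
- by move=> z _; exact: nacc.2.
- exact: nacc.1.
- by move=> z _; exact: nrd.2.
- exact: nrd.1.
apply: eq_integral_pmt => //; first exact: nnmfD.
by move=> z Wz; rewrite pmKE// integral_pm.
Qed.

Lemma pmt_reversible : reversible_model bounded (kop pmK) (fun f => \int[pmt]_z f z)%R.
Proof.
apply: reversible_of_nonneg; first exact: pmt_setT.
move=> f g bf bg f0 g0.
have expand (f' g' : E -> R) : bounded f' -> bounded g' -> (forall x, 0 <= f' x)%R -> (forall x, 0 <= g' x)%R ->
    \int[pmt]_z ((f' z)%:E * \int[pmK z]_y (g' y)%:E) =
    \int[pi]_x \int[q x]_y pmJ (fun p => (f' p.1)%:E * (g' p.2)%:E) x y +
    \int[pmt]_z ((reject pm_acc z)%:E * ((f' z)%:E * (g' z)%:E)).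
  move=> bf' bg' f0' g0'; have nf' := bounded_nnmf bf' f0'; have ng' := bounded_nnmf bg' g0'.
  have E1 z : (f' z)%:E * \int[pmK z]_y (g' y)%:E = \int[pmK z]_y ((f' z)%:E * (g' y)%:E).
    rewrite ge0_integralZl_EFin//; [by move=> y _; rewrite lee_fin|exact: ng'.1].
  rewrite (eq_integral (fun z => \int[pmK z]_y ((f' z)%:E * (g' y)%:E))); last first.
    by move=> z _; rewrite E1.
  apply: (integral_pmt_pmK (h := fun p => (f' p.1)%:E * (g' p.2)%:E)) => /=.
  - by apply: nnmfM; [exact: (nnmf_comp nf')|exact: (nnmf_comp ng')].
  - by move=> z; apply: nnmfM => //; apply: nnmf_cst; rewrite lee_fin.
  - rewrite (_ : (fun z => _) = (fun z => (f' z)%:E * \int[pmK z]_y (g' y)%:E)).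
      by apply: nnmfM => //; exact: mkint.
    by apply/funext => z; rewrite E1.
  - exact: nnmfM.
have e1 := expand _ _ bf bg f0 g0; have e2 := expand _ _ bg bf g0 f0.
have nh : nnmf (fun p : E * E => (f p.1)%:E * (g p.2)%:E).
  by apply: nnmfM; [exact: (nnmf_comp (bounded_nnmf bf f0))|exact: (nnmf_comp (bounded_nnmf bg g0))].
have e3 : \int[pi]_x \int[q x]_y pmJ (fun p => (f p.1)%:E * (g p.2)%:E) x y =
    \int[pi]_x \int[q x]_y pmJ (fun p => (g p.1)%:E * (f p.2)%:E) x y.
  apply: etrans (pmJ_sym nh) _.
  by apply: eq_pmJ => p /=; exact: muleC.
have e4 : \int[pmt]_z ((reject pm_acc z)%:E * ((f z)%:E * (g z)%:E)) =
    \int[pmt]_z ((reject pm_acc z)%:E * ((g z)%:E * (f z)%:E)).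
  by apply: eq_integral => z _; rewrite [X in _ * X]muleC.
exact: (etrans e1 (etrans (f_equal2 adde e3 e4) (esym e2))).
Qed.

Let m_pair_flow x w y : nnmf (fun u => (pm_flow (x, w) (y, u))%:E).
Proof.
apply: nnmf_EFin => [|u]; last exact: pm_flow_ge0.
apply: (measurableT_comp measurable_pm_flow (g := fun u => ((x, w), (y, u)))).
by apply: measurable_fun_pair => //; exact: pair1_measurable.
Qed.

Let m_flow1 x y : nnmf (fun w => \int[Q y]_u (pm_flow (x, w) (y, u))%:E).
Proof.
split=> [|w]; last by apply: integral_ge0 => u _; rewrite lee_fin pm_flow_ge0.
pose c1 (a : R * R) : E * E := ((x, a.1), (y, a.2)).
have mc1 : measurable_fun setT c1 by apply: measurable_fun_pair; apply: measurable_fun_pair.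
have n1 : nnmf (fun a => (pm_flow (c1 a).1 (c1 a).2)%:E).
  apply: nnmf_EFin => [|a]; last exact: pm_flow_ge0.
  exact: (measurableT_comp measurable_pm_flow mc1).
exact: (measurable_kernel_integral Q (@measurable_cst _ _ R X setT y) n1).
Qed.

Let nweight x : nnmf (fun w => (pm_weight (x, w))%:E).
Proof.
apply: nnmf_EFin => [|w]; last exact: pm_weight_ge0.
by apply: (measurableT_comp measurable_pm_weight); exact: pair1_measurable.
Qed.

(** Concavity of the minimum: the mean of [min(w, r u)] is at most the minimum
    of the means of [w] and [r u], which are [1] and [r]. *)
Lemma pm_flow_mass x y :
  \int[Q x]_w \int[Q y]_u (pm_flow (x, w) (y, u))%:E <= (Num.min 1 (r x y))%:E.
Proof.
have [h|h] := leP 1%R (r x y).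
- rewrite -(pm_weight_int x); apply: ge0_le_integral => //.
  + by move=> w _; exact: (m_flow1 x y).2.
  + exact: (m_flow1 x y).1.
  + exact: (nweight x).1.
  move=> w _; apply: (@le_trans _ _ (\int[Q y]_u (pm_weight (x, w))%:E)); last first.
    by rewrite integral_cst// Qprob mule1.
  apply: ge0_le_integral => //.
  + by move=> u _; exact: (m_pair_flow x w y).2.
  + exact: (m_pair_flow x w y).1.
  move=> u _; rewrite lee_fin /pm_flow /pm_weight /=.
  case: (indW w) => [Ww|->]; last by rewrite !mul0r.
  rewrite indW1// !mul1r; case: (indW u) => [Wu|->]; last by rewrite mul0r W0.
  by rewrite indW1// mul1r ge_min lexx.
- have -> : (r x y)%:E = \int[Q x]_w (r x y)%:E by rewrite integral_cst// Qprob mule1.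
  apply: ge0_le_integral => //.
  + by move=> w _; exact: (m_flow1 x y).2.
  + exact: (m_flow1 x y).1.
  move=> w _.
  have -> : (r x y)%:E = \int[Q y]_u ((r x y)%:E * (pm_weight (y, u))%:E).
    rewrite ge0_integralZl_EFin//; first by rewrite pm_weight_int mule1.
    + by move=> u _; exact: (nweight y).2.
    + exact: (nweight y).1.
  have nrw : nnmf (fun u => (r x y)%:E * (pm_weight (y, u))%:E).
    by apply: nnmfM => //; apply: nnmf_cst; rewrite lee_fin.
  apply: ge0_le_integral => //.
  + by move=> u _; exact: (m_pair_flow x w y).2.
  + exact: (m_pair_flow x w y).1.
  + exact: nrw.1.
  move=> u _; rewrite -EFinM lee_fin /pm_flow /pm_weight /=.
  case: (indW u) => [Wu|->]; last by rewrite mulr0 !mul0r mulr0.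
  rewrite (indW1 Wu) mulr1 mul1r; case: (indW w) => [Ww|->]; last first.
    by rewrite mul0r mulr_ge0// W0.
  by rewrite indW1// mul1r ge_min lexx orbT.
Qed.

Lemma pmJ_le (H : X -> X -> R) x y : (forall x y, 0 <= H x y)%R ->
  pmJ (fun p => (H p.1.1 p.2.1)%:E) x y <= (Num.min 1 (r x y))%:E * (H x y)%:E.
Proof.
move=> H0; rewrite [leRHS]muleC; apply: (@le_trans _ _
  ((H x y)%:E * \int[Q x]_w \int[Q y]_u (pm_flow (x, w) (y, u))%:E)); last first.
  by apply: lee_wpmul2l; [rewrite lee_fin|exact: pm_flow_mass].
rewrite -(ge0_integralZl_EFin (Q x) measurableT (fun w _ => (m_flow1 x y).2 w) (m_flow1 x y).1 (H0 x y)).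
rewrite le_eqVlt; apply/orP; left; apply/eqP; apply: eq_integral => w _.
rewrite -(ge0_integralZl_EFin (Q y) measurableT (fun u _ => (m_pair_flow x w y).2 u) (m_pair_flow x w y).1 (H0 x y)).
by apply: eq_integral => u _; rewrite muleC.
Qed.

Lemma bounded_fst (f : X -> R) : bounded f -> bounded (f \o fst : E -> R).
Proof.
move=> [mf [c fc]]; split; first exact: measurableT_comp.
by exists c => z; exact: fc.
Qed.

(** Both forms are half of the mean square increment of [f] over one step.
    Rejected moves contribute nothing, and accepted ones have a rate which,
    averaged over the weights, is at most that of the marginal kernel by
    [pm_flow_mass]. *)
Lemma pm_dirichlet_le (f : X -> R) : bounded f ->
  (\int[pmt]_z (f z.1 * (f z.1 - kop pmK (f \o fst) z)) <=
   \int[pi]_x (f x * (f x - kop (mh hr) f x)))%R.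
Proof.
move=> bf; have bf2 := bounded_fst bf.
have M1 := mh_reversible hr; have M2 := pmt_reversible.
have s1 : ((-1) ^+ 2 = 1 :> R)%R by rewrite sqrrN expr1n.
have D1 := dirichletE M1 bf s1; have D2 := dirichletE M2 bf2 s1.
have e1 : (\int[pi]_x (f x * (f x - kop (mh hr) f x)) =
    \int[pi]_x (f x * (f x + -1 * kop (mh hr) f x)))%R.
  by apply: eq_Rintegral => x _; rewrite mulN1r.
have e2 : (\int[pmt]_z (f z.1 * (f z.1 - kop pmK (f \o fst) z)) =
    \int[pmt]_z ((f \o fst) z * ((f \o fst) z + -1 * kop pmK (f \o fst) z)))%R.
  by apply: eq_Rintegral => x _; rewrite mulN1r.
rewrite e1 e2 -(ler_pM2l (ltr0Sn R 1)); apply: etrans (f_equal2 (fun a b : R => a <= b)%R D2 D1) _.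
pose H x y : R := ((f y + -1 * f x) * (f y + -1 * f x))%R.
have H0 x y : (0 <= H x y)%R by rewrite /H -expr2 sqr_ge0.
have bH x : bounded (H x).
  apply: dominated_mul; apply: (fun_add (@bounded_space _ X R)) => //; exact: bounded_cst.
have b1 : bounded (fun x => kop (mh hr) (H x) x).
  rewrite [X in dominated _ X](_ : _ = (fun x => (-1 * f x) ^+ 2 + 2 * (-1 * f x) * kop (mh hr) f x +
    kop (mh hr) (fun y => f y * f y) x)%R); last first.
    by apply/funext => x; exact: (esym (dirichlet_cst M1 bf s1 x)).
  have bNf : bounded (fun x => -1 * f x)%R by exact: (fun_scale (@bounded_space _ X R)).
  have bK g : bounded g -> bounded (kop (mh hr) g) by exact: (markov_fun (bounded_kop_markov _)).
  apply: (fun_add (@bounded_space _ X R)); last by apply: bK; exact: dominated_mul.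
  apply: (fun_add (@bounded_space _ X R)).
    exact: (dominated_mul bNf bNf).
  apply: dominated_mul; last exact: bK.
  exact: (fun_scale (@bounded_space _ X R)).
have b2 : bounded (fun z : E => kop pmK (fun z' => H z.1 z'.1) z).
  rewrite [X in dominated _ X](_ : _ = (fun z : E => (-1 * (f \o fst) z) ^+ 2 + 2 * (-1 * (f \o fst) z) * kop pmK (f \o fst) z +
    kop pmK (fun y => (f \o fst) y * (f \o fst) y) z)%R); last first.
    by apply/funext => z; exact: (esym (dirichlet_cst M2 bf2 s1 z)).
  have bNf := fun_scale (@bounded_space _ E R) (-1)%R bf2.
  have bK g : bounded g -> bounded (kop pmK g) by exact: (markov_fun (bounded_kop_markov _)).
  apply: (fun_add (@bounded_space _ E R)); last by apply: bK; exact: dominated_mul.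
  apply: (fun_add (@bounded_space _ E R)).
    exact: (dominated_mul bNf bNf).
  apply: dominated_mul; last exact: bK.
  exact: (fun_scale (@bounded_space _ E R)).
rewrite -lee_fin (EFin_Rintegral_bounded (probability_setT pi) b1) (EFin_Rintegral_bounded pmt_setT b2).
have mH : measurable_fun setT (fun p : X * X => H p.1 p.2).
  have mf := bf.1.
  by apply: measurable_funM; apply: measurable_funD; try apply: measurable_funM; try apply: measurableT_comp.
have mF : measurable_fun setT (fun p : E * E => (p.1.1, p.2.1)) by exact: measurable_fun_pair.
have nh : nnmf (fun p : E * E => (H p.1.1 p.2.1)%:E).
  by apply: nnmf_EFin => [|p]; [exact: (measurableT_comp mH mF)|exact: H0].
have bHz (z : E) : bounded (fun z' : E => H z.1 z'.1) by exact: (bounded_fst (bH z.1)).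
have KE (z : E) : (kop pmK (fun z' => H z.1 z'.1) z)%:E = \int[pmK z]_z' (H z.1 z'.1)%:E.
  exact: EFin_kop.
under eq_integral do rewrite KE.
have K0 (z : E) : (0 <= kop pmK (fun z' => H z.1 z'.1) z)%R by exact: kop_ge0.
have n1 (z : E) : nnmf (fun z' : E => (H z.1 z'.1)%:E).
  exact (bounded_nnmf (bHz z) (fun z' => H0 z.1 z'.1)).
have n2 : nnmf (fun z => \int[pmK z]_z' (H z.1 z'.1)%:E).
  rewrite (_ : (fun z => _) = (fun z => (kop pmK (fun z' => H z.1 z'.1) z)%:E)).
    exact: bounded_nnmf.
  by apply/funext => z; rewrite KE.
have n3 : nnmf (fun z : E => (H z.1 z.1)%:E).
  rewrite (_ : (fun z => _) = cst 0%E); first exact: nnmf_cst.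
  by apply/funext => z; rewrite /H /= mulN1r subrr mul0r.
rewrite (integral_pmt_pmK nh n1 n2 n3).
rewrite [X in _ + X]integral0_eq ?adde0; last first.
  by move=> z _; rewrite /H /= mulN1r subrr mul0r mule0.
apply: ge0_le_integral => //.
- by move=> x _; apply: integral_ge0 => y _; exact: (nnmf_pmJ nh).2 (x, y).
- exact: (measurable_kernel_integral q (@measurable_id _ _ _) (nnmf_pmJ nh)).
- by apply/measurable_EFinP; exact: b1.1.
move=> x _; rewrite EFin_kop// integral_mh; last exact: bounded_nnmf.
have Hxx : H x x = 0%R by rewrite /H mulN1r subrr mul0r.
rewrite Hxx mule0 adde0.
apply: ge0_le_integral => //.
- by move=> y _; exact: (nnmf_pmJ nh).2 (x, y).
- exact: (nnmf_pair1 x (nnmf_pmJ nh)).1.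
- apply: emeasurable_funM; first by apply/measurable_EFinP; exact: (measurable_fun_pair2 x (measurable_mh_min hr)).
  by apply/measurable_EFinP; exact: (bH x).1.
- by move=> y _; exact: pmJ_le.
Qed.

Let nind1 (A : set X) : measurable A -> nnmf (EFin \o \1_A : X -> \bar R).
Proof. exact: nnmf_indic. Qed.

Let naccW1 z y : nnmf (fun u => (pm_accW z (y, u))%:E).
Proof.
apply: nnmf_EFin => [|u]; last exact: pm_accW_ge0.
apply: (measurableT_comp measurable_pm_accW (g := fun u => (z, (y, u)))).
by apply: measurable_fun_pair => //; exact: pair1_measurable.
Qed.

Lemma pm_acc_fst z (h : X -> R) : measurable_fun setT h -> (forall y, 0 <= h y)%R ->
  pm_acc z (fun z' => (h z'.1)%:E) =
  \int[q z.1]_y ((h y)%:E * \int[Q y]_u (pm_accW z (y, u))%:E).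
Proof.
move=> mh0 h0; apply: eq_integral => y _.
rewrite -(ge0_integralZl_EFin (Q y) measurableT (fun u _ => (naccW1 z y).2 u) (naccW1 z y).1 (h0 y)).
by apply: eq_integral => u _; rewrite muleC.
Qed.

Let naccQ z : nnmf (fun y => \int[Q y]_u (pm_accW z (y, u))%:E).
Proof.
split=> [|y]; last by apply: integral_ge0 => u _; exact: (naccW1 z y).2.
have n1 : nnmf (fun p : X * R => (pm_accW z p)%:E).
  apply: nnmf_EFin => [|p]; last exact: pm_accW_ge0.
  exact: (measurable_fun_pair2 z measurable_pm_accW).
exact: (measurable_kernel_integral Q (@measurable_id _ _ _) n1).
Qed.

Lemma pm_accW_mass_le1 z y : \int[Q y]_u (pm_accW z (y, u))%:E <= 1.
Proof.
apply: (@le_trans _ _ (\int[Q y]_u 1%:E)); last by rewrite integral_cst// Qprob mule1.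
apply: ge0_le_integral => //.
- by move=> u _; exact: (naccW1 z y).2.
- exact: (naccW1 z y).1.
- by move=> u _; rewrite lee_fin (le_trans (pm_accW_le _ _))// indicE lern1 leq_b1.
Qed.

(** At a positive weight [w], the mean acceptance probability is at most the
    mean of [r u / w], that is [r / w]. *)
Lemma pm_accW_mass_le x w y : W w -> (0 < w)%R ->
  \int[Q y]_u (pm_accW (x, w) (y, u))%:E <= (Num.max 1 w^-1 * Num.min 1 (r x y))%:E.
Proof.
move=> Ww w0; set M := (Num.max 1 w^-1)%R.
have M1 : (1 <= M)%R by rewrite le_max lexx.
have [h|h] := leP 1%R (r x y).
  rewrite mulr1; apply: (le_trans (pm_accW_mass_le1 _ _)).
  by rewrite lee_fin.
have c0 : (0 <= w^-1 * r x y)%R by rewrite mulr_ge0// invr_ge0 ltW.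
apply: (@le_trans _ _ (w^-1 * r x y)%:E); last first.
  by rewrite lee_fin; apply: ler_wpM2r => //; rewrite le_max lexx orbT.
have -> : (w^-1 * r x y)%:E = \int[Q y]_u ((w^-1 * r x y)%:E * (pm_weight (y, u))%:E).
  rewrite (ge0_integralZl_EFin (Q y) measurableT (fun u _ => (nweight y).2 u) (nweight y).1 c0).
  by rewrite pm_weight_int mule1.
apply: ge0_le_integral => //.
- by move=> u _; exact: (naccW1 (x, w) y).2.
- exact: (naccW1 (x, w) y).1.
- by apply: emeasurable_funM => //; exact: (nweight y).1.
move=> u _; rewrite -EFinM lee_fin /pm_accW /pm_weight /pm_accept /= w0.
case: (indW u) => [Wu|->]; last by rewrite !mul0r mulr0.
by rewrite indW1// !mul1r ge_min -mulrA mulrC -mulrA lexx orbT.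
Qed.

Let ind_fst (A : set X) : (EFin \o (\1_(A `*` [set: R]) : E -> R)) = (fun z' : E => (\1_A z'.1 : R)%:E).
Proof.
apply/funext => z' /=; rewrite !indicE; congr (_%:R%:E); congr nat_of_bool.
by apply/idP/idP => /set_mem h; apply/mem_set; [case: h|split].
Qed.

Lemma pm_acc_le_q z A : measurable A ->
  pm_acc z (EFin \o (\1_(A `*` [set: R]) : E -> R)) <= q z.1 A.
Proof.
move=> mA; rewrite ind_fst pm_acc_fst//.
apply: (@le_trans _ _ (\int[q z.1]_y (\1_A y : R)%:E)); last by rewrite integral_indic// setIT.
apply: ge0_le_integral => //.
- by move=> y _; rewrite mule_ge0 ?lee_fin//; exact: (naccQ z).2.
- by apply: emeasurable_funM; [exact/measurable_EFinP|exact: (naccQ z).1].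
- exact/measurable_EFinP.
- move=> y _; rewrite -[leRHS]mule1; apply: lee_wpmul2l; first by rewrite lee_fin.
  exact: pm_accW_mass_le1.
Qed.

Lemma pm_acc_le_mh x w A : W w -> (0 < w)%R -> measurable A ->
  pm_acc (x, w) (EFin \o (\1_(A `*` [set: R]) : E -> R)) <=
  (Num.max 1 w^-1)%:E * mh_acc q r x (EFin \o \1_A).
Proof.
move=> Ww w0 mA; rewrite ind_fst pm_acc_fst//.
have M0 : (0 <= Num.max 1%R w^-1)%R by rewrite le_max ler01.
rewrite -(daniellZ (daniell_mh_acc hr x) M0 (nind1 mA)).
have nm : nnmf (fun y => (Num.min 1 (r x y))%:E).
  by apply: nnmf_EFin; [exact: (measurable_fun_pair2 x (measurable_mh_min hr))|exact: (mh_min_ge0 hr x)].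
apply: ge0_le_integral => //.
- by move=> y _; rewrite mule_ge0 ?lee_fin//; exact: (naccQ (x, w)).2.
- by apply: emeasurable_funM; [exact/measurable_EFinP|exact: (naccQ (x, w)).1].
- apply: emeasurable_funM; first exact: nm.1.
  by apply: emeasurable_funM => //; exact/measurable_EFinP.
- move=> y _ /=; rewrite muleCA muleA [leRHS]muleC -EFinM EFinM.
  apply: lee_wpmul2l; first by rewrite lee_fin.
  exact: pm_accW_mass_le.
Qed.

Let mhprob x : mh hr x setT = 1. Proof. exact: prob_kernel. Qed.

Let mh_set x A : measurable A ->
  mh hr x A = mh_acc q r x (EFin \o \1_A) + (reject (mh_acc q r) x)%:E * (\1_A x : R)%:E.
Proof.
by move=> mA; rewrite -(integral_mh hr x (nind1 mA)) integral_indic// setIT.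
Qed.

Lemma mh_acc_le_mh x A : measurable A -> mh_acc q r x (EFin \o \1_A) <= mh hr x A.
Proof.
move=> mA; rewrite mh_set// leeDl// mule_ge0 ?lee_fin//.
exact: (reject_ge0 (daniell_mh_acc hr) (mh_acc_le1 hr) x).
Qed.

(** A rejected proposal leaves the chain at [x], hence in [A]. *)
Lemma mh_ge_proposal x A : measurable A -> A x -> q x A <= mh hr x A.
Proof.
move=> mA Ax; have mC : measurable (~` A) by exact: measurableC.
have h : mh hr x (~` A) <= q x (~` A).
  rewrite mh_set// indicE memNset ?mule0 ?adde0; last by move=> /(_ Ax).
  apply: (le_trans (mh_acc_le hr x (nind1 mC))).
  by rewrite integral_indic// setIT.
have e1 := probability_setC (as_probability (mhprob x)) mA.
have e2 := probability_setC (as_probability (qprob x)) mA.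
have f1 := fin_num_measure (as_probability (mhprob x)) _ mA.
have f2 := fin_num_measure (as_probability (qprob x)) _ mA.
rewrite /as_probability /= in e1 e2 f1 f2.
move: h; rewrite [leLHS]e1 [leRHS]e2.
rewrite -(fineK f1) -(fineK f2) -!EFinB lee_fin lerD2l lerN2 => h'.
by move: (h'); rewrite -lee_fin (fineK f1) (fineK f2).
Qed.

Lemma pm_indic z (B : set E) : measurable B ->
  pm z B = pm_acc z (EFin \o (\1_B : E -> R)) + (reject pm_acc z)%:E * (\1_B z : R)%:E.
Proof.
by move=> mB; rewrite -(integral_pm z (nnmf_indic R mB)) integral_indic// setIT.
Qed.

Let pm_fst z A : measurable A ->
  pm z (A `*` setT) = pm_acc z (EFin \o (\1_(A `*` [set: R]) : E -> R)) +
    (reject pm_acc z)%:E * (\1_A z.1 : R)%:E.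
Proof.
move=> mA; have mAT : measurable (A `*` [set: R]) by exact: measurableX.
rewrite (pm_indic z mAT); apply: f_equal2 => //; apply: f_equal2 => //.
exact (congr1 (@^~ z) (ind_fst A)).
Qed.

(** A lower bound of the pseudo-marginal kernel at [(x, w)] cannot be
    transferred as such: its rejection probability depends on [w] and leaves
    the chain at the single point [(x, w)].  But that point is avoided by [A x
    {u | u <> w}], where only accepted moves count.  With two distinct
    weights, [A x R] is the union of two sets each of which avoids one of the
    two points. *)
Lemma mh_minor x w1 w2 (nu : probability E R) (eps : R) :
  W w2 -> w1 != w2 -> (0 < w2)%R -> (0 <= eps)%R ->
  (forall A, measurable A -> eps%:E * nu A <= pm (x, w1) A) ->
  (forall A, measurable A -> eps%:E * nu A <= pm (x, w2) A) ->
  forall A, measurable A ->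
    eps%:E * nu (A `*` setT) <= (Num.max 1 w2^-1 + 1)%:E * mh hr x A.
Proof.
move=> Ww2 w12 w20 eps0 h1 h2 A mA.
have M0 : (0 <= Num.max 1%R w2^-1)%R by rewrite le_max ler01.
have mAT : measurable (A `*` [set: R]) by exact: measurableX.
have mhA0 : 0 <= mh hr x A by exact: measure_ge0.
have k2 : pm_acc (x, w2) (EFin \o (\1_(A `*` [set: R]) : E -> R)) <= (Num.max 1%R w2^-1)%:E * mh hr x A.
  apply: (le_trans (pm_acc_le_mh x Ww2 w20 mA)).
  by apply: lee_wpmul2l; [rewrite lee_fin|exact: mh_acc_le_mh].
have [Ax|nAx] := pselect (A x); last first.
  apply: (le_trans (h2 _ mAT)); rewrite pm_fst//= indicE (memNset nAx) mule0 adde0.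
  apply: (le_trans k2); apply: lee_wpmul2r => //.
  by rewrite lee_fin lerDl.
(* D avoids the point (x, w2), and D' the point (x, w1) *)
pose D := A `*` [set~ w2]; pose D' := A `*` [set w2].
have mD : measurable D by apply: measurableX => //; exact: measurableC.
have mD' : measurable D' by exact: measurableX.
have DD : A `*` setT = D `|` D'.
  apply/seteqP; split => -[y u] /=.
    move=> [Ay _]; have [->|n] := pselect (u = w2); first by right.
    by left; split.
  by move=> [[]|[]].
have part (B : set E) w : measurable B -> B `<=` A `*` setT -> ~ B (x, w) ->
    pm (x, w) B <= pm_acc (x, w) (EFin \o (\1_(A `*` [set: R]) : E -> R)).
  move=> mB BA nB.
  rewrite (pm_indic (x, w) mB) indicE (memNset nB) mule0 adde0.
  apply: (daniell_le (daniell_pm_acc (x, w)) (nnmf_indic R mB) (nnmf_indic R mAT)).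
  move=> z; rewrite lee_fin !indicE ler_nat.
  by case: (boolP (z \in B)) => // /set_mem/BA h; rewrite (mem_set h).
apply: (@le_trans _ _ (eps%:E * (nu D + nu D'))).
  apply: lee_wpmul2l; first by rewrite lee_fin.
  by rewrite DD; apply: measureU2.
rewrite ge0_muleDr//.
rewrite EFinD ge0_muleDl ?lee_fin// mul1e; apply: leeD.
- apply: (le_trans (h2 _ mD)); apply: le_trans k2; apply: part => //.
  + by move=> [y u] [].
  + by move=> [_ /=]; apply.
- apply: (le_trans (h1 _ mD')); apply: (@le_trans _ _ (q x A)); last exact: mh_ge_proposal.
  apply: le_trans (pm_acc_le_q (x, w1) mA); apply: part => //.
  + by move=> [y u] [].
  + by move=> [_ /= e]; rewrite e eqxx in w12.
Qed.

Lemma weight_gt0 (x : X) : exists2 w, W w & (0 < w)%R.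
Proof.
apply: contrapT => h.
have e : \int[Q x]_(w in W) w%:E = 0.
  apply: integral0_eq => w Ww; apply: contrapT => w0; apply: h; exists w => //.
  by rewrite lt_neqAle (W0 Ww) andbT eq_sym; apply/eqP => w00; apply: w0; rewrite w00.
by move: (Qmean x); rewrite e => -[] /eqP; rewrite eq_sym oner_eq0.
Qed.

Lemma single_weight (x : X) w : W w -> (forall u, W u -> u = w) -> w = 1%R.
Proof.
move=> Ww Ws; have := Qmean x.
rewrite (eq_integral (cst w%:E)); last by move=> u /set_mem Wu /=; rewrite (Ws u Wu).
by rewrite integral_cst// QW mule1 => -[].
Qed.

Lemma pm_single w : W w -> (forall u, W u -> u = w) ->
  forall x A, measurable A -> pm (x, w) (A `*` setT) = mh hr x A.
Proof.
move=> Ww Ws x A mA.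
have e y : \int[Q y]_u (pm_accW (x, w) (y, u))%:E = (Num.min 1 (r x y))%:E.
  have m0 := mh_min_ge0 hr x y.
  rewrite (eq_integral (fun u => (Num.min 1 (r x y))%:E * (\1_W u : R)%:E)).
    rewrite ge0_integralZl_EFin//; last exact/measurable_EFinP.
    by rewrite integral_indic// setIT QW mule1.
  move=> u _; rewrite -EFinM; congr (_%:E); rewrite /pm_accW /pm_accept /=.
  case: (indW u) => [Wu|->]; last by rewrite mulr0 mul0r.
  have w1 := single_weight x Ww Ws.
  by rewrite (Ws u Wu) w1 ltr01 divr1 mulr1 mulrC.
have f (h : X -> R) : measurable_fun setT h -> (forall y, 0 <= h y)%R ->
    pm_acc (x, w) (fun z' => (h z'.1)%:E) = mh_acc q r x (EFin \o h).
  move=> mh0 h0; rewrite pm_acc_fst//; apply: eq_integral => y _.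
  by rewrite e muleC.
rewrite (pm_fst (x, w) mA) ind_fst f// mh_set//; apply: f_equal2 => //; apply: f_equal2 => //.
rewrite /reject; congr ((1 - fine _)%:E).
exact: (f (fun=> 1%R)).
Qed.

(** When all weights are equal, they equal one and the two kernels agree;
    otherwise two distinct weights are available, one of which is positive. *)
Lemma mh_small : (exists x : X, True) -> exists w1 w2 (c : R),
  [/\ W w1, W w2, (0 < c)%R & forall x (nu : probability E R) (eps : R), (0 <= eps)%R ->
  (forall A, measurable A -> eps%:E * nu A <= pm (x, w1) A) ->
  (forall A, measurable A -> eps%:E * nu A <= pm (x, w2) A) ->
  forall A, measurable A -> eps%:E * nu (A `*` setT) <= c%:E * mh hr x A].
Proof.
move=> [x0 _]; have [w2 Ww2 w20] := weight_gt0 x0.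
have [[w1 [Ww1 /eqP w12]]|n] := pselect (exists w1, W w1 /\ w1 <> w2).
  exists w1, w2, (Num.max 1%R w2^-1 + 1)%R; split => //.
    by rewrite ltr_wpDl// le_max ler01.
  move=> x nu eps eps0 h1 h2 A mA; exact: (mh_minor Ww2 w12 w20 eps0 h1 h2 mA).
have Ws u : W u -> u = w2 by move=> Wu; apply: contrapT => un; apply: n; exists u.
exists w2, w2, 1%R; split => // x nu eps eps0 h1 _ A mA.
rewrite mul1e -(pm_single Ww2 Ws x mA); apply: h1.
exact: measurableX.
Qed.

End pseudo_marginal.

Local Close Scope ereal_scope.

(** * Limits of autocovariances *)

Section sequences.
Context (R : realType).

Lemma cvg_bigsum (a : nat -> nat -> R) (l : nat -> R) n m :
  (forall k, a L k @[L --> \oo] --> l k) ->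
  \sum_(n <= k < m) a L k @[L --> \oo] --> \sum_(n <= k < m) l k.
Proof.
move=> al; elim: m => [|m IH].
  under eq_fun do rewrite big_geq//; rewrite big_geq//; exact: cvg_cst.
have [nm|mn] := leqP n m; last first.
  under eq_fun do rewrite big_geq//; rewrite big_geq//; exact: cvg_cst.
under eq_fun do rewrite big_nat_recr//=; rewrite big_nat_recr//=.
exact: (cvgD IH (al m)).
Qed.

Lemma cvgn_le_cst (u : nat -> R) (l c : R) : u n @[n --> \oo] --> l ->
  (forall n, u n <= c) -> l <= c.
Proof.
move=> ul uc; rewrite -(cvg_lim _ ul)//; apply: limr_le; first by apply/cvg_ex; exists l.
exact: nearW.
Qed.

Lemma cvgn_ge_cst (u : nat -> R) (l c : R) : u n @[n --> \oo] --> l ->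
  (forall n, c <= u n) -> c <= l.
Proof.
move=> /cvgN ul uc; rewrite -lerN2; apply: (cvgn_le_cst ul) => n.
by rewrite lerN2.
Qed.

Lemma cvgn_norm_le_cst (u : nat -> R) (l c : R) : u n @[n --> \oo] --> l ->
  (forall n, `|u n| <= c) -> `|l| <= c.
Proof. by move=> /cvg_norm ul uc; apply: (cvgn_le_cst ul). Qed.

Lemma cvg_half (u : nat -> R) (l : R) : u n @[n --> \oo] --> l ->
  u n./2 @[n --> \oo] --> l.
Proof.
move=> ul; apply: (cvg_comp _ _ _ ul).
move=> A [N _ NA]; exists N.*2 => // n /= h; apply: NA => /=.
by rewrite -(doubleK N); exact: half_leq.
Qed.

(** The partial sums of even length increase and are bounded; those of odd
    length differ from them by a term that vanishes. *)
Lemma series_cvg_of_pairs (a : nat -> R) (B : R) :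
  (forall m, \sum_(0 <= k < m + m) a k <= B) ->
  (forall k, 0 <= a (k + k)%N + a (k + k).+1) ->
  a (k + k)%N @[k --> \oo] --> 0 -> cvgn (series a).
Proof.
move=> sB p0 ev.
pose c m := \sum_(0 <= k < m + m) a k.
have cc : cvgn c.
  apply: nondecreasing_is_cvgn; last by exists B => _ [m _ <-]; exact: sB.
  apply/nondecreasing_seqP => m; rewrite /c addSn addnS !big_nat_recr//= ?leq_addr//.
  by rewrite -addrA lerDl; exact: p0.
have e n : series a n = c n./2 + (if odd n then a (n./2 + n./2)%N else 0).
  rewrite seriesEnat /c /= -{1}(odd_double_half n) -addnn.
  by case: (odd n); rewrite ?add0n ?addr0// add1n big_nat_recr.
rewrite (_ : series a = fun n => c n./2 + (if odd n then a (n./2 + n./2)%N else 0)).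
  apply/cvg_ex; exists (limn c + 0); apply: cvgD; first exact: cvg_half.
  apply/norm_cvg0P/(squeeze_cvgr (f := fun=> 0) (h := fun n => `|a (n./2 + n./2)%N|)).
  - by apply: nearW => n; rewrite normr_ge0/=; case: ifP => // _; rewrite normr0.
  - exact: cvg_cst.
  - by apply/norm_cvg0P; exact: (cvg_half ev).
by apply/funext => n; exact: e.
Qed.

Lemma series_cvg_of_tails (a : nat -> R) :
  (forall e, 0 < e -> exists n0 : nat, forall n m, (n0 <= n)%N ->
     `|\sum_(n <= k < n + m) a k| <= e) -> cvgn (series a).
Proof.
move=> tl; apply/cauchy_cvgP/cauchy_seriesP => e e0.
have [n0 h] := tl _ (divr_gt0 e0 (ltr0n _ 2)).
exists ([set n | (n0 <= n)%N], setT); first by split; [exists n0|exists 0%N].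
move=> [n m] /= [nn _]; apply: (@le_lt_trans _ _ (e / 2)).
  have [nm|mn] := leqP n m; first by have := h n (m - n)%N nn; rewrite subnKC.
  by rewrite (big_geq (ltnW mn)) normr0 divr_ge0// ltW.
by rewrite ltr_pdivrMr// ltr_pMr// ltr1n.
Qed.

Lemma ereal_cvg0 (u : nat -> \bar R) :
  (forall e : R, 0 < e -> exists n0 : nat, forall n, (n0 <= n)%N ->
     (0 <= u n <= e%:E)%E) -> u n @[n --> \oo] --> 0%E.
Proof.
move=> h; apply/fine_cvgP; split.
  have [n0 h1] := h _ ltr01; exists n0 => // n /= /h1 /andP[u0 u1].
  by rewrite ge0_fin_numE// (le_lt_trans u1)// ltry.
apply/cvgrPdist_le => e e0; have [n0 h1] := h _ e0; exists n0 => // n /= /h1 /andP[].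
by case: (u n) => [x||] //=; rewrite !lee_fin sub0r normrN => x0 xe; rewrite ger0_norm.
Qed.

End sequences.

Section l2.
Context (R : realType) (E : Type) (F : set (E -> R)) (T : (E -> R) -> E -> R)
  (I : (E -> R) -> R).
Hypothesis M : reversible_model F T I.

(** As [a_(2 k)] is a mean square, the parallelogram inequality applies, and
    the contribution of the difference is largest at [k = 0]. *)
Lemma acov_even_perturb k f g : F f -> F g ->
  acov T I f (k + k) <= 2 * acov T I g (k + k) + 2 * I (fun x => (f x - g x) ^+ 2).
Proof.
have sF := rm_space M; have mT := rm_markov M; have mI := rm_mean M; have FM := rm_mul M.
move=> Ff Fg; have Fu := fun_sub sF Ff Fg; set u := fun x => _ in Fu.
have Ti h : F h -> F (iter k T h) by exact: iter_fun.
have Fi h : F h -> F (fun x => iter k T h x * iter k T h x) by move=> /Ti ?; exact: FM.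
have -> : I (fun x => (f x - g x) ^+ 2) = acov T I u 0.
  by congr I; apply/funext => x; rewrite expr2.
apply: (@le_trans _ _ (2 * acov T I g (k + k) + 2 * acov T I u (k + k))).
  rewrite -!(acov_shift M)// -!(mean_scale mI)//; try exact: Fi.
  rewrite -(mean_add mI); try (apply: (fun_scale sF); exact: Fi).
  apply: (mean_le mI); first exact: Fi.
    by apply: (fun_add sF); apply: (fun_scale sF); exact: Fi.
  move=> x; rewrite (iter_sub sF mT k Ff Fg) /=.
  move: (iter k T f x) (iter k T g x) => p s.
  have := sqr_ge0 (p - 2 * s); rewrite expr2; lra.
have := acov_le M (k + k)%N Fu; rewrite ler_norml => /andP[_]; lra.
Qed.

(** The partial sum [s] of the [T^k f] has mean zero, so integrating the
    oscillation bound over [z'] bounds [|s z|] itself.  The class [F']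
    contains the weight functions, which are not bounded. *)
Lemma acov_tail_le (F' : set (E -> R)) (f A U : E -> R) (eps K c B : R) (n m : nat) :
  fun_space F' -> mean F' I -> F `<=` F' -> F f -> I f = 0 -> F' A -> F' U ->
  (forall z, 1 <= A z) -> (forall z, A z <= U z) ->
  (forall z, `|f z| * A z <= c * U z) -> I U <= B -> 0 <= eps -> 0 <= K -> 0 <= c ->
  (forall z z', \sum_(n <= k < n + m) iter k T f z - \sum_(n <= k < n + m) iter k T f z'
     <= eps * (A z + A z' + K)) ->
  `|\sum_(n <= k < n + m) acov T I f k| <= eps * (1 + B + K) * (c * B).
Proof.
move=> sF' mI' FF' Ff If0 FA FU A1 AU fAU IU eps0 K0 c0.
set s := fun z => \sum_(n <= k < n + m) iter k T f z => osc.
have sF := rm_space M; have mT := rm_markov M; have mI := rm_mean M.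
have Fk k : F (iter k T f) by exact: iter_fun.
have Fs : F s by exact: fun_sum.
have Is : I s = 0.
  rewrite /s (mean_sum sF mI)//; apply: big1 => k _.
  by rewrite (rm_inv_iter M).
have IA : I A <= B by apply: le_trans IU; exact: (mean_le mI').
have B0 : 0 <= B.
  apply: le_trans IU; apply: (mean_ge0 sF' mI') => // z.
  by rewrite (le_trans _ (AU z))// (le_trans _ (A1 z)).
have IAc a : I (fun z' => eps * (A z' + a)) <= eps * (B + a).
  have Fa : F' (fun=> a) by exact: fun_cst.
  rewrite (mean_scale mI'); last exact: (fun_add sF').
  by apply: ler_wpM2l => //; rewrite (mean_add mI')// (mean_cst sF' mI') lerD2r.
have sb z : `|s z| <= eps * (A z + B + K).
  have FAz : F' (fun z' => eps * (A z' + (A z + K))).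
    by apply: (fun_scale sF'); apply: (fun_add sF') => //; exact: fun_cst.
  have Fz : F' (fun=> s z) by exact: fun_cst.
  have Fs' : F' s by exact: FF'.
  rewrite ler_norml; apply/andP; split.
    have h : I (fun z' => s z' - s z) <= I (fun z' => eps * (A z' + (A z + K))).
      apply: (mean_le mI') => //; first exact: (fun_sub sF').
      by move=> z'; have := osc z' z; rewrite -/(s _) -/(s _) addrA.
    move: h; rewrite (mean_sub sF' mI')// Is (mean_cst sF' mI') => h.
    have := le_trans h (IAc _); rewrite (addrC B) -addrA (addrC K) addrA; lra.
  have h : I (fun z' => s z - s z') <= I (fun z' => eps * (A z' + (A z + K))).
    apply: (mean_le mI') => //; first exact: (fun_sub sF').
    by move=> z'; have := osc z z'; rewrite -/(s _) -/(s _) (addrC (A z)) addrA.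
  move: h; rewrite (mean_sub sF' mI')// Is (mean_cst sF' mI') => h.
  have := le_trans h (IAc _); rewrite (addrC B) -addrA (addrC K) addrA; lra.
have -> : \sum_(n <= k < n + m) acov T I f k = I (fun x => f x * s x).
  rewrite /acov -(mean_sum sF mI); last by move=> k; exact: (rm_mul M).
  by congr I; apply/funext => x; rewrite /s mulr_sumr.
set D := eps * (1 + B + K).
have D0 : 0 <= D by rewrite mulr_ge0// addr_ge0// addr_ge0.
have FDU : F' (fun z => (D * c) * U z) by exact: (fun_scale sF').
apply: (@le_trans _ _ (I (fun z => (D * c) * U z))); last first.
  by rewrite (mean_scale mI')// mulrA; apply: ler_wpM2l => //; exact: mulr_ge0.
apply: (mean_norm_le sF' mI') => //; first by apply: FF'; exact: (rm_mul M).
move=> z; rewrite normrM.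
apply: (@le_trans _ _ (`|f z| * (D * A z))).
  apply: ler_wpM2l => //; apply: (le_trans (sb z)); rewrite /D -[leRHS]mulrA.
  apply: ler_wpM2l => //; rewrite mulrDl mulrDl mul1r.
  by rewrite lerD// ?lerD2l// ler_peMr.
by rewrite mulrCA -mulrA; apply: ler_wpM2l.
Qed.

Lemma acov_center k f : F f ->
  acov T I (fun x => f x - I f) k = acov T I f k - I f ^+ 2.
Proof.
have sF := rm_space M; have mT := rm_markov M; have mI := rm_mean M; have FM := rm_mul M.
move=> Ff; set c := I f; have Fc : F (fun=> c) by exact: fun_cst.
have Fk : F (iter k T f) by exact: iter_fun.
rewrite /acov (iter_sub sF mT k Ff Fc) (iter_cst sF mT).
rewrite (_ : (fun x => _) = (fun x => f x * iter k T f x - c * f x - c * (iter k T f x - c))); last first.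
  by apply/funext => x; ring.
rewrite (mean_sub sF mI); last 2 first.
- by apply: (fun_sub sF); [exact: FM|exact: (fun_scale sF)].
- by apply: (fun_scale sF); exact: (fun_sub sF).
rewrite (mean_sub sF mI)//; last 2 first.
- exact: FM.
- exact: (fun_scale sF).
rewrite !(mean_scale mI)//; last exact: (fun_sub sF).
rewrite (mean_sub sF mI)// (mean_cst sF mI) (rm_inv_iter M)// -/c; ring.
Qed.

End l2.

Section dct.
Context d (T : measurableType d) (R : realType).

Lemma Rintegral_cvg (m : {measure set T -> \bar R}) (u_ : nat -> T -> R) (u D : T -> R) :
  (forall n, measurable_fun setT (u_ n)) ->
  (forall x, u_ n x @[n --> \oo] --> u x) ->
  m.-integrable setT (EFin \o D) -> (forall n x, `|u_ n x| <= D x) ->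
  m.-integrable setT (EFin \o u) /\
  (\int[m]_x u_ n x)%R @[n --> \oo] --> (\int[m]_x u x)%R.
Proof.
move=> mu_ uu iD uD.
have mu : measurable_fun setT u.
  by apply: (measurable_fun_cvg mu_) => x _; exact: uu.
have iu : m.-integrable setT (EFin \o u).
  apply: (le_integrable measurableT _ _ iD); first exact/measurable_EFinP.
  move=> x _; rewrite lee_fin (le_trans _ (ler_norm _))//.
  by apply: (cvgn_norm_le_cst (uu x)) => n; exact: uD.
split=> //; apply: fine_cvg; rewrite fineK; last exact: integrable_fin_num.
apply: (dominated_cvg measurableT (g := EFin \o D)) => //.
- by move=> n; apply/measurable_EFinP; exact: mu_.
- by move=> x _; apply: cvg_EFin; [exact: nearW|exact: uu].
- by move=> n x _; rewrite lee_fin; exact: uD.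
Qed.

Lemma integrable_sqr_lt (m : {measure set T -> \bar R}) (G : T -> R) :
  measurable_fun setT G -> (\int[m]_x (G x ^+ 2)%:E < +oo)%E ->
  m.-integrable setT (fun x => (G x ^+ 2)%:E).
Proof.
move=> mG iG; apply/integrableP; split.
  by apply/measurable_EFinP; exact: measurable_funX.
by under eq_integral do rewrite /= ger0_norm ?sqr_ge0//.
Qed.

End dct.

Section chain_limit.
Context dO (Om : measurableType dO) d (T : measurableType d) (R : realType).
Variables (m : {measure set T -> \bar R}) (K : R.-pker T ~> T)
  (Pr : probability Om R) (Z : nat -> {RV Pr >-> T}).
Hypothesis m1 : m setT = 1%E.
Hypothesis chain : markov_chain m (fun z A => K z A) Z.
Hypothesis M : reversible_model bounded (kop K) (fun f => \int[m]_x f x)%R.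

Let mZ n : measurable_fun setT (Z n). Proof. exact: measurable_funPT. Qed.
Let Pr1 : Pr setT = 1%E. Proof. exact: probability_setT. Qed.

(** Stationarity: the law of the initial state is invariant by reversibility. *)
Lemma chain_law n f : nnmf f -> (\int[Pr]_o f (Z n o) = \int[m]_x f x)%E.
Proof.
move=> nf; apply: (@eq_daniell _ _ _ (fun f => \int[Pr]_o f (Z n o))%E
  (fun f => \int[m]_x f x)%E) => //.
- have := daniell_weight (w := fun=> 1) (psi := Z n) (daniell_integral Pr)
    (measurable_cst _) (fun=> ler01) (mZ n).
  congr daniell; apply/funext => h; apply: eq_integral => w _.
  by rewrite mul1e.
- exact: daniell_integral.
move=> A mA.
have b1 : bounded ((fun=> 1) : T -> R) by exact: bounded_cst.
have bA : bounded (\1_A : T -> R).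
  by split=> //; exists 1 => x; rewrite mulr1 ger0_norm// indicE lern1 leq_b1.
have := chain_moment m1 chain n b1 bA.
under eq_Rintegral do rewrite mul1r.
under [X in _ = X]eq_Rintegral do rewrite mul1r.
rewrite (rm_inv_iter M n bA) => e; have := congr1 (@EFin R) e.
by rewrite (EFin_Rintegral_bounded Pr1 (bounded_comp Z n bA)) (EFin_Rintegral_bounded m1 bA).
Qed.

Variables (h_ : nat -> T -> R) (h G : T -> R).
Hypotheses (bh : forall L, bounded (h_ L)) (hh : forall x, h_ L x @[L --> \oo] --> h x).
Hypotheses (mG : measurable_fun setT G) (hG : forall L x, `|h_ L x| <= G x)
  (iG : (\int[m]_x (G x ^+ 2)%:E < +oo)%E).

(** By stationarity the product is dominated by [G(Z_0)^2 + G(Z_k)^2], which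
    is integrable. *)
Lemma chain_moment_cvg k :
  Pr.-integrable setT (fun w => (h (Z 0%N w) * h (Z k w))%:E) /\
  acov (kop K) (fun f => \int[m]_x f x)%R (h_ L) k @[L --> \oo] -->
    (\int[Pr]_w (h (Z 0%N w) * h (Z k w)))%R.
Proof.
have G0 x : 0 <= G x by apply: le_trans (hG 0 x).
have iGZ n : Pr.-integrable setT (fun w => (G (Z n w) ^+ 2)%:E).
  apply: (@integrable_sqr_lt _ _ _ Pr (fun w => G (Z n w))).
    exact: (measurableT_comp mG (mZ n)).
  rewrite (chain_law n (f := fun x => (G x ^+ 2)%:E))//.
  by apply: nnmf_EFin => [|x]; [exact: measurable_funX|exact: sqr_ge0].
have := @Rintegral_cvg _ _ _ Pr (fun L w => h_ L (Z 0%N w) * h_ L (Z k w))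
  (fun w => h (Z 0%N w) * h (Z k w)) (fun w => G (Z 0%N w) ^+ 2 + G (Z k w) ^+ 2).
case.
- move=> L; apply: measurable_funM.
    exact: (measurableT_comp (bh L).1 (mZ 0)).
  exact: (measurableT_comp (bh L).1 (mZ k)).
- by move=> w; apply: cvgM; exact: hh.
- exact: (integrableD measurableT (iGZ 0%N) (iGZ k)).
- move=> L w; rewrite normrM.
  have := ler_pM (normr_ge0 _) (normr_ge0 _) (hG L (Z 0%N w)) (hG L (Z k w)).
  move: (G0 (Z 0%N w)) (G0 (Z k w)).
  move: (G (Z 0%N w)) (G (Z k w)) => a b a0 b0 /le_trans; apply.
  by have := sqr_ge0 (a - b); rewrite sqrrB; have := mulr_ge0 a0 b0; lra.
move=> i1 c; split; first exact: i1.
move: c; under eq_fun do rewrite (chain_moment m1 chain k (bh _) (bh _)).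
exact.
Qed.

End chain_limit.

(** * Pseudo-marginal chains and their drift *)

Local Open Scope ereal_scope.

(** An inequality between measures of sets is one between integrals; both
    sides are written as measures, the left one being the image by [p] scaled
    by [c1]. *)
Lemma minorization_integral d1 (T1 : measurableType d1) d2 (T2 : measurableType d2)
    (R : realType) (m1 : {measure set T1 -> \bar R}) (m2 : {measure set T2 -> \bar R})
    (p : T1 -> T2) (c1 c2 : R) : measurable_fun setT p -> (0 <= c1)%R -> (0 <= c2)%R ->
  (forall A, measurable A -> c1%:E * m1 (p @^-1` A) <= c2%:E * m2 A) ->
  forall f, nnmf f -> c1%:E * \int[m1]_x f (p x) <= c2%:E * \int[m2]_x f x.
Proof.
move=> mp c10 c20 h f nf.
have D1 : daniell (fun f => \int[m1]_x (c1%:E * f (p x))).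
  exact: (daniell_weight (daniell_integral m1) (measurable_cst _) (fun=> c10) mp).
have D2 : daniell (fun f => \int[m2]_x (c2%:E * f x)).
  exact: (daniell_weight (daniell_integral m2) (measurable_cst _) (fun=> c20) (@measurable_id _ _ _)).
have le12 A : measurable A -> daniell_measure D1 A <= daniell_measure D2 A.
  move=> mA; rewrite /daniell_measure.
  have mpA : measurable (p @^-1` A) by rewrite -[X in measurable X]setTI; exact: mp.
  have nA := nnmf_indic R mA; have npA := nnmf_indic R mpA.
  rewrite (ge0_integralZl_EFin m1 measurableT (fun x _ => npA.2 x) npA.1 c10).
  rewrite (ge0_integralZl_EFin m2 measurableT (fun x _ => nA.2 x) nA.1 c20).
  by rewrite !integral_indic// !setIT; exact: h.
have := ge0_le_measure_integral le12 measurableT nf.2 nf.1.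
rewrite (integral_daniell D1 nf) (integral_daniell D2 nf).
rewrite (ge0_integralZl_EFin m1 measurableT (fun x _ => nf.2 (p x)) (measurableT_comp nf.1 mp) c10).
by rewrite (ge0_integralZl_EFin m2 measurableT (fun x _ => nf.2 x) nf.1 c20).
Qed.

Section pseudo_marginal_chain.
Context d (X : measurableType d) (R : realType).
Variables (pi : probability X R) (q : R.-pker X ~> X).
Variables (S : set (X * X)) (r : X -> X -> R).
Hypothesis hr : tierney_ratio pi q S r.
Variables (W : set R) (mW : measurable W) (W0 : forall w, W w -> (0 <= w)%R).
Variable Q : R.-pker X ~> R.
Hypothesis QW : forall x, Q x W = 1.
Hypothesis Qmean : forall x, \int[Q x]_(w in W) w%:E = 1.
Variables (wp : R) (Wwp : W wp).

Local Notation E := (X * R)%type.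
Local Notation P := (pm hr mW W0 Q).
Local Notation PK := (pmK hr mW W0 Q wp).
Local Notation mt := (pmt pi mW W0 Q).
Let D : set E := [set: X] `*` W.

Let mD : measurable D. Proof. exact: measurableX. Qed.

(** Proposed weights are restricted to [W]. *)
Lemma pm_weights z : W z.2 -> P z D = 1.
Proof.
move=> Wz; rewrite (pm_indic hr mW W0 Q z mD).
have n1 : nnmf (cst 1 : E -> \bar R) by apply: nnmf_cst; rewrite lee_fin.
have := integral_pm hr mW W0 Q z n1.
rewrite integral_cst// prob_kernel mul1e => ->; apply: f_equal2; last first.
  by rewrite /= indicE mem_set//; split.
apply: eq_integral => y _; apply: eq_integral => u _ /=.
have [Wu|nW] := pselect (W u); first by rewrite indicE mem_set//; split.
by rewrite /pm_accW indicE memNset//= mul0r !mul0e.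
Qed.

(** The chain stays in [X x W] almost surely, by induction on time, and there
    the two kernels agree. *)
Lemma pm_chain dO (Om : measurableType dO) (Pr : probability Om R)
    (Z : nat -> {RV Pr >-> E}) :
  markov_chain (pm_target W Q pi) (pm_kernel W Q q r) Z ->
  markov_chain mt (fun z A => PK z A) Z.
Proof.
move=> [init step].
have mZ n A : measurable A -> measurable (Z n @^-1` A).
  by move=> mA; rewrite -[X in measurable X]setTI; exact: measurable_funPT.
have step' n (As : nat -> set E) B : (forall i, measurable (As i)) -> measurable B ->
    let H := \bigcap_(i in `I_n.+1) (Z i @^-1` As i) in
    Pr (H `&` Z n.+1 @^-1` B) = \int[Pr]_(o in H) P (Z n o) B.
  move=> mAs mB H; rewrite (step n As B mAs mB).
  by apply: eq_integral => w _; rewrite pmE.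
have as_D n : Pr (Z n @^-1` D) = 1.
  elim: n => [|n IH].
    rewrite (init _ mD) -pmtE//.
    rewrite -(pmt_setT pi mW W0 Qmean).
    have := @eq_integral_pmt _ _ _ pi W mW W0 Q _ _ (nnmf_indic R mD) (nnmf_indic R (@measurableT _ E)).
    rewrite (integral_indic mt measurableT mD) (integral_indic mt measurableT measurableT).
    rewrite !setIT; apply=> z Wz.
    by rewrite /= !indicE !mem_set//; split.
  pose As i := if i == n then D else setT.
  have mAs i : measurable (As i) by rewrite /As; case: ifP.
  have := step' n As D mAs mD.
  have -> : \bigcap_(i in `I_n.+1) (Z i @^-1` As i) = Z n @^-1` D.
    apply/seteqP; split=> [w h|w h i _].
      by have := h n (ltnSn n); rewrite /As eqxx.
    by rewrite /As; case: eqP => // ->.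
  move=> /= h; apply/eqP; rewrite eq_le probability_le1 /=; last exact: mZ.
  rewrite -[X in X <= _]IH; apply: (@le_trans _ _ (Pr (Z n @^-1` D `&` Z n.+1 @^-1` D))).
    rewrite h (eq_integral (cst 1)); last by move=> w /set_mem [_ Ww]; rewrite pm_weights.
    by rewrite integral_cst ?mul1e//; exact: mZ.
  have mn := mZ n.+1 _ mD; have mI := measurableI _ _ (mZ n _ mD) mn.
  by apply: (le_measure Pr (mem_set mI) (mem_set mn)); exact: subIsetr.
split=> [A mA|n As B mAs mB H]; first by rewrite (init A mA) (pmtE pi mW W0 Q mA).
rewrite step'//.
have mH : measurable H by apply: fin_bigcap_measurable => // i _; exact: mZ.
have mk (k : R.-pker E ~> E) : measurable_fun H (fun w => k (Z n w) B).
  apply: (measurable_funS measurableT) => //.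
  exact: (measurableT_comp (measurable_kernel k B mB)).
apply: ae_eq_integral; [exact: mH|exact: (mk P)|exact: (mk PK)|].
exists (~` (Z n @^-1` D)); split.
- by apply: measurableC; exact: mZ.
- have /= := probability_setC Pr (mZ n _ mD); rewrite /= => ->.
  by rewrite as_D subee.
- move=> w /= nw; apply: contra_not nw => -[_ Ww] _.
  exact (congr1 (fun k : {measure set E -> \bar R} => k B) (esym (pmKE hr mW W0 Q wp Ww))).
Qed.

Variables (V : E -> R) (alpha b e : R) (ev : R -> R).
Hypothesis mV : measurable_fun D V.
Hypothesis V1 : forall x w, W w -> (1 <= V (x, w))%R.
Hypotheses (b0 : (0 <= b)%R) (e0 : (0 < e)%R).
Hypothesis drift : forall x w, W w ->
  \int[pm_kernel W Q q r (x, w)]_(z in D) (V z)%:E <=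
    (V (x, w) - e * V (x, w) `^ alpha + b)%:E.
Hypothesis minorization : forall v, (1 <= v)%R -> (0 < ev v)%R /\
  exists nu : probability E R, forall x w, W w -> (V (x, w) <= v)%R ->
    forall A, measurable A -> (ev v)%:E * nu A <= pm_kernel W Q q r (x, w) A.
Variable x0 : X.

Definition pmV (z : E) : R := V (pmp W wp z).

Let pmpE (z : E) : pmp W wp z = (z.1, (pmp W wp z).2). Proof. by []. Qed.

Lemma measurable_pmV : measurable_fun setT pmV.
Proof.
apply: (measurable_comp mD) => //; last exact: measurable_pmp.
by move=> _ [z _ <-]; split => //; exact: pmpW.
Qed.

Lemma pmV_ge1 z : (1 <= pmV z)%R.
Proof. by rewrite /pmV pmpE; apply: V1; exact: pmpW. Qed.

Let nV : nnmf (fun z => (pmV z)%:E).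
Proof.
apply: nnmf_EFin; first exact: measurable_pmV.
by move=> z; apply: le_trans (pmV_ge1 z).
Qed.

(** The kernel charges [X x W] only, where [pmV] is [V]. *)
Lemma pm_drift z : \int[PK z]_y (pmV y)%:E <= (pmV z - e * pmV z `^ alpha + b)%:E.
Proof.
have Wz := pmpW Wwp z.
apply: le_trans (drift z.1 Wz); rewrite -pmpE.
have mDc : measurable (~` D) by exact: measurableC.
have PDc : P (pmp W wp z) (~` D) = 0.
  have P1 : P (pmp W wp z) setT = 1 by exact: prob_kernel.
  have := probability_setC (as_probability P1) mD.
  rewrite /as_probability => hC; apply: etrans hC _.
  by rewrite pm_weights// subee.
have h := ge0_negligible_integral mDc measurableT nV.1 (fun y _ => nV.2 y) PDc.
rewrite le_eqVlt; apply/orP; left; apply/eqP; apply: etrans h _.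
rewrite setTD setCK; transitivity (\int[P (pmp W wp z)]_(y in D) (V y)%:E).
  by apply: eq_integral => y /set_mem [_ Wy]; rewrite /pmV pmp_id.
by apply: eq_set_function_integral => A mA; exact: pmE.
Qed.

Let V0 z : (0 <= pmV z)%R. Proof. by apply: le_trans (pmV_ge1 z). Qed.

Lemma pm_integrable z : (PK z).-integrable setT (EFin \o pmV).
Proof.
apply/integrableP; split; first exact: nV.1.
under eq_integral do rewrite /= ger0_norm//.
by apply: le_lt_trans (pm_drift z) _; rewrite ltry.
Qed.

(** Where the level set [V <= v] is empty the minorization is void and the
    measure of the hypothesis need not integrate [V]; evaluation at a point
    then serves as mean.  Otherwise [V] is integrable because the kernel at a
    point of the level set dominates the measure. *)
Lemma pm_drift_model : drift_model (dominated pmV) (kop PK) pmV alpha e b ev.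
Proof.
have dr z : (kop PK pmV z <= pmV z - e * pmV z `^ alpha + b)%R.
  rewrite -lee_fin /kop /Rintegral fineK; first exact: pm_drift.
  exact: (integrable_fin_num measurableT (pm_integrable z)).
split => //.
- by apply: dominated_space; exact: pmV_ge1.
- by move=> f B; apply: dominated_clamp; exact: pmV_ge1.
- apply: kop_markov; [exact: pmV_ge1|exact: pm_integrable|].
  exists (1 + b)%R => z; apply: (le_trans (dr z)).
  have := pmV_ge1 z; have : (0 <= e * pmV z `^ alpha)%R by rewrite mulr_ge0 ?powR_ge0// ltW.
  move: (pmV z) (e * _)%R => v y y0 v1.
  have := ler_wpM2l b0 v1; lra.
- exact: pmV_ge1.
- move=> s /andP[s0 s1]; split.
    by apply: (measurableT_comp (measurable_powR s)); exact: measurable_pmV.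
  exists 1%R => z; rewrite mul1r ger0_norm ?powR_ge0//.
  by rewrite -[leRHS](powRr1 (V0 z)); apply: ler_powR => //; exact: pmV_ge1.
move=> v v1; have [ev0 [nu nuP]] := minorization v1.
have nuK z : (pmV z <= v)%R -> forall f, nnmf f ->
    (ev v)%:E * \int[nu]_y f y <= \int[PK z]_y f y.
  move=> Vz f nf; have := @minorization_integral _ _ _ _ _ nu (PK z) id (ev v) 1
    (@measurable_id _ _ _) (ltW ev0) ler01 _ f nf.
  rewrite mul1e; apply => A mA; rewrite mul1e preimage_id.
  rewrite (_ : PK z A = P (pmp W wp z) A)// pmE// pmpE.
  by apply: nuP => //; exact: pmpW.
have [[z1 Vz1]|none] := pselect (exists z, (pmV z <= v)%R); last first.
  (* no point lies in the level set, so that any mean will do *)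
  exists (fun f => f (x0, wp)); first by split.
  by move=> z f Vz; exfalso; apply: none; exists z.
have iV : nu.-integrable setT (EFin \o pmV).
  apply/integrableP; split; first exact: nV.1.
  under eq_integral do rewrite /= ger0_norm//.
  have := nuK z1 Vz1 _ nV; case: (\int[nu]_y _) => [x||] //.
  + by rewrite ltry.
  + rewrite mulry gtr0_sg// mul1e => h.
    by have := le_lt_trans (le_trans h (pm_drift z1)) (ltry _); rewrite ltxx.
exists (fun f => \int[nu]_y f y)%R.
  by apply: dominated_mean => //; [exact: probability_setT|exact: pmV_ge1].
move=> z f Vz df f0.
have nf : nnmf (fun y => (f y)%:E) by apply: nnmf_EFin => //; exact: df.1.
have := nuK z Vz _ nf.
have i1 := dominated_integrable iV df; have i2 := dominated_integrable (pm_integrable z) df.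
rewrite -(fineK (integrable_fin_num measurableT i1)) -(fineK (integrable_fin_num measurableT i2)).
by rewrite -EFinM lee_fin.
Qed.

End pseudo_marginal_chain.

Local Close Scope ereal_scope.

(** * Centred truncations *)

Lemma sqr_diff_le (R : realFieldType) (a b c : R) : `|a| <= c -> `|b| <= c ->
  `|(a - b) ^+ 2| <= 4 * c ^+ 2.
Proof.
by move=> h1 h2; rewrite ger0_norm ?sqr_ge0//; move: h1 h2; rewrite !ler_norml => /andP[? ?] /andP[? ?]; nra.
Qed.

Section truncation.
Context d (T : measurableType d) (R : realType).
Variables (m : {measure set T -> \bar R}) (g : T -> R).
Hypotheses (m1 : m setT = 1%E) (mg : measurable_fun setT g)
  (g2 : (\int[m]_x (g x ^+ 2)%:E < +oo)%E).

Definition trunc (L : nat) (x : T) : R := Num.max (- L%:R) (Num.min L%:R (g x)).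

Lemma trunc_le L x : `|trunc L x| <= `|g x|.
Proof.
have L0 : (0 : R) <= L%:R by [].
rewrite /trunc; move: (L%:R : R) L0 => l l0.
rewrite ler_norml ge_max le_max.
have := ler_norm (g x); have := ler_norm (- g x); rewrite normrN => h1 h2.
apply/andP; split.
  by apply/orP; right; rewrite le_min; apply/andP; split; have := normr_ge0 (g x); lra.
apply/andP; split; first by have := normr_ge0 (g x); lra.
by rewrite ge_min h2 orbT.
Qed.

Lemma trunc_le_cst L x : `|trunc L x| <= L%:R.
Proof.
have L0 : (0 : R) <= L%:R by [].
rewrite /trunc; move: (L%:R : R) L0 => l l0.
rewrite ler_norml ge_max le_max lexx /= ge_min lexx /= andbT; lra.
Qed.

Lemma measurable_trunc L : measurable_fun setT (trunc L).
Proof. by apply: measurable_maxr => //; apply: measurable_minr. Qed.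

Lemma bounded_trunc L : bounded (trunc L).
Proof.
split; first exact: measurable_trunc.
by exists L%:R => x; rewrite mulr1; exact: trunc_le_cst.
Qed.

Lemma trunc_cvg x : trunc L x @[L --> \oo] --> g x.
Proof.
apply: cvg_near_cst.
near=> L; rewrite /trunc.
have : `|g x| <= L%:R by near: L; exact: nbhs_infty_ger.
by rewrite ler_norml => /andP[h1 h2]; rewrite (min_idPr h2); apply/max_idPr.
Unshelve. all: by end_near. Qed.

Let g2i := integrable_sqr_lt mg g2.

Lemma integrable_of_sqr : m.-integrable setT (EFin \o g).
Proof.
have b1 : bounded ((fun=> 1) : T -> R) by exact: bounded_cst.
have iD := integrableD measurableT (bounded_integrable m1 b1) g2i.
apply: (le_integrable measurableT _ _ iD); first exact/measurable_EFinP.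
move=> x _ /=; rewrite lee_fin [leRHS]ger0_norm; last by rewrite addr_ge0// sqr_ge0.
by rewrite -real_normK ?num_real//; have := sqr_ge0 (`|g x| - 1); have := sqr_ge0 `|g x|; nra.
Qed.

(** Centring after truncation keeps the mean equal to zero at every level. *)
Definition ctrunc L (x : T) : R := trunc L x - \int[m]_y trunc L y.
(** A bound for all centred truncations and for their limit. *)
Definition cenv (x : T) : R := `|g x| + \int[m]_y `|g y|.

Lemma bounded_ctrunc L : bounded (ctrunc L).
Proof.
apply: (fun_sub (@bounded_space _ T R)); first exact: bounded_trunc.
exact: bounded_cst.
Qed.

Lemma mean_ctrunc L : \int[m]_x ctrunc L x = 0.
Proof.
have mm := bounded_mean m1; have bt := bounded_trunc L.
by rewrite (mean_sub (@bounded_space _ T R) mm bt (@bounded_cst _ T R _)) (mean_cst (@bounded_space _ _ _) mm) subrr.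
Qed.

Let iabs : m.-integrable setT (fun x => `|g x|%:E).
Proof. exact: (integrable_norm integrable_of_sqr). Qed.

Lemma mean_abs_ge0 : 0 <= \int[m]_y `|g y|.
Proof. exact: Rintegral_ge0. Qed.

Lemma ctrunc_le L x : `|ctrunc L x| <= cenv x.
Proof.
apply: (le_trans (ler_normB _ _)); apply: lerD; first exact: trunc_le.
have it := bounded_integrable m1 (bounded_trunc L).
apply: (le_trans (le_normr_Rintegral measurableT it)).
apply: le_Rintegral => //; first exact: (integrable_norm it).
by move=> y _; exact: trunc_le.
Qed.

Lemma measurable_cenv : measurable_fun setT cenv.
Proof. by apply: measurable_funD => //; exact: measurableT_comp. Qed.

Lemma cenv_sqr : (\int[m]_x (cenv x ^+ 2)%:E < +oo)%E.
Proof.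
set c := \int[m]_y `|g y|.
have bc : bounded ((fun=> 2 * c ^+ 2) : T -> R) by exact: bounded_cst.
have i1 := integrableZl measurableT 2 g2i.
have iD := integrableD measurableT i1 (bounded_integrable m1 bc).
apply: le_lt_trans (_ : \int[m]_x (2 * g x ^+ 2 + 2 * c ^+ 2)%:E < +oo)%E; last first.
  by rewrite -ge0_fin_numE; [exact: (integrable_fin_num measurableT iD)|
    apply: integral_ge0 => x _; rewrite lee_fin addr_ge0// mulr_ge0// sqr_ge0].
apply: ge0_le_integral => //.
- by move=> x _; rewrite lee_fin sqr_ge0.
- by apply/measurable_EFinP; apply: measurable_funX; exact: measurable_cenv.
- apply/measurable_EFinP; apply: measurable_funD => //; apply: measurable_funM => //.
  exact: measurable_funX.
- move=> x _; rewrite lee_fin /cenv -/c -[in leRHS](real_normK (num_real (g x))).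
  by have := sqr_ge0 (`|g x| - c); nra.
Qed.

Lemma mean_trunc_cvg : \int[m]_y trunc L y @[L --> \oo] --> \int[m]_y g y.
Proof.
have [] := @Rintegral_cvg _ _ _ m trunc g (fun x => `|g x|) measurable_trunc trunc_cvg iabs.
  by move=> L y; exact: trunc_le.
by [].
Qed.

Lemma ctrunc_cvg x : ctrunc L x @[L --> \oo] --> g x - \int[m]_y g y.
Proof.
by apply: cvgB; [exact: trunc_cvg|exact: mean_trunc_cvg].
Qed.

Lemma ctrunc_sqr_cvg :
  \int[m]_x (g x - \int[m]_y g y - ctrunc L x) ^+ 2 @[L --> \oo] --> 0.
Proof.
pose c := \int[m]_y g y.
have := @Rintegral_cvg _ _ _ m (fun L x => (g x - c - ctrunc L x) ^+ 2) (fun=> 0)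
  (fun x => 4 * cenv x ^+ 2).
have mc L : measurable_fun setT (ctrunc L) by exact: (bounded_ctrunc L).1.
case.
- move=> L; apply: measurable_funX; apply: measurable_funB => //.
  exact: measurable_funB.
- move=> x; rewrite -[X in _ --> X](_ : (g x - c - (g x - c)) ^+ 2 = 0); last by rewrite subrr expr0n.
  have h : g x - c - ctrunc L x @[L --> \oo] --> g x - c - (g x - c).
    by apply: cvgB; [exact: cvg_cst|exact: ctrunc_cvg].
  by rewrite expr2; under eq_fun do rewrite expr2; exact: (cvgM h h).
- exact: (integrableZl measurableT 4 (integrable_sqr_lt measurable_cenv cenv_sqr)).
- move=> L x; apply: sqr_diff_le; last exact: ctrunc_le.
  by apply: (cvgn_norm_le_cst (@ctrunc_cvg x)) => k; exact: ctrunc_le.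
by move=> _; rewrite (mean_cst (@bounded_space _ _ _) (bounded_mean m1)).
Qed.

End truncation.

(** * Bounds uniform along the family of kernels *)

Section pseudo_marginal_family.
Context d (X : measurableType d) (R : realType).
Variables (pi : probability X R) (q : R.-pker X ~> X).
Variables (S : set (X * X)) (r : X -> X -> R).
Hypothesis hr : tierney_ratio pi q S r.
Variables (W : set R) (mW : measurable W) (W0 : forall w, W w -> 0 <= w).
Variable Q : nat -> R.-pker X ~> R.
Hypothesis QW : forall N x, Q N x W = 1%E.
Hypothesis Qmean : forall N x, (\int[Q N x]_(w in W) w%:E = 1)%E.
Local Notation E := (X * R)%type.
Variables (V : E -> R) (alpha bV epsV : R) (ev : R -> R) (N0 : nat).
Hypothesis mV : measurable_fun ([set: X] `*` W) V.
Hypothesis V1 : forall x w, W w -> 1 <= V (x, w).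
Hypotheses (alpha0 : 0 < alpha) (alpha1 : alpha <= 1) (bV0 : 0 <= bV) (epsV0 : 0 < epsV).
Hypothesis drift : forall N, (N0 <= N)%N -> forall x w, W w ->
  (\int[pm_kernel W (Q N) q r (x, w)]_(z in [set: X] `*` W) (V z)%:E <=
    (V (x, w) - epsV * V (x, w) `^ alpha + bV)%:E)%E.
Hypothesis minorization : forall N, (N0 <= N)%N -> forall v, 1 <= v -> 0 < ev v /\
  exists nu : probability E R, forall x w, W w -> V (x, w) <= v ->
    forall A, measurable A -> ((ev v)%:E * nu A <= pm_kernel W (Q N) q r (x, w) A)%E.
Variables (wp : R) (Wwp : W wp) (x0 : X).
Variables (g : X -> R) (lambda kappa Mg Bs : R).
Hypothesis mg : measurable_fun setT g.
Hypotheses (lambda0 : 0 <= lambda) (lambda1 : lambda < 1)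
  (kappa1 : kappa < 1) (Mg0 : 0 <= Mg).

Local Notation V' := (pmV W wp V).
Local Notation PK N := (pmK hr mW W0 (Q N) wp).
Local Notation mt N := (pmt pi mW W0 (Q N)).
Local Notation I1 := (fun f : X -> R => \int[pi]_x f x).
Local Notation I2 N := (fun f : E -> R => \int[mt N]_z f z).
Let eta := 1 - lambda * alpha.
Let U (z : E) : R := (`|g z.1| + 1) * V' z `^ eta.

Hypothesis gV : forall z : E, `|g z.1| <= Mg * V' z `^ (kappa * alpha * (1 - lambda)).
Hypothesis piV : forall N, (N0 <= N)%N -> (\int[mt N]_z (U z)%:E <= Bs%:E)%E.

Let pi1 : pi setT = 1%E. Proof. exact: probability_setT. Qed.
Let mt1 N : mt N setT = 1%E. Proof. exact: pmt_setT. Qed.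
Let V'1 z : 1 <= V' z. Proof. exact: (pmV_ge1 Wwp V1). Qed.
Let mV' : measurable_fun setT V'. Proof. exact: measurable_pmV. Qed.

Let eta0 : 0 <= eta.
Proof. by rewrite /eta subr_ge0; have := ler_pM lambda0 (ltW alpha0) (ltW lambda1) alpha1; rewrite mulr1. Qed.

Let eta1 : eta <= 1.
Proof. by rewrite /eta lerBlDr lerDl mulr_ge0// ltW. Qed.

Let A1 z : 1 <= V' z `^ eta.
Proof. by rewrite -[leLHS](powRr0 (V' z)); apply: ler_powR. Qed.

Let AU z : V' z `^ eta <= U z.
Proof. by rewrite /U ler_peMl ?lerDr// (le_trans _ (A1 z)). Qed.

Let U1 z : 1 <= U z. Proof. exact: le_trans (A1 z) (AU z). Qed.

Let mA : measurable_fun setT (fun z => V' z `^ eta).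
Proof. exact: (measurableT_comp (measurable_powR eta) mV'). Qed.

Let mU : measurable_fun setT U.
Proof.
apply: measurable_funM => //; apply: measurable_funD => //.
apply: measurableT_comp => //; exact: measurableT_comp.
Qed.

Let nU : nnmf (fun z => (U z)%:E).
Proof. by apply: nnmf_EFin => // z; apply: le_trans (U1 z). Qed.

Let iU N : (N0 <= N)%N -> (mt N).-integrable setT (EFin \o U).
Proof.
move=> NN; apply/integrableP; split; first exact: nU.1.
under eq_integral => z _ do rewrite /= ger0_norm ?(le_trans _ (U1 z))//.
by apply: le_lt_trans (piV NN) _; rewrite ltry.
Qed.

(** One factor [|g|] is bounded by [V^eta], because [kappa alpha (1 - lambda)
    <= 1 - lambda alpha]; the other one is kept. *)
Lemma weighted_second_moment : (\int[pi]_x (g x ^+ 2)%:E < +oo)%E.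
Proof.
have ng : nnmf (fun x => (g x ^+ 2)%:E).
  by apply: nnmf_EFin => [|x]; [exact: measurable_funX|exact: sqr_ge0].
rewrite -(pmt_marginal pi mW W0 (Qmean N0) ng).
apply: (@le_lt_trans _ _ (Mg%:E * \int[mt N0]_z (U z)%:E)%E); last first.
  apply: (@le_lt_trans _ _ (Mg%:E * Bs%:E)%E); last by rewrite -EFinM ltry.
  by apply: lee_wpmul2l; [rewrite lee_fin|exact: piV].
rewrite -(ge0_integralZl_EFin (mt N0) measurableT (fun z _ => nU.2 z) nU.1 Mg0).
apply: ge0_le_integral => //.
- by move=> z _; exact: ng.2.
- exact: (measurableT_comp ng.1 measurable_fst).
- by apply: emeasurable_funM => //; exact: nU.1.
move=> z _; rewrite -EFinM lee_fin -real_normK ?num_real// expr2.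
apply: (@le_trans _ _ (`|g z.1| * (Mg * V' z `^ eta))).
  apply: ler_wpM2l => //; apply: (le_trans (gV z)); apply: ler_wpM2l => //.
  apply: ler_powR => //; rewrite /eta.
  have h1 : kappa * (alpha * (1 - lambda)) <= 1 * (alpha * (1 - lambda)).
    by apply: ler_wpM2r; [rewrite mulr_ge0 ?subr_ge0// ltW|exact: ltW].
  by move: h1; rewrite mulrA mul1r => h1; apply: (le_trans h1); rewrite mulrBr mulr1 (mulrC alpha) lerD2r.
rewrite mulrCA; apply: ler_wpM2l => //; rewrite /U; apply: ler_wpM2r; first exact: powR_ge0.
by rewrite lerDl.
Qed.

Local Notation h_ := (ctrunc pi g).
Local Notation cG := (\int[pi]_y `|g y|).

Let g2 := weighted_second_moment.
Let bh L : bounded (h_ L). Proof. exact: (bounded_ctrunc pi mg). Qed.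
Let hh0 L : I1 (h_ L) = 0. Proof. exact: mean_ctrunc. Qed.
Let hcG L x : `|h_ L x| <= cenv pi g x. Proof. exact: (ctrunc_le pi1 mg g2). Qed.
Let cG0 : 0 <= cG. Proof. exact: mean_abs_ge0. Qed.

Lemma pmt_mean_fst N f : bounded f -> I2 N (f \o fst) = I1 f.
Proof.
move=> bf; have [c [c0 fc]] := bounded_shift bf.
have bc := @bounded_cst _ X R c; have bfc := fun_add (@bounded_space _ X R) bf bc.
have bf2 := bounded_fst bf; have bc2 := @bounded_cst _ E R c.
have m1 := bounded_mean pi1; have m2 := bounded_mean (mt1 N).
have e := congr1 fine (pmt_marginal pi mW W0 (Qmean N) (bounded_nnmf bfc fc)).
apply: (@addIr _ c).
rewrite -[X in _ + X = _](mean_cst (@bounded_space _ E R) m2 c) -(mean_add m2 bf2 bc2).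
by rewrite -[X in _ = _ + X](mean_cst (@bounded_space _ X R) m1 c) -(mean_add m1 bf bc).
Qed.

Let dm N : (N0 <= N)%N ->
  drift_model (dominated V') (kop (PK N)) V' alpha epsV bV ev.
Proof.
move=> NN; apply: pm_drift_model => //.
- exact: drift.
- exact: minorization.
Qed.

(** The oscillation bound of [uniform_tail] is homogeneous, so it applies to
    [h_ L] after division by a constant that does not depend on the level [L].
    The weight [V^eta] and the product of [|g| + 1] with it have integrals
    bounded uniformly in [N]. *)
Lemma uniform_acov_tail (eps : R) : 0 < eps -> exists n0 : nat,
  forall N, (N0 <= N)%N -> forall n m L, (n0 <= n)%N ->
  `|\sum_(n <= k < n + m) acov (kop (PK N)) (I2 N) (h_ L \o fst) k| <= eps.
Proof.
move=> eps0.
(* enlarging kappa keeps the hypothesis on g, and makes it positive *)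
pose kappa' := Num.max kappa 2^-1.
have kk' : kappa <= kappa' by rewrite le_max lexx.
have k'01 : 0 < kappa' < 1.
  by rewrite /kappa' lt_max gt_max kappa1 invr_gt0 ltr0n orbT /= invf_lt1 ?ltr1n.
have ev0 v : 1 <= v -> 0 < ev v by move=> v1; have [] := minorization (leqnn N0) v1.
have l01 : 0 <= lambda < 1 by rewrite lambda0.
have [K K0 tail] := uniform_tail alpha0 alpha1 epsV0 bV0 ev0 l01 k'01.
(* bounds the constant of h_ L whatever the level L; 1 makes it positive *)
pose M' := Mg + cG + 1.
have M'1 : 1 <= M' by rewrite /M' lerDr addr_ge0.
have M'0 : 0 < M' by exact: lt_le_trans M'1.
have Bs0 : 0 <= Bs.
  rewrite -lee_fin; apply: le_trans (piV (leqnn N0)); apply: integral_ge0 => z _; exact: nU.2.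
pose C0 := M' * (1 + Bs + K) * ((1 + cG) * Bs).
have C00 : 0 <= C0 by rewrite /C0 !mulr_ge0 ?addr_ge0// ltW.
pose eps' := eps / (C0 + 1).
have C1 : 0 < C0 + 1 by rewrite ltr_wpDl.
have eps'0 : 0 < eps' by rewrite divr_gt0.
have [n0 {}tail] := tail _ eps'0; exists n0 => N NN n m L nn.
have D := dm NN; have M2 := pmt_reversible hr mW W0 (Qmean N) wp.
have bhf : bounded (h_ L \o fst : E -> R) by exact: bounded_fst.
pose ff (z : E) : R := M'^-1 * h_ L z.1.
have bff : bounded ff by exact: (fun_scale (@bounded_space _ E R)).
have bdom f : bounded f -> dominated V' f.
  move=> [mf [c fc]]; split=> //; exists `|c| => z; apply: (le_trans (fc z)).
  by rewrite mulr1 (le_trans (ler_norm _))// ler_peMr.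
have bdomU f : bounded f -> dominated U f.
  move=> [mf [c fc]]; split=> //; exists `|c| => z; apply: (le_trans (fc z)).
  by rewrite mulr1 (le_trans (ler_norm _))// ler_peMr.
have ffV z : `|ff z| <= V' z `^ (kappa' * alpha * (1 - lambda)).
  rewrite /ff normrM ger0_norm ?invr_ge0 ?(ltW M'0)// ler_pdivrMl//.
  apply: (le_trans (hcG L z.1)); rewrite /cenv.
  have p1 : 1 <= V' z `^ (kappa' * alpha * (1 - lambda)).
    rewrite -[leLHS](powRr0 (V' z)); apply: ler_powR => //.
    by case/andP: k'01 => k0 _; rewrite !mulr_ge0 ?subr_ge0 ?(ltW k0)// ltW.
  have pp : V' z `^ (kappa * alpha * (1 - lambda)) <= V' z `^ (kappa' * alpha * (1 - lambda)).
    apply: ler_powR => //; rewrite -!mulrA; apply: ler_wpM2r => //.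
    by rewrite mulr_ge0 ?subr_ge0 ?ltW.
  have := le_trans (gV z) (ler_wpM2l Mg0 pp); have := ler_wpM2l cG0 p1.
  rewrite /M' !mulrDl mulr1 mul1r; lra.
have osc := tail _ _ _ _ D ff (bdom _ bff) ffV n m nn.
have hE : h_ L \o fst = (fun z : E => M' * ff z).
  by apply/funext => z /=; rewrite /ff mulrA mulfV ?mul1r// gt_eqF.
have itE k z : iter k (kop (PK N)) (h_ L \o fst) z = M' * iter k (kop (PK N)) ff z.
  by rewrite hE (iter_scale (rm_markov M2) k M' bff).
have sU : fun_space (dominated U) by exact: dominated_space.
have mmU : mean (dominated U) (I2 N) by apply: dominated_mean => //; exact: iU.
have H := @acov_tail_le _ _ _ _ _ M2 (dominated U) (h_ L \o fst) (fun z => V' z `^ eta) U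
  (M' * eps') K (1 + cG) Bs n m sU mmU bdomU bhf.
apply: le_trans (H _ _ _ A1 AU _ _ _ K0 _ _) _.
- by rewrite pmt_mean_fst//; exact: bh.
- split; first exact: mA.
  by exists 1 => z; rewrite mul1r ger0_norm ?powR_ge0.
- split; first exact: mU.
  by exists 1 => z; rewrite mul1r ger0_norm// (le_trans _ (U1 z)).
- move=> z; rewrite /U mulrA; apply: ler_wpM2r; first exact: powR_ge0.
  apply: (le_trans (hcG L z.1)); rewrite /cenv.
  have := mulr_ge0 cG0 (normr_ge0 (g z.1)); rewrite mulrDl mul1r mulrDr mulr1; lra.
- rewrite -lee_fin /Rintegral fineK; [exact: piV|exact: (integrable_fin_num measurableT (iU NN))].
- by rewrite mulr_ge0// ltW.
- by rewrite addr_ge0.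
- move=> z z'; rewrite !(eq_bigr _ (fun k _ => itE k _)) -!mulr_sumr -mulrBr -mulrA.
  by apply: ler_wpM2l; [exact: ltW|exact: osc].
rewrite (_ : _ * _ = eps * (C0 / (C0 + 1))); last by rewrite /eps' /C0; ring.
by rewrite ler_piMr ?(ltW eps0)// ler_pdivrMr// mul1r lerDl.
Qed.

Let M1 := mh_reversible hr.
Let M2 N := pmt_reversible hr mW W0 (Qmean N) wp.
Local Notation T1 := (kop (mh hr)).

(** A single pseudo-marginal kernel suffices for the comparison; its partial
    sums are bounded by their first terms and the uniform bound for the tails. *)
Lemma marginal_psum_bounded : exists B : R, forall L m,
  \sum_(0 <= k < m + m) acov T1 I1 (h_ L) k <= B.
Proof.
pose A0 := \int[pi]_x cenv pi g x ^+ 2.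
have iA0 := integrable_sqr_lt (measurable_cenv pi mg) (cenv_sqr pi1 mg g2).
have A00 : 0 <= A0 by apply: Rintegral_ge0 => x _; exact: sqr_ge0.
have [n0 tail] := uniform_acov_tail ltr01.
have bhf L : bounded (h_ L \o fst : E -> R) by exact: bounded_fst.
pose B2 := n0%:R * A0 + 1.
pose a L k := acov (kop (PK N0)) (I2 N0) (h_ L \o fst) k.
have ak L k : `|a L k| <= A0.
  apply: (le_trans (acov_le (M2 N0) k (bhf L))); rewrite /acov /=.
  have bhh : bounded (fun x => h_ L x * h_ L x : R) by exact: dominated_mul.
  rewrite (pmt_mean_fst N0 bhh); apply: le_Rintegral => //.
    exact: (bounded_integrable pi1 bhh).
  by move=> x _; rewrite -expr2 -real_normK ?num_real// lerXn2r ?nnegrE ?(le_trans _ (hcG L x)).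
have head L n : (n <= n0)%N -> `|\sum_(0 <= k < n) a L k| <= n0%:R * A0.
  move=> nn; apply: (le_trans (ler_norm_sum _ _ _)).
  apply: (@le_trans _ _ (\sum_(0 <= k < n) A0)); first exact: ler_sum.
  by rewrite big_const_nat subn0 iter_addr_0 -[leLHS]mulr_natl; apply: ler_wpM2r => //; rewrite ler_nat.
have s2 L n : `|\sum_(0 <= k < n) a L k| <= B2.
  have [nn|nn] := leqP n n0.
    by apply: (le_trans (head L n nn)); rewrite lerDl.
  rewrite (@big_cat_nat _ _ _ n0)//=; last exact: ltnW.
  apply: (le_trans (ler_normD _ _)); apply: lerD; first exact: head.
  have := tail N0 (leqnn _) n0 (n - n0)%N L (leqnn _).
  by rewrite subnKC// ltnW.
exists (3 * B2) => L m.
apply: (acov_psum_comparison (p := fst) M1 (M2 N0) (fun f => @bounded_fst _ X R f)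
  (pmt_mean_fst N0) (pm_dirichlet_le hr mW W0 (Qmean N0) wp) m (bh L) (s2 L)).
move=> e e0; have [n1 tail1] := uniform_acov_tail e0; exists n1.
have := tail1 N0 (leqnn _) (n1 + n1)%N 1%N L (leq_addr _ _).
by rewrite addn1 big_nat1 => /(le_trans (ler_norm _)).
Qed.

(** The points where [V] is below a level at both weights given by [mh_small];
    as the level grows, these sets exhaust the space. *)
Lemma marginal_small_sets (e : R) : 0 < e ->
  exists (dl : X -> R) (D : set X) (c : R) (nu : (X -> R) -> R),
  [/\ bounded dl, (forall z, D z /\ dl z = 1 \/ dl z = 0), 0 < c,
    mean bounded nu /\ (forall z f, D z -> bounded f -> (forall y, 0 <= f y) ->
      c * nu f <= T1 f z) & I1 (fun z => 1 - dl z) <= e].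
Proof.
move=> e0.
have [w1 [w2 [c [Ww1 Ww2 c0 mh_min]]]] :=
  mh_small hr mW W0 (QW N0) (Qmean N0) (ex_intro _ x0 I).
have mw w : W w -> measurable_fun setT (fun x : X => V (x, w)).
  move=> Ww; rewrite (_ : (fun x => V (x, w)) = (fun x => V' (x, w))).
    by apply: (measurableT_comp mV'); exact: measurable_fun_pair.
  by apply/funext => x; rewrite /pmV pmp_id.
(* levels n + 1, because the minorizations are given for levels at least 1 *)
pose D (n : nat) : set X := [set x | V (x, w1) <= n.+1%:R] `&` [set x | V (x, w2) <= n.+1%:R].
have mD n : measurable (D n).
  apply: measurableI.
    by rewrite -[X in measurable X]setTI; apply: measurable_fun_le => //; exact: mw.
  by rewrite -[X in measurable X]setTI; apply: measurable_fun_le => //; exact: mw.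
have [] := @Rintegral_cvg _ _ _ pi (fun n x => 1 - \1_(D n) x) (fun=> 0) (fun=> 1).
- by move=> n; apply: measurable_funB => //; exact: measurable_indic.
- move=> x; apply: cvg_near_cst; near=> n; rewrite indicE mem_set ?subrr//.
  split; rewrite /=.
    by apply: (@le_trans _ _ n%:R); [near: n; exact: nbhs_infty_ger|rewrite ler_nat].
  by apply: (@le_trans _ _ n%:R); [near: n; exact: nbhs_infty_ger|rewrite ler_nat].
- exact: (bounded_integrable pi1 (@bounded_cst _ X R 1)).
- by move=> n x; rewrite indicE; case: (_ \in _); rewrite ?subrr ?normr0 ?subr0 ?normr1.
move=> _; rewrite (mean_cst (@bounded_space _ X R) (bounded_mean pi1)).
move=> /cvgrPdist_le /(_ e e0) [n _ /(_ n (leqnn n))] /=; rewrite sub0r normrN => le_e.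
pose v : R := n.+1%:R.
have v1 : 1 <= v by rewrite /v ler1n.
have [ev0 [nu nuP]] := minorization (leqnn N0) v1.
exists (\1_(D n)), (D n), (ev v / c), (fun f => \int[nu]_z f z.1); split.
- split; first exact: measurable_indic.
  by exists 1 => x; rewrite mulr1 indicE; case: (_ \in _); rewrite ?normr0 ?normr1.
- move=> z; rewrite indicE; have [Dz|nD] := pselect (D n z).
    by left; rewrite mem_set.
  by right; rewrite memNset.
- by rewrite divr_gt0.
- have mnu := bounded_mean (probability_setT nu).
  have bf1 f : bounded f -> bounded (f \o fst : E -> R) by exact: bounded_fst.
  split.
    split=> [f1 f2 b1 b2|k f1 b1|f1 f2 b1 b2 le12|].
    + exact: (mean_add mnu (bf1 _ b1) (bf1 _ b2)).
    + exact: (mean_scale mnu k (bf1 _ b1)).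
    + exact: (mean_le mnu (bf1 _ b1) (bf1 _ b2) (fun z => le12 z.1)).
    + exact: (mean_one mnu).
  move=> z f [Dz1 Dz2] bf f0.
  rewrite mulrAC ler_pdivrMr// [leRHS]mulrC.
  have nf := bounded_nnmf bf f0.
  have nup w : W w -> V (z, w) <= v -> forall A, measurable A ->
      ((ev v)%:E * nu A <= pm hr mW W0 (Q N0) (z, w) A)%E.
    by move=> Ww Vw A mA'; rewrite pmE//; exact: nuP.
  have h := minorization_integral (@measurable_fst _ _ X R) (ltW ev0) (ltW c0) _ nf.
  have := h nu (mh hr z); rewrite -(EFin_kop _ z bf).
  rewrite -(EFin_Rintegral_bounded (probability_setT nu) (bf1 _ bf)) -!EFinM lee_fin; apply.
  move=> A mA'; rewrite (_ : fst @^-1` A = A `*` setT).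
    exact: (mh_min z nu (ev v) (ltW ev0) (nup w1 Ww1 Dz1) (nup w2 Ww2 Dz2) A mA').
  by apply/seteqP; split=> [[y u] //=|[y u] []].
- exact: (le_trans (ler_norm _) le_e).
Unshelve. all: by end_near. Qed.

Lemma marginal_even_vanishes L (e : R) : 0 < e -> exists n0 : nat,
  forall n, (n0 <= n)%N -> acov T1 I1 (h_ L) (n + n) <= e.
Proof.
move=> e0; have [B sB] := marginal_psum_bounded.
have [_ [c hc]] := bh L.
have c0 : 0 <= c by have := hc x0; rewrite mulr1; exact: le_trans.
apply: (acov_even_vanishes M1 marginal_small_sets (bh L) (hh0 L) c0 _ (sB L) e0).
by move=> z; rewrite -[leRHS]mulr1; exact: hc.
Qed.

Local Notation gb := (fun x : X => g x - \int[pi]_y g y).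
Let a L k := acov T1 I1 (h_ L) k.
Let al k : R := limn (a ^~ k).

Let hgb x : h_ L x @[L --> \oo] --> gb x.
Proof. exact: (ctrunc_cvg pi1 mg g2). Qed.

Lemma limit_acov_pair_ge0 k : cvgn (a ^~ (k + k)%N) -> cvgn (a ^~ (k + k).+1) ->
  0 <= al (k + k) + al (k + k).+1.
Proof.
move=> c1 c2; apply: (cvgn_ge_cst (cvgD c1 c2)) => L.
exact: (acov_pair_ge0 M1 k (bh L)).
Qed.

(** Choose the level [L] such that [h_ L] is close to its limit in mean
    square, and then [n] large for [h_ L]; [acov_even_perturb] transfers the
    bound to all higher levels and hence to the limit. *)
Lemma limit_acov_even_vanishes : (forall k, cvgn (a ^~ k)) ->
  al (k + k)%N @[k --> \oo] --> 0.
Proof.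
move=> ca; apply/cvgrPdist_le => e e0.
have := ctrunc_sqr_cvg pi1 mg g2 => /cvgrPdist_le /(_ (e / 8)).
case=> [|L _ /(_ L (leqnn L))]; first by rewrite divr_gt0.
rewrite /= sub0r normrN => dL.
have [n0 ev_] := marginal_even_vanishes L (divr_gt0 e0 (ltr0n _ 8)).
exists n0 => // n /= nn; rewrite sub0r normrN ger0_norm; last first.
  by apply: limr_ge => //; apply: nearW => L'; exact: (acov_even_ge0 M1 n (bh L')).
have [||||_ cc] := @Rintegral_cvg _ _ _ pi (fun L' x => (h_ L' x - h_ L x) ^+ 2)
  (fun x => (gb x - h_ L x) ^+ 2) (fun x => 4 * cenv pi g x ^+ 2).
- by move=> L'; apply: measurable_funX; apply: measurable_funB; [exact: (bh L').1|exact: (bh L).1].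
- move=> x; have h : h_ L' x - h_ L x @[L' --> \oo] --> gb x - h_ L x.
    by apply: cvgB; [exact: hgb|exact: cvg_cst].
  by rewrite expr2; under eq_fun do rewrite expr2; exact: (cvgM h h).
- exact: (integrableZl measurableT 4 (integrable_sqr_lt (measurable_cenv pi mg) (cenv_sqr pi1 mg g2))).
- by move=> L' x; apply: sqr_diff_le; exact: hcG.
apply: (@le_trans _ _ (2 * (e / 8) + 2 * \int[pi]_x (gb x - h_ L x) ^+ 2)); last first.
  by have := le_trans (ler_norm _) dL; lra.
have c2 : 2 * (e / 8) + 2 * \int[pi]_x (h_ L' x - h_ L x) ^+ 2 @[L' --> \oo] -->
    2 * (e / 8) + 2 * \int[pi]_x (gb x - h_ L x) ^+ 2.
  by apply: cvgD; [exact: cvg_cst|apply: cvgM; [exact: cvg_cst|exact: cc]].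
rewrite -(cvg_lim _ c2)//; apply: ler_lim => //; first by apply/cvg_ex; eexists; exact: c2.
apply: nearW => L'; apply: (le_trans (acov_even_perturb M1 n (bh L') (bh L))).
by rewrite lerD2r; apply: ler_wpM2l => //; exact: ev_.
Qed.

Lemma limit_acov_series_cvg : (forall k, cvgn (a ^~ k)) -> cvgn (series al).
Proof.
move=> ca; have [B sB] := marginal_psum_bounded.
apply: (@series_cvg_of_pairs _ al B).
- move=> m; apply: (@cvgn_le_cst _ (fun L => \sum_(0 <= k < m + m) a L k)) => [|L].
    by apply: cvg_bigsum => k; exact: ca.
  exact: sB.
- by move=> k; exact: limit_acov_pair_ge0.
- exact: limit_acov_even_vanishes.
Qed.

(** The value is defined through the limits of the autocovariances of the
    truncations, without reference to a chain; along a given chain these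
    limits exist and are the covariances. *)
Lemma marginal_iact : exists tau : R,
  forall (dO : measure_display) (Om : measurableType dO)
    (Pr : probability Om R) (Z : nat -> {RV Pr >-> X}),
  markov_chain pi (mh_kernel q r) Z -> has_iact pi Z g tau.
Proof.
exists (1 + 2 * ((limn (series al) - al 0) / fine 'V_pi[g])) => dO Om Pr Z [init step].
have chain : markov_chain pi (fun x A => mh hr x A) Z.
  split=> // n As B mAs mB H; rewrite (step n As B mAs mB).
  by apply: eq_integral => w _; rewrite mhE.
have Eg : fine 'E_pi[g] = \int[pi]_y g y by rewrite unlock.
have mabs : measurable_fun setT (fun x => `|g x|) by exact: measurableT_comp.
have iabs : (\int[pi]_x (`|g x| ^+ 2)%:E < +oo)%E.
  by under eq_integral do rewrite real_normK ?num_real//; exact: g2.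
have mom k := chain_moment_cvg pi1 chain M1 (bounded_trunc mg) (@trunc_cvg _ X R g) mabs
  (trunc_le g) iabs k.
have cak k : a L k @[L --> \oo] --> fine (joint_moment Z g k) - fine 'E_pi[g] ^+ 2.
  have aE L : a L k = acov T1 I1 (trunc g L) k - I1 (trunc g L) ^+ 2.
    exact: (acov_center M1 k (bounded_trunc mg L)).
  under eq_fun do rewrite aE; apply: cvgB.
    by have [_] := mom k; rewrite /joint_moment unlock.
  rewrite Eg expr2; under eq_fun do rewrite expr2.
  by have h := mean_trunc_cvg pi1 mg g2; exact: (cvgM h h).
have alE k : al k = fine (joint_moment Z g k) - fine 'E_pi[g] ^+ 2 by exact/cvg_lim.
have ca k : cvgn (a ^~ k) by apply/cvg_ex; eexists; exact: cak.
split=> [k|]; first by have [] := mom k.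
have sE n : \sum_(1 <= k < n.+1)
     ((fine (joint_moment Z g k) - fine 'E_pi[g] ^+ 2) / fine 'V_pi[g]) =
   (series al n.+1 - al 0) / fine 'V_pi[g].
  rewrite -mulr_suml; congr (_ / _).
  rewrite seriesEnat /= (big_ltn (ltn0Sn n)) addrAC subrr add0r.
  by apply: eq_bigr => k _; rewrite alE.
under eq_fun do rewrite sE.
apply: cvgD; first exact: cvg_cst.
apply: cvgM; first exact: cvg_cst.
apply: cvgM; last exact: cvg_cst.
apply: cvgB; last exact: cvg_cst.
by rewrite (cvg_shiftS (series al)); exact: limit_acov_series_cvg.
Qed.

Lemma pm_autocov_cvg N dO (Om : measurableType dO) (Pr : probability Om R)
    (Z : nat -> {RV Pr >-> E}) :
  markov_chain (pm_target W (Q N) pi) (pm_kernel W (Q N) q r) Z ->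
  let gbar := fun z : E => g z.1 - fine 'E_pi[g] in
  forall k, joint_moment_defined Z gbar k /\
    (acov (kop (PK N)) (I2 N) (h_ L \o fst) k @[L --> \oo] --> fine (joint_moment Z gbar k)).
Proof.
move=> chain gbar k.
have chain' := pm_chain hr mW W0 (Qmean N) wp chain.
have Eg : fine 'E_pi[g] = \int[pi]_y g y by rewrite unlock.
have nc : nnmf (fun x => (cenv pi g x ^+ 2)%:E).
  by apply: nnmf_EFin => [|x]; [apply: measurable_funX; exact: measurable_cenv|exact: sqr_ge0].
have iG : (\int[mt N]_z ((cenv pi g \o fst) z ^+ 2)%:E < +oo)%E.
  have := pmt_marginal pi mW W0 (Qmean N) nc => /= ->; exact: (cenv_sqr pi1 mg g2).
have mG : measurable_fun setT (cenv pi g \o fst : E -> R).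
  by apply: measurableT_comp => //; exact: measurable_cenv.
have hc (z : E) : (h_ L \o fst) z @[L --> \oo] --> gbar z by rewrite /gbar Eg; exact: hgb.
have [] := chain_moment_cvg (mt1 N) chain' (M2 N) (fun L => bounded_fst (bh L)) hc mG
  (fun L z => hcG L z.1) iG k.
by move=> i1 c1; split; [exact: i1|rewrite /joint_moment unlock; exact: c1].
Qed.

Lemma pm_uniform_tails : exists N0' : nat,
  forall (dO : nat -> measure_display) (Om : forall N, measurableType (dO N))
    (Pr : forall N, probability (Om N) R) (Z : forall N, nat -> {RV (Pr N) >-> E}),
  (forall N, (N0' <= N)%N ->
     markov_chain (pm_target W (Q N) pi) (pm_kernel W (Q N) q r) (Z N)) ->
  let gbar := fun z : E => g z.1 - fine 'E_pi[g] in
  let autocov := fun N k => fine (joint_moment (Z N) gbar k) in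
  [/\ forall N k, (N0' <= N)%N -> joint_moment_defined (Z N) gbar k,
      forall N, (N0' <= N)%N -> cvgn (series (autocov N)) &
      ereal_sup [set `| limn (fun m => \sum_(n <= k < m) autocov N k) |%:E
                   | N in [set N | (N0' <= N)%N]] @[n --> \oo] --> 0%E].
Proof.
exists N0 => dO Om Pr Z chain gbar autocov.
have lim_ N (NN : (N0 <= N)%N) := pm_autocov_cvg (chain N NN).
have tails e : 0 < e -> exists n0 : nat, forall N, (N0 <= N)%N -> forall n m, (n0 <= n)%N ->
    `|\sum_(n <= k < n + m) autocov N k| <= e.
  move=> e0; have [n0 h] := uniform_acov_tail e0; exists n0 => N NN n m nn.
  apply: (@cvgn_norm_le_cst _ (fun L => \sum_(n <= k < n + m)
     acov (kop (PK N)) (I2 N) (h_ L \o fst) k)) => [|L].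
    by apply: cvg_bigsum => k; have [] := lim_ N NN k.
  exact: h.
have cs N : (N0 <= N)%N -> cvgn (series (autocov N)).
  move=> NN; apply: series_cvg_of_tails => e e0; have [n0 h] := tails e e0.
  by exists n0 => n m nn; exact: h.
split=> //; first by move=> N k NN; have [] := lim_ N NN k.
apply: ereal_cvg0 => e e0; have [n0 h] := tails e e0; exists n0 => n nn; apply/andP; split.
  apply: (@le_trans _ _ (`| limn (fun m => \sum_(n <= k < m) autocov N0 k) |%:E)).
    by rewrite lee_fin.
  by apply: ereal_sup_ubound; exists N0 => //=.
apply: ge_ereal_sup => _ [N NN <-]; rewrite lee_fin.
apply: (@cvgn_norm_le_cst _ (fun m => \sum_(n <= k < m) autocov N k)) => [|m].
  by have := cs N NN; rewrite -(is_cvg_series_restrict n).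
have [nm|mn] := leqP n m; first by have := h N NN n (m - n)%N nn; rewrite subnKC.
by rewrite (big_geq (ltnW mn)) normr0 ltW.
Qed.

End pseudo_marginal_family.

(** * Passage to measures and conclusion *)

Lemma Lfun2_of_sqr d (T : measurableType d) (R : realType)
    (m : {measure set T -> \bar R}) (g : T -> R) : measurable_fun setT g ->
  (\int[m]_x (g x ^+ 2)%:E < +oo)%E -> g \in Lfun m 2%:E.
Proof.
move=> mg g2; apply/andP; split; apply: mem_set => //=.
rewrite /finite_norm unlock; apply: poweR_lty.
by under eq_integral do rewrite /= powR_mulrn// real_normK ?num_real//.
Qed.

(** The target gives no mass to weights outside [W]. *)
Lemma pm_target_integral d (X : measurableType d) (R : realType) (pi : probability X R)
    (W : set R) (mW : measurable W) (W0 : forall w, W w -> 0 <= w)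
    (Q : R.-pker X ~> R) (f f' : X * R -> \bar R) :
  nnmf f' -> (forall z, W z.2 -> f z = f' z) ->
  (\int[pmt pi mW W0 Q]_z f' z = \int[pm_target W Q pi]_(z in [set: X] `*` W) f z)%E.
Proof.
move=> nf ff.
have mD : measurable ([set: X] `*` W) by exact: measurableX.
have nfD : nnmf (fun z => f' z * (\1_([set: X] `*` W) z : R)%:E)%E.
  by apply: nnmfM => //; exact: nnmf_indic.
rewrite -(@eq_set_function_integral _ _ _ (pmt pi mW W0 Q)); last by move=> A mA; exact: pmtE.
rewrite [RHS]integral_mkcond (eq_integral_pmt pi mW W0 Q nf nfD); last first.
  by move=> z Wz; rewrite indicE mem_set ?mule1.
apply: eq_integral => z _; rewrite patchE indicE.
case: ifPn => [/set_mem [_ Wz]|_]; last by rewrite mule0.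
by rewrite mule1 ff.
Qed.

Theorem proposition25 (R : realType) (d : measure_display)
  (X : measurableType d) (pi : probability X R) (q : R.-pker X ~> X)
  (S : set (X * X)) (r : X -> X -> R) (hr : tierney_ratio pi q S r)
  (W : set R) (mW : measurable W) (W0 : forall w, W w -> 0 <= w)
  (Q : nat -> R.-pker X ~> R)
  (QW : forall N x, Q N x W = 1%E)
  (Qmean : forall N x, (\int[Q N x]_(w in W) w%:E = 1)%E)
  (V : X * R -> R) (mV : measurable_fun ([set: X] `*` W) V)
  (V1 : forall x w, W w -> 1 <= V (x, w))
  (C : set (X * R)) (mC : measurable C) (CW : C `<=` [set: X] `*` W)
  (VC : (ereal_sup [set (V z)%:E | z in C] < +oo)%E)
  (alpha bV epsV : R) (N0 : nat)
  (alpha0 : 0 < alpha) (alpha1 : alpha <= 1)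
  (bV0 : 0 <= bV) (epsV0 : 0 < epsV)
  (drift : forall N, (N0 <= N)%N -> forall x w, W w ->
     (\int[pm_kernel W (Q N) q r (x, w)]_(z in [set: X] `*` W) (V z)%:E
      <= (V (x, w) - epsV * V (x, w) `^ alpha + bV * \1_C (x, w))%:E)%E)
  (minorization : forall v, 1 <= v ->
     exists (nu : nat -> probability (X * R)%type R) (epsv : R),
       [/\ 0 < epsv, epsv <= 1,
        (forall N, (N0 <= N)%N -> nu N ([set: X] `*` W) = 1%E) &
        forall N, (N0 <= N)%N -> forall x w, W w -> V (x, w) <= v ->
        forall A, measurable A ->
          (epsv%:E * nu N A <= pm_kernel W (Q N) q r (x, w) A)%E])
  (g : X -> R) (mg : measurable_fun setT g)
  (lambda kappa : R)
  (lambda0 : 0 <= lambda) (lambda1 : lambda < 1)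
  (kappa0 : 0 <= kappa) (kappa1 : kappa < 1)
  (gV : (ereal_sup
     [set (`|g z.1| / V z `^ (kappa * alpha * (1 - lambda)))%:E
        | z in [set: X] `*` W] < +oo)%E)
  (piV : (ereal_sup
     [set \int[pm_target W (Q N) pi]_(z in [set: X] `*` W)
            ((`|g z.1| + 1) * V z `^ (1 - lambda * alpha))%:E
        | N in [set N | (N0 <= N)%N]] < +oo)%E) :
  (* the integrated autocorrelation time of g under P *)
  (g \in Lfun pi 2%:E /\
   exists tau : R,
     forall (dO : measure_display) (Om : measurableType dO)
       (Pr : probability Om R) (Z : nat -> {RV Pr >-> X}),
     markov_chain pi (mh_kernel q r) Z -> has_iact pi Z g tau)
  /\
  (* uniform decay of the tails of the autocovariance series *)
  (exists N0' : nat,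
     forall (dO : nat -> measure_display)
       (Om : forall N, measurableType (dO N))
       (Pr : forall N, probability (Om N) R)
       (Z : forall N, nat -> {RV (Pr N) >-> (X * R)%type}),
     (forall N, (N0' <= N)%N ->
        markov_chain (pm_target W (Q N) pi) (pm_kernel W (Q N) q r) (Z N)) ->
     let gbar := fun z : X * R => g z.1 - fine 'E_pi[g] in
     let autocov := fun N k => fine (joint_moment (Z N) gbar k) in
     [/\ forall N k, (N0' <= N)%N -> joint_moment_defined (Z N) gbar k,
         forall N, (N0' <= N)%N -> cvgn (series (autocov N)) &
         ereal_sup [set `| limn (fun m => \sum_(n <= k < m) autocov N k) |%:E
                      | N in [set N | (N0' <= N)%N]] @[n --> \oo] --> 0%E]).
Proof.
have [x0 _] : exists x : X, True.
  apply: contrapT => nX; have := probability_setT pi.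
  rewrite (_ : setT = set0) ?measure0; last first.
    by apply/seteqP; split=> x // _; apply: nX; exists x.
  by move=> /eqP; rewrite eq_sym onee_eq0.
have [wp Wwp] : exists w, W w.
  apply: contrapT => nW; have := QW 0%N x0.
  rewrite (_ : W = set0) ?measure0; last first.
    by apply/seteqP; split=> w // Ww; apply: nW; exists w.
  by move=> /eqP; rewrite eq_sym onee_eq0.
have drift' N : (N0 <= N)%N -> forall x w, W w ->
  (\int[pm_kernel W (Q N) q r (x, w)]_(z in [set: X] `*` W) (V z)%:E <=
    (V (x, w) - epsV * V (x, w) `^ alpha + bV)%:E)%E.
  move=> NN x w Ww; apply: (le_trans (drift N NN x w Ww)).
  by rewrite lee_fin lerD2l ler_piMr// indicE lern1 leq_b1.
(* the constants of the minorizations, chosen once and for all as a function of the level *)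
have [ev evP] : {ev : R -> R & forall v, 1 <= v -> 0 < ev v /\
    forall N, (N0 <= N)%N -> exists nu : probability (X * R)%type R,
      forall x w, W w -> V (x, w) <= v -> forall A, measurable A ->
      ((ev v)%:E * nu A <= pm_kernel W (Q N) q r (x, w) A)%E}.
  apply: (@choice _ _ (fun v e => 1 <= v -> 0 < e /\
    forall N, (N0 <= N)%N -> exists nu : probability (X * R)%type R,
      forall x w, W w -> V (x, w) <= v -> forall A, measurable A ->
      (e%:E * nu A <= pm_kernel W (Q N) q r (x, w) A)%E)) => v.
  have [v1|nv] := pselect (1 <= v); last by exists 0.
  have [nu [e [e0 e1 _ nuP]]] := minorization v v1.
  by exists e => _; split=> // N NN; exists (nu N) => x w Ww Vw; exact: nuP.
have minor' N : (N0 <= N)%N -> forall v, 1 <= v -> 0 < ev v /\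
  exists nu : probability (X * R)%type R, forall x w, W w -> V (x, w) <= v ->
    forall A, measurable A -> ((ev v)%:E * nu A <= pm_kernel W (Q N) q r (x, w) A)%E.
  by move=> NN v v1; have [e0 h] := evP v v1; split=> //; exact: h.
have sup_bound (A : set \bar R) : (ereal_sup A < +oo)%E ->
    exists2 B : R, 0 <= B & forall y, A y -> (y <= B%:E)%E.
  move=> supA; exists `|fine (ereal_sup A)| => // y Ay.
  have yA : (y <= ereal_sup A)%E by exact: ereal_sup_ubound.
  case: (ereal_sup A) supA yA => [b||] //= _ yb.
    by apply: (le_trans yb); rewrite lee_fin ler_norm.
  by move: yb; rewrite leeNy_eq => /eqP ->; rewrite leNye.
have [Mg Mg0 gM] := sup_bound _ gV.
have [Bs _ piB] := sup_bound _ piV.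
have V'1 := pmV_ge1 Wwp V1.
have gV' (z : X * R) : `|g z.1| <= Mg * pmV W wp V z `^ (kappa * alpha * (1 - lambda)).
  rewrite -ler_pdivrMr; last by rewrite powR_gt0// (lt_le_trans ltr01).
  rewrite -lee_fin; apply: gM; exists (pmp W wp z) => //.
  by split=> //; exact: pmpW.
have piV' N : (N0 <= N)%N ->
    (\int[pmt pi mW W0 (Q N)]_z ((`|g z.1| + 1) * pmV W wp V z `^ (1 - lambda * alpha))%:E <= Bs%:E)%E.
  move=> NN; apply: le_trans (piB _ (ex_intro2 _ _ N NN erefl)).
  rewrite le_eqVlt; apply/orP; left; apply/eqP; apply: pm_target_integral.
    apply: nnmf_EFin => [|z]; last by rewrite mulr_ge0// ?powR_ge0// addr_ge0.
    apply: measurable_funM; last first.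
      by apply: (measurableT_comp (measurable_powR _)); exact: measurable_pmV.
    apply: measurable_funD => //.
    by apply: measurableT_comp => //; exact: measurableT_comp.
  by move=> z Wz; rewrite /pmV pmp_id.
split; last first.
  exact: (pm_uniform_tails hr Qmean mV V1 alpha0 alpha1 bV0 epsV0 drift' minor' Wwp x0
    mg lambda0 lambda1 kappa1 Mg0 gV' piV').
split.
  apply: Lfun2_of_sqr => //.
  exact: (weighted_second_moment Qmean mV V1 alpha0 alpha1 Wwp mg lambda0 lambda1 kappa1 Mg0 gV' piV').
exact: (marginal_iact hr QW Qmean mV V1 alpha0 alpha1 bV0 epsV0 drift' minor' Wwp x0
    mg lambda0 lambda1 kappa1 Mg0 gV' piV').
Qed.
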